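(* There exists an absolute constant $C>0$ such that every $(n,d,\lambda)$-graph with $d/\lambda \ge C(\log n)^{1/3}$ contains a Hamilton cycle.
   Context: An $(n,d,\lambda)$-graph is an $n$-vertex $d$-regular graph whose second largest eigenvalue in absolute value (of its adjacency matrix) is at most $\lambda$. A Hamilton cycle is a cycle passing through all vertices of the graph. *)

(* Defs.v *)
From HB Require Import structures.
From mathcomp Require Import all_boot all_order all_algebra.
From mathcomp Require Import all_classical all_reals all_analysis.
Set Implicit Arguments. Unset Strict Implicit. Unset Printing Implicit Defensive.
Import Order.TTheory GRing.Theory Num.Theory.
Local Open Scope ring_scope.

Definition simple_graph (n : nat) (e : rel 'I_n) : Prop :=
  symmetric e /\ irreflexive e.

Definition regular (n : nat) (e : rel 'I_n) (d : nat) : Prop :=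
  forall v : 'I_n, #|[set w | e v w]| = d.

Definition adj_mx (R : realType) (n : nat) (e : rel 'I_n) : 'M[R]_n :=
  \matrix_(i, j) (e i j)%:R.

Definition second_abs_eig_le (R : realType) (n : nat) (A : 'M[R]_n) (lam : R)
  : Prop :=
  exists s : seq R,
    [/\ char_poly A = \prod_(x <- s) ('X - x%:P),
        sorted (fun x y => `|y| <= `|x|) s
      & `|s`_1| <= lam].

Definition ndl_graph (R : realType) (n d : nat) (lam : R) (e : rel 'I_n) : Prop :=
  [/\ simple_graph e, regular e d & second_abs_eig_le (adj_mx R e) lam].

Definition hamiltonian (n : nat) (e : rel 'I_n) : Prop :=
  exists p : seq 'I_n, perm_eq p (enum 'I_n) /\ cycle e p.

(* Main.v *)
Require Import Defs.
From HB Require Import structures.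
From mathcomp Require Import all_boot zify.
From mathcomp Require Import boolp.
Set Implicit Arguments. Unset Strict Implicit. Unset Printing Implicit Defensive.

(* By the expander mixing lemma, with g of order d/lambda, small sets expand by a factor g^2
   and sets X, Y with g^2 |X| |Y| > n^2 span an edge.  The Lovasz local lemma splits the
   vertices into three zones in which every vertex keeps a positive proportion of its
   neighbours.  A shortest cover of a zone by paths has at most n / g^8 paths: a rotation
   argument in the style of Krivelevich and Sudakov shortens any larger cover.

   In the third zone the Friedman-Pippenger embedding technique yields about n / g^8 disjoint
   ladders with two rails, in each of which a path A from u to z and an edge B from z' to v can
   be exchanged for a path from u to z' and an edge from z to v on the same vertices.  The ladders
   and the paths covering the second zone are strung on one path L, in which B of a ladder is
   joined to A of the next.  The vertices outside L are again covered by few paths.  Their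
   ends are linked to the ends of an equal number of pieces of L, after Posa rotations on both
   sides; on the side of L the pivots lie in the second zone, so that the ladders stay
   intact and every component keeps meeting a ladder.

   The result is a 2-factor.  If A and B of a ladder lie on different cycles, the exchange
   merges these cycles (by parity, u is connected to z and z' to v outside the ladder).
   After all exchanges A and B of each ladder, and hence all ladders, lie on one cycle, which
   is therefore a Hamilton cycle. *)

(** * Lists and their consecutive pairs *)

(** The exponent [1/3] comes from a balance between ladders and covering paths. After the linking
    every cycle must meet a ladder, so cutting [L] into as many pieces as there are paths outside
    takes about as many ladders as paths. Four rotations multiply a set of path ends by about [g^8],
    which gives covers by at most [n / g^8] paths. Prescribed vertices are connected by paths of
    length of order [log n]; a ladder whose rails and rungs are such paths has order [(log n)^2]
    vertices. Once [g^3] is at least of order [log n], this is at most [g^6], so all ladders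
    together occupy about [n / g^2] vertices and fit into a zone. The degree may be as small as
    order [(log n)^(2/3)]. A cover by paths is encoded throughout as a single list, cut at its
    non-adjacent consecutive pairs. *)

Section Lists.
Variable T : eqType.
Implicit Types (q a b I : seq T) (x y w : T).

Definition prs q := zip q (behead q).

Arguments prs : simpl never.

Definition adj q x y := ((x, y) \in prs q) || ((y, x) \in prs q).

Lemma adjC q x y : adj q x y = adj q y x.
Proof. by rewrite /adj orbC. Qed.

Lemma prs_cons2 x y q : prs [:: x, y & q] = (x, y) :: prs (y :: q).
Proof. by []. Qed.

Lemma prs_cat x a y b :
  prs ((x :: a) ++ (y :: b)) = prs (x :: a) ++ (last x a, y) :: prs (y :: b).
Proof.
elim: a x => [|z a IH] x //.
by have := IH z; rewrite /prs /= => ->.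
Qed.

Lemma prs_rcons2 q x y : prs (rcons (rcons q x) y) = rcons (prs (rcons q x)) (x, y).
Proof.
case: q => [|z q] //.
have := prs_cat z (rcons q x) y [::].
by rewrite !cats1 -!rcons_cons last_rcons.
Qed.

Lemma prs_rev q : prs (rev q) = rev [seq (p.2, p.1) | p <- prs q].
Proof.
elim: q => [|x [|y q] IH] //.
have -> : rev [:: x, y & q] = rcons (rcons (rev q) y) x by rewrite !rev_cons.
by rewrite prs_rcons2 -rev_cons IH prs_cons2 map_cons rev_cons.
Qed.

Lemma adj_rev q x y : adj (rev q) x y = adj q x y.
Proof.
rewrite /adj prs_rev !mem_rev orbC.
have E z t : ((z, t) \in [seq (p.2, p.1) | p <- prs q]) = ((t, z) \in prs q).
  by rewrite (mem_map (f := fun p => (p.2, p.1)) _ _ (t, z)) // => -[? ?] [? ?] [-> ->].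
by rewrite !E.
Qed.

Lemma prs_mem q x y : (x, y) \in prs q -> x \in q /\ y \in q.
Proof.
elim: q => [|z [|t q] IH] //.
rewrite prs_cons2 inE => /orP[/eqP[-> ->]|/IH[xq yq]]; rewrite !inE ?eqxx ?orbT //.
by move: xq yq; rewrite !inE => -> ->; rewrite !orbT.
Qed.

Lemma prsP q x y : reflect (exists a b, q = a ++ [:: x, y & b]) ((x, y) \in prs q).
Proof.
apply: (iffP idP) => [|[a] [b] ->]; last first.
  by case: a => [|z a]; rewrite ?cat0s ?prs_cat ?mem_cat prs_cons2 !inE eqxx ?orbT.
elim: q => [|z [|t q] IH] //.
rewrite prs_cons2 inE => /orP[/eqP[-> ->]|/IH[a] [b] ->]; first by exists [::], q.
by exists (z :: a), b.
Qed.

Lemma adj_mem q x y : adj q x y -> x \in q /\ y \in q.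
Proof. by case/orP => /prs_mem []. Qed.

Lemma uniq_prs_l q x y z : uniq q -> (x, y) \in prs q -> (x, z) \in prs q -> y = z.
Proof.
elim: q => [|t [|u q] IH] //.
rewrite prs_cons2 !inE cons_uniq => /andP[tq uq].
case/orP => [/eqP[xt ->]|xy] /orP[/eqP[xt' ->]|xz] //.
- by have [] := prs_mem xz; rewrite xt (negbTE tq).
- by have [] := prs_mem xy; rewrite xt' (negbTE tq).
- exact: IH.
Qed.

Lemma uniq_prs_r q x y z : uniq q -> (y, x) \in prs q -> (z, x) \in prs q -> y = z.
Proof.
move=> uq yx zx; have H p : p \in prs q -> (p.2, p.1) \in prs (rev q).
  by move=> pq; rewrite prs_rev mem_rev (map_f (fun p => (p.2, p.1))).
by apply: (@uniq_prs_l (rev q) x); rewrite ?rev_uniq // (H (_, _)).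
Qed.

Lemma uniq_tri q w x y z : uniq q -> infix [:: x; w; y] q -> adj q w z -> z = x \/ z = y.
Proof.
move=> uq /infixP[a] [b] E; have xw : (x, w) \in prs q.
  by apply/prsP; exists a, (y :: b); rewrite E.
have wy : (w, y) \in prs q by apply/prsP; exists (rcons a x), b; rewrite E -cats1 -catA.
by case/orP => [wz|zw]; [right; apply: uniq_prs_l wz wy|left; apply: uniq_prs_r zw xw].
Qed.

(* A pivot outside the block leaves the block contiguous. *)
Lemma infix_split I a w b : w \notin I -> infix I (a ++ w :: b) -> infix I a \/ infix I b.
Proof.
move=> wI /infixP[p] [s] E.
have [le|gt] := leqP (size p + size I) (size a).
  left; have := congr1 (take (size a)) E.
  rewrite take_size_cat // => ->; rewrite catA take_cat size_cat ltnNge le /=.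
  by apply/infixP; exists p; eexists; rewrite catA.
have [le|lt] := ltnP (size a) (size p).
  right; have := congr1 (drop (size a).+1) E.
  rewrite -cat_rcons drop_cat size_rcons ltnn subnn drop0 => ->.
  rewrite drop_cat; case: ltnP => h; apply/infixP; first by eexists; exists s; reflexivity.
  have -> : (size a).+1 - size p = 0 by lia.
  by rewrite drop0; exists [::], s.
have nE := congr1 (fun l => nth w l (size a)) E.
rewrite /= !nth_cat ltnn subnn /= in nE; move: nE.
rewrite ltnNge lt /=; have -> : size a - size p < size I by lia.
by move=> nE; case/negP: wI; rewrite [X in X \in _]nE mem_nth //; lia.
Qed.

(** The vertices of [I] are removed one at a time, each as a point outside [J]. This places two
    intact blocks on different sides of a cut. *)
Lemma infix_disj J I p s : J != [::] -> I != [::] -> {in I, forall x, x \notin J} ->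
  infix J (p ++ I ++ s) -> infix J p \/ infix J s.
Proof.
move=> J0; case: I => // w I _ dis.
have H : forall I s, {in I, forall x, x \notin J} -> infix J (I ++ s) -> infix J s.
  elim=> // {dis}x {}I IH {}s dis /(@infix_split J [::] x (I ++ s) (dis _ (mem_head _ _))).
  case=> [|/IH]; first by rewrite infixs0 (negbTE J0).
  by apply => y yI; apply: dis; rewrite inE yI orbT.
rewrite cat_cons => /(infix_split (dis _ (mem_head _ _)))[|/H]; first by left.
by move=> h; right; apply: h => x xI; apply: dis; rewrite inE xI orbT.
Qed.

Lemma infix_rev I q : infix (rev I) (rev q) = infix I q.
Proof.
apply/infixP/infixP => -[p] [s] E; exists (rev s), (rev p); last by rewrite E !rev_cat catA.
by rewrite -[q]revK E !rev_cat revK catA.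
Qed.

End Lists.

(** * Rotations *)

Module Graph.
Section Graphs.
Variables (T : finType) (e : rel T).
Implicit Types (q a b I : seq T) (x y w : T) (X Y A : {set T}).

Definition dg x Y := #|[set y in Y | e x y]|.

(** Ordered pairs are counted, so an edge inside [X :&: Y] counts twice, as in the expander mixing
    lemma. *)
Definition edges X Y := \sum_(x in X) dg x Y.

(* What the proof uses of an (n,d,lambda)-graph; [g ^ 2] is of order
   (d / (kap lambda)) ^ 2. *)
Record pseudorandom (d kap g : nat) : Prop := {
  pr_sym : symmetric e;
  pr_irr : irreflexive e;
  pr_reg : forall x, #|[set y | e x y]| = d;
  pr_expand : forall X Y, d * #|X| <= kap * edges X Y ->
    #|T| <= 2 * kap * #|Y| \/ g ^ 2 * #|X| <= #|Y|;
  pr_spread : forall X Y, 2 * #|T| * edges X Y <= d * #|X| * #|Y| ->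
    g ^ 2 * #|X| * #|Y| <= #|T| ^ 2 }.

Lemma dg_sub x X Y : X \subset Y -> dg x X <= dg x Y.
Proof.
move=> XY; apply: subset_leq_card; apply/subsetP => y; rewrite !inE.
by case/andP => /(subsetP XY) -> ->.
Qed.

Lemma edges_ge c X Y : (forall x, x \in X -> c <= dg x Y) -> c * #|X| <= edges X Y.
Proof. by move=> h; rewrite mulnC -sum_nat_const; apply: leq_sum. Qed.

Lemma dg_setD x X Y : dg x X <= dg x (X :\: Y) + #|Y|.
Proof.
rewrite addnC -leq_subLR /dg.
have -> : [set y in X :\: Y | e x y] = [set y in X | e x y] :\: Y.
  by apply/setP => y; rewrite !inE andbA.
by rewrite cardsD leq_sub2l // subset_leq_card // subsetIr.
Qed.

(** Cutting a list at its [nel q] non-edges leaves [nel q + 1] paths (for a non-empty list), so few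
    non-edges mean a cover by few paths. *)
Definition nel q := count (fun p => ~~ e p.1 p.2) (prs q).

Lemma nel_cat x a y b :
  nel ((x :: a) ++ (y :: b)) = nel (x :: a) + ~~ e (last x a) y + nel (y :: b).
Proof. by rewrite /nel prs_cat count_cat /= addnA. Qed.

Lemma nel_rev q : symmetric e -> nel (rev q) = nel q.
Proof.
move=> se; rewrite /nel prs_rev count_rev count_map; apply: eq_count => p /=.
by rewrite se.
Qed.

Lemma rev_last x a : exists b, rev (x :: a) = last x a :: b /\ last (last x a) b = x.
Proof.
case: (lastP a) => [|c z]; first by exists [::].
exists (rev (x :: c)); rewrite last_rcons -rcons_cons rev_rcons; split=> //.
by rewrite rev_cons last_rcons.
Qed.

(** A rotation trades the pair in front of the pivot [w] for the edge [s w]. It never increases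
    [nel], and in a list with minimal [nel] the pair given up must be an edge. *)
Lemma nel_rot s a w b : symmetric e -> e s w ->
  nel (rev (s :: a) ++ w :: b) + ~~ e (last s a) w = nel ((s :: a) ++ w :: b).
Proof.
move=> se sw; have [c [E L]] := rev_last s a.
by rewrite E !nel_cat L sw /= -E nel_rev //; lia.
Qed.

Lemma adj_cat x a y b u v : adj ((x :: a) ++ (y :: b)) u v =
  [|| adj (x :: a) u v, adj (y :: b) u v,
      (u == last x a) && (v == y) | (u == y) && (v == last x a)].
Proof.
rewrite /adj !prs_cat !mem_cat !inE !xpair_eqE.
by move: (_ == y) (_ == y) (_ == last _ _) (_ == last _ _) (_ \in _) (_ \in _) (_ \in _) (_ \in _)
  => [] [] [] [] [] [] [] [].
Qed.

Lemma adj_rot s a w b x y : adj (rev (s :: a) ++ w :: b) x y ->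
  adj ((s :: a) ++ w :: b) x y \/ (x = s /\ y = w) \/ (x = w /\ y = s).
Proof.
have [c [E L]] := rev_last s a; rewrite E !adj_cat -E adj_rev L.
by case/or4P => [->|->|/andP[/eqP-> /eqP->]|/andP[/eqP-> /eqP->]]; rewrite ?orbT; auto.
Qed.

Inductive reach A q : seq T -> Prop :=
| reach0 : reach A q q
| reachS s a w b : reach A q ((s :: a) ++ w :: b) -> w \in A -> e s w ->
    reach A q (rev (s :: a) ++ w :: b).

Lemma reach_perm A q q' : reach A q q' -> perm_eq q' q.
Proof.
elim=> // s a w b _ IH _ _; apply: perm_trans IH.
by rewrite perm_cat2r perm_rev.
Qed.

Lemma reach_last A q q' z : reach A q q' -> last z q' = last z q.
Proof. by elim=> // s a w b _ <- _ _; rewrite !last_cat. Qed.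

Lemma reach_nel A q q' : symmetric e -> reach A q q' -> nel q' <= nel q.
Proof.
by move=> se; elim=> // s a w b _ IH _ sw; have := nel_rot a b se sw; lia.
Qed.

Definition nbh q X := [set y | [exists x in X, adj q x y]].

Lemma card_nbh q X : uniq q -> #|nbh q X| <= 2 * #|X|.
Proof.
move=> uq; pose f x := odflt x [pick y | (x, y) \in prs q].
pose h x := odflt x [pick y | (y, x) \in prs q].
suff /subset_leq_card H : nbh q X \subset [set f x | x in X] :|: [set h x | x in X].
  apply: leq_trans H _; apply: leq_trans (leq_card_setU _ _) _.
  by rewrite mul2n -addnn leq_add // leq_imset_card.
apply/subsetP => y; rewrite !inE => /existsP[x /andP[xX /orP[xy|xy]]]; apply/orP.
  left; apply/imsetP; exists x => //; rewrite /f; case: pickP => [z xz|/(_ y)]; last by rewrite xy.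
  exact: uniq_prs_l xy xz.
right; apply/imsetP; exists x => //; rewrite /h; case: pickP => [z xz|/(_ y)]; last by rewrite xy.
exact: uniq_prs_r xy xz.
Qed.

Lemma mem_nbh q X x y : x \in X -> adj q x y -> y \in nbh q X.
Proof. by move=> xX xy; rewrite inE; apply/existsP; exists x; rewrite xX. Qed.

Definition heads A q := [set v | `[< exists q', reach A q (v :: q') >]].

(* Posa's lemma: if the end [s] is adjacent to a pivot [w] outside
   [heads :|: nbh q heads], then no edge at [w] has changed, and rotating at [w]
   makes a [q]-neighbour of [w] a head, a contradiction. *)
Lemma posa d kap g A (Gd : {set T}) s0 q0 : pseudorandom d kap g -> 1 < g ->
  let q := s0 :: q0 in uniq q -> s0 \in Gd ->
  (forall w, w \in A -> w \in Gd /\ w \in q /\ forall y, adj q w y -> y \in Gd) ->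
  (forall v, v \in q -> v \in Gd -> d <= kap * dg v A) ->
  #|T| <= 6 * kap * #|heads A q|.
Proof.
move=> [se irr _ E1 _] g2 q uq s0G AG deg; pose S := heads A q.
pose U := S :|: nbh q S.
have inS q' v r : reach A q q' -> q' = v :: r -> v \in S.
  by move=> R E; rewrite inE; apply/asboolP; exists r; rewrite -E.
(* Every pair created by a rotation joins two vertices of [U] that lie in [Gd]. A new head stood
   beside a pivot: if that pair is old, the hypothesis on [A] puts the head into [Gd], and if it is
   new, the invariant does. *)
have inv q' : reach A q q' -> forall x y, adj q' x y ->
    adj q x y \/ [/\ x \in U, y \in U, x \in Gd & y \in Gd].
  have sym q1 x y : adj q x y \/ [/\ x \in U, y \in U, x \in Gd & y \in Gd] ->
      adj q1 x y = adj q1 x y -> adj q y x \/ [/\ y \in U, x \in U, y \in Gd & x \in Gd].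
    by move=> [h|[? ? ? ?]] _; [left; rewrite adjC|right].
  suff: reach A q q' -> (forall x y, adj q' x y ->
    adj q x y \/ [/\ x \in U, y \in U, x \in Gd & y \in Gd]) /\
    (forall v r, q' = v :: r -> v \in Gd) by move=> h /h[].
  elim=> [|s a w b R [IH hd] wA sw]; first by split; [left|move=> v r [<-]].
  have sG := hd _ _ erefl; have [wG [wq wN]] := AG w wA.
  have sS : s \in S by apply: inS R erefl.
  have [c [E L]] := rev_last s a.
  have R' := reachS R wA sw.
  have lS : last s a \in S by apply: (inS _ _ (c ++ w :: b) R'); rewrite E.
  have lw : adj ((s :: a) ++ w :: b) (last s a) w.
    by rewrite adj_cat !eqxx /= !orbT.
  have wU : w \in U.
    have [h|[]//] := IH _ _ lw; rewrite inE.
    by apply/orP; right; apply: mem_nbh lS h.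
  have sU : s \in U by rewrite inE sS.
  split=> [x y /adj_rot[/IH//|[[-> ->]|[-> ->]]]|v r]; [by right|by right|].
  rewrite E => -[<- _]; have [h|[]//] := IH _ _ lw.
  by apply: wN; rewrite adjC.
have headG q' v r : reach A q q' -> q' = v :: r -> v \in Gd.
  case=> [[<-]//|s a w b R wA sw]; have [c [E L]] := rev_last s a.
  rewrite E => -[<- _]; have [wG [wq wN]] := AG w wA.
  have lw : adj ((s :: a) ++ w :: b) (last s a) w.
    by rewrite adj_cat !eqxx /= !orbT.
  by have [h|[]//] := inv _ R _ _ lw; apply: wN; rewrite adjC.
have degS s : s \in S -> d <= kap * dg s U.
  rewrite inE => /asboolP[r R]; have sq : s \in q.
    by rewrite -(perm_mem (reach_perm R)) mem_head.
  have /leq_trans : d <= kap * dg s A by apply: deg sq (headG _ _ _ R erefl).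
  apply; rewrite leq_mul2l; apply/orP; right.
  apply: subset_leq_card; apply/subsetP => w; rewrite [in X in X -> _]inE => /andP[wA sw].
  rewrite inE sw andbT; have wq' : w \in s :: r.
    by rewrite (perm_mem (reach_perm R)); case: (AG w wA) => _ [].
  move: wq'; rewrite inE => /orP[/eqP ws|wr]; first by rewrite ws irr in sw.
  have [a [b Er]] : exists a b, r = a ++ w :: b.
    by case/splitPr: wr => a b; exists a, b.
  move: R; rewrite Er -cat_cons => R; have R' := reachS R wA sw.
  have [c [E L]] := rev_last s a.
  have lS : last s a \in S by apply: (inS _ _ (c ++ w :: b) R'); rewrite E.
  have lw : adj ((s :: a) ++ w :: b) (last s a) w by rewrite adj_cat !eqxx /= !orbT.
  have [h|[]//] := inv _ R _ _ lw; rewrite inE.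
  by apply/orP; right; apply: mem_nbh lS h.
have s0S : s0 \in S by apply: (inS q _ q0) => //; constructor.
have cU : #|U| <= 3 * #|S|.
  by apply: leq_trans (leq_card_setU _ _) _; have := card_nbh S uq; lia.
have S0 : 0 < #|S| by apply/card_gt0P; exists s0.
have k0 : d * #|S| <= kap * edges S U.
  by rewrite /edges big_distrr mulnC -sum_nat_const leq_sum.
(* [U] has at most [3 * #|S|] vertices, so the second alternative would need [g ^ 2 <= 3]. *)
case: (E1 _ _ k0) => [h|h].
  by apply: leq_trans h _; rewrite -/S; nia.
suff: 4 * #|S| <= #|U| by lia.
apply: leq_trans h; rewrite leq_mul2r; apply/orP; right.
by rewrite -[4]/(2 ^ 2) leq_sqr.
Qed.

Lemma dg_setU x X Y : dg x X <= dg x (X :\: Y) + dg x Y.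
Proof.
rewrite /dg; set A := [set y in X | _]; rewrite -(cardsID Y A) addnC leq_add //.
  by apply: subset_leq_card; apply/subsetP => y; rewrite !inE; case/and3P => -> -> ->.
by apply: subset_leq_card; apply/subsetP => y; rewrite !inE; case/andP => /andP[_ ->] ->.
Qed.

(* A sequence of rotations, recorded by its list of pivots (last one first). *)
Inductive rotated q : seq T -> seq T -> Prop :=
| rotated0 : rotated q [::] q
| rotatedS ws s a w b : rotated q ws ((s :: a) ++ w :: b) -> e s w ->
    rotated q (w :: ws) (rev (s :: a) ++ w :: b).

Lemma rotated_perm q ws q' : rotated q ws q' -> perm_eq q' q.
Proof.
elim=> // {}ws s a w b _ IH _; apply: perm_trans IH.
by rewrite perm_cat2r perm_rev.
Qed.

Lemma rotated_last q ws q' z : rotated q ws q' -> last z q' = last z q.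
Proof. by elim=> // {}ws s a w b _ <- _; rewrite !last_cat. Qed.

Lemma rotated_nel q ws q' : symmetric e -> rotated q ws q' -> nel q' <= nel q.
Proof.
by move=> se; elim=> // {}ws s a w b _ IH sw; have := nel_rot a b se sw; lia.
Qed.

(** Each rotation creates one new pair only. A bounded number of rotations thus disturbs a bounded
    number of vertices, few compared with the degree. *)
Lemma rotated_adj q ws q' : rotated q ws q' -> exists2 C : {set T}, #|C| <= 2 * size ws
  & forall x y, adj q' x y -> adj q x y \/ (x \in C /\ y \in C).
Proof.
elim=> [|{}ws s a w b _ [C cC IH] sw]; first by exists set0; rewrite ?cards0 //; left.
exists (C :|: [set s; w]) => [|x y].
  apply: leq_trans (leq_card_setU _ _) _.
  by have := cards2 s w; rewrite /=; case: (s != w) => /=; lia.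
case/adj_rot => [/IH[|[xC yC]]|[[-> ->]|[-> ->]]]; first by left.
- by right; rewrite !inE xC yC.
- by right; rewrite !inE !eqxx !orbT.
- by right; rewrite !inE !eqxx !orbT.
Qed.

(** Rotations reverse segments, so a block counts as preserved in either direction. *)
Definition block I q := infix I q || infix (rev I) q.

Lemma block_rev I q : block I (rev q) = block I q.
Proof.
have -> : block I (rev q) = infix (rev (rev I)) (rev q) || infix (rev I) (rev q).
  by rewrite revK.
by rewrite !infix_rev orbC.
Qed.

Lemma rotated_block q ws q' I : rotated q ws q' -> {in ws, forall w, w \notin I} ->
  block I q -> block I q'.
Proof.
elim=> // {}ws s a w b _ IH _ wsI Iq.
have wI : w \notin I by apply: wsI; rewrite mem_head.
have wsI' : {in ws, forall w, w \notin I}.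
  by move=> z zws; apply: wsI; rewrite inE zws orbT.
have {}Iq := IH wsI' Iq.
have catP q1 q2 J : infix J q1 \/ infix J q2 -> infix J (q1 ++ w :: q2).
  case=> /infixP[u [v ->]]; first by apply/infixP; exists u, (v ++ w :: q2); rewrite -!catA.
  by apply/infixP; exists (q1 ++ w :: u), v; rewrite -catA.
have wI' : w \notin rev I by rewrite mem_rev.
case/orP: Iq => [/(infix_split wI)|/(infix_split wI')] H; apply/orP.
  case: H => [h|h]; [right|left]; apply: catP; [left|by right].
  by rewrite infix_rev.
case: H => [h|h]; [left|right]; apply: catP; [left|by right].
by rewrite -[I]revK infix_rev.
Qed.

Lemma split_mem q w : w \in q -> exists a b, q = a ++ w :: b.
Proof. by case/splitPr => a b; exists a, b. Qed.

End Graphs.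
End Graph.
Export Graph.

(** * Covering a zone by few paths *)

Section Expansion.
Variables (T : finType) (e : rel T) (d kap g : nat).
Hypothesis G : pseudorandom e d kap g.
Hypotheses (kap_ge : 1024 <= kap) (g_ge : 128 * kap <= g) (n_ge : g ^ 3 <= #|T|).
Implicit Types (q a b I : seq T) (x y w : T) (X Y A : {set T}).
Local Notation dg := (dg e).
Local Notation edges := (edges e).
Local Notation nel := (nel e).
Local Notation rotated := (rotated e).

Let g_pos : 0 < g. Proof. by lia. Qed.

Lemma edges_sym X Y : edges X Y = edges Y X.
Proof.
have E X' Y' : edges X' Y' = \sum_(x in X') \sum_(y in Y') e x y.
  apply: eq_bigr => x _; rewrite /Graph.dg -sum1_card big_mkcond [RHS]big_mkcond /=.
  by apply: eq_bigr => y _; rewrite inE; case: (y \in Y'); case: (e x y).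
rewrite !E exchange_big; apply: eq_bigr => x _; apply: eq_bigr => y _.
by rewrite (pr_sym G).
Qed.

Lemma degT x : dg x [set: T] = d.
Proof. by rewrite -(pr_reg G x); apply: eq_card => y; rewrite !inE. Qed.

(** Expansion of a single vertex into its own neighbourhood gives [#|T| <= 2 * kap * d] or
    [g ^ 2 <= d]; either is enough. *)
Lemma deg_ge : 128 * kap <= d.
Proof using G kap_ge g_ge n_ge.
have [x _] : exists x : T, True.
  by have /card_gt0P[x] : 0 < #|T| by rewrite (leq_trans _ n_ge) // expn_gt0 g_pos.
have := pr_expand G (X := [set x]) (Y := [set y | e x y]).
rewrite /Graph.edges big_set1 cards1 !muln1 (pr_reg G).
have -> : dg x [set y | e x y] = d.
  by rewrite -(pr_reg G x); apply: eq_card => y; rewrite !inE andbb.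
have kd : d <= kap * d by rewrite leq_pmull //; lia.
case/(_ kd) => h.
  have : 128 * kap * (128 * kap) * g <= 2 * kap * d.
    apply: leq_trans h; apply: leq_trans n_ge.
    by rewrite -[3]/(1 + 1 + 1) !expnD !expn1 !leq_mul.
  by have := g_pos; nia.
by apply: leq_trans h; apply: leq_trans g_ge _; rewrite expnS expn1 leq_pmulr ?g_pos.
Qed.

Section Zone.
Variables (Z : {set T}) (c : seq T).
Hypothesis degZ : forall x, d <= 16 * dg x Z.
Hypotheses (cZ : c =i Z) (uc : uniq c).
Hypothesis cmin : forall q, perm_eq q c -> nel c <= nel q.

(** The starting lists vary with the head, but each differs from [c] only inside a set of at most
    [t] vertices, and [j] rotations disturb at most [2 * j] more. So a head has at least about
    [d / 32] neighbours [w] in [Z] still standing between their [c]-neighbours, and rotating at [w]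
    makes one of these the next head. All these [w] lie in [nbh c (S j.+1)], which has at most
    [2 * #|S j.+1|] vertices; expansion therefore gains a factor [g ^ 2 / 2] per rotation as long as
    the heads stay in the small set [B]. *)
Lemma growth (H B : {set T}) (Q : T -> seq T -> Prop) (t h : nat) :
  4 * kap * #|B| < #|T| -> 32 * (t + 2 * h) <= d ->
  (forall x, x \in H -> exists q, Q x q) ->
  (forall x q, x \in H -> Q x q -> [/\ exists r, q = x :: r, perm_eq q c &
    exists2 C : {set T}, #|C| <= t &
      forall u v, adj q u v -> adj c u v \/ (u \in C /\ v \in C)]) ->
  (forall x q ws v r, x \in H -> Q x q -> size ws <= h -> rotated q ws (v :: r) ->
     v \in B) ->
  (g ^ 2) ^ h * #|H| <= 2 ^ h * #|B|.
Proof using G kap_ge g_ge n_ge degZ cZ uc.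
move=> smallB smallt exQ propQ inB.
pose S j := [set v | `[< exists x q ws r,
  [/\ x \in H, Q x q, size ws = j & rotated q ws (v :: r)] >]].
have SP j v : v \in S j -> exists x q ws r,
  [/\ x \in H, Q x q, size ws = j & rotated q ws (v :: r)] by rewrite inE => /asboolP.
have subB j : j <= h -> S j \subset B.
  move=> jh; apply/subsetP => v /SP[x [q [ws [r [xH xq sw R]]]]].
  by apply: inB xH xq _ R; rewrite sw.
have step j : j < h -> g ^ 2 * #|S j| <= 2 * #|S j.+1|.
  move=> jh; pose W := nbh c (S j.+1).
  have cW : #|W| <= 2 * #|S j.+1| by apply: card_nbh.
  have deg v : v \in S j -> d <= kap * dg v W.
    move=> /SP[x [q [ws [r [xH xq sw R]]]]].
    have [_ pq [C cC adjC]] := propQ x q xH xq.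
    have [C' cC' adjC'] := rotated_adj R.
    have sub : dg v (Z :\: (C :|: C')) <= dg v W.
      apply: subset_leq_card; apply/subsetP => w.
      rewrite 4!inE => /andP[/andP[/norP[wC wC'] wZ] vw].
      suff wW : w \in W by move: wW; rewrite !inE vw => ->.
      have : w \in v :: r by rewrite (perm_mem (rotated_perm R)) (perm_mem pq) cZ.
      rewrite inE => /orP[/eqP wv|/split_mem[a [b E]]].
        by rewrite wv (pr_irr G) in vw.
      move: R; rewrite E -cat_cons => R; have R' := rotatedS R vw.
      have [c1 [E1 L]] := rev_last v a.
      apply: (@mem_nbh _ _ _ (last v a)).
        rewrite inE; apply/asboolP; exists x, q, (w :: ws), (c1 ++ w :: b).
        by split=> //; [rewrite /= sw|rewrite E1 in R'].
      have lw : adj ((v :: a) ++ w :: b) (last v a) w by rewrite adj_cat !eqxx /= !orbT.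
      have [h1|[_ h1]] := adjC' _ _ (eq_ind _ (fun l => adj l (last v a) w) lw _ (esym (congr1 (cons v) E))).
        by have [//|[_ h2]] := adjC _ _ h1; rewrite h2 in wC.
      by rewrite h1 in wC'.
    have := dg_setD e v Z (C :|: C'); have := degZ v.
    have cU : #|C :|: C'| <= #|C| + #|C'| := leq_card_setU C C'.
    have : 32 * dg v W <= kap * dg v W by rewrite leq_mul2r; lia.
    by lia.
  have k0 : d * #|S j| <= kap * edges (S j) W.
    by rewrite /Graph.edges big_distrr mulnC -sum_nat_const leq_sum.
  have [h1|h1] := pr_expand G k0; last by apply: leq_trans cW.
  by have := subset_leq_card (subB j.+1 jh); nia.
have H0 : #|H| <= #|S 0|.
  apply: subset_leq_card; apply/subsetP => x xH; rewrite inE; apply/asboolP.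
  have [q xq] := exQ x xH; have [[r E] _ _] := propQ x q xH xq.
  by exists x, q, [::], r; split=> //; rewrite E; constructor.
have all j : j <= h -> (g ^ 2) ^ j * #|H| <= 2 ^ j * #|S j|.
  elim: j => [|j IH] jh; first by rewrite !expn0 !mul1n.
  have := IH (ltnW jh); have := step j jh.
  rewrite ![_ ^ j.+1]expnSr; move: (2 ^ j) ((g ^ 2) ^ j) (g ^ 2) => u v w; nia.
apply: leq_trans (all h (leqnn _)) _.
by rewrite leq_mul2l subset_leq_card ?orbT // subB.
Qed.

Lemma card_Z : #|T| <= 16 * #|Z|.
Proof using G kap_ge g_ge n_ge degZ.
clear cmin cZ uc; have k : d * #|T| <= 16 * edges [set: T] Z.
  by rewrite /Graph.edges big_distrr -[#|T|]cardsT mulnC -sum_nat_const leq_sum.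
move: k; rewrite edges_sym.
have -> : edges Z setT = d * #|Z|.
  by rewrite /Graph.edges (eq_bigr (fun=> d)) ?sum_nat_const 1?mulnC // => x _; rewrite degT.
by have := deg_ge; nia.
Qed.

(* A cyclic closing edge can be traded for a missing edge. *)
Lemma closed_min f x r : f = x :: r -> perm_eq f c -> nel f <= nel c -> e (last x r) x ->
  nel c = 0.
Proof using G kap_ge g_ge n_ge uc cmin.
move=> E pf le ex; apply/eqP; rewrite -leqn0 leqNgt; apply/negP => pos.
have : 0 < nel f by apply: leq_trans pos (cmin pf).
rewrite -has_count => /hasP[[u v]] /prsP[a [b Ef]] /= uv.
have [z [a' Ea]] : exists z a', rcons a u = z :: a'.
  by case: (a) => [|z a']; [exists u, [::]|exists z, (rcons a' u)].
have Ef' : f = (z :: a') ++ v :: b by rewrite -Ea cat_rcons.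
have lu : last z a' = u by rewrite -[last z a']/(last z (z :: a')) -Ea last_rcons.
have xz : x = z by move: Ef'; rewrite E => -[].
have lb : last v b = last x r.
  by rewrite -[last x r]/(last x (x :: r)) -E Ef' last_cat.
have p' : perm_eq ((v :: b) ++ z :: a') c by rewrite perm_catC -Ef'.
have := cmin p'; move: le; rewrite Ef' !nel_cat lu uv lb -xz ex /=; lia.
Qed.

End Zone.
End Expansion.

Section Inner.
Variable T : finType.
Implicit Types (I : seq T).

Definition inner I := [set w | [exists x, exists y, infix [:: x; w; y] I]].

Lemma card_inner I : uniq I -> size I <= #|inner I| + 2.
Proof.
case: I => [//|x I]; case: (lastP I) => [|m y] uI; first by rewrite /=; lia.
rewrite /= size_rcons addn2 !ltnS.
have um : uniq m by move: uI; rewrite /= rcons_uniq => /and3P[].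
rewrite -(card_uniqP um); apply: subset_leq_card; apply/subsetP => w wm; rewrite inE.
have [m1 [m2 E]] := split_mem wm; rewrite E rcons_cat rcons_cons.
have [z [r Er]] : exists z r, x :: m1 = rcons r z.
  by exists (last x m1), (belast x m1); rewrite lastI.
have [t [s Es]] : exists t s, rcons m2 y = t :: s.
  by case: (m2) => [|t s]; [exists y, [::]|exists t, (rcons s y)].
apply/existsP; exists z; apply/existsP; exists t; apply/infixP; exists r, s.
by rewrite -cat_cons Er Es -cats1 -catA.
Qed.

End Inner.

Section SparseClosure.
Variables (T : finType) (e : rel T) (d kap g : nat).
Hypothesis G : pseudorandom e d kap g.
Hypotheses (kap_ge : 1024 <= kap) (g_ge : 128 * kap <= g) (n_ge : g ^ 3 <= #|T|).
Implicit Types (q a b I : seq T) (x y w : T) (X Y A : {set T}).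
Local Notation dg := (dg e).
Local Notation edges := (edges e).
Local Notation nel := (nel e).
Variables (Z : {set T}) (c : seq T).
Hypothesis degZ : forall x, d <= 16 * dg x Z.
Hypotheses (cZ : c =i Z) (uc : uniq c).
Hypothesis cmin : forall q, perm_eq q c -> nel c <= nel q.

Let g_pos : 0 < g. Proof. by lia. Qed.
Let deg_ge := deg_ge G kap_ge g_ge n_ge.

(** [B] is a largest set containing [X0], below a size cap, such that [B :\: X0] sends many edges to
    [B :|: nbh c B]. A vertex outside with [d / 1024] neighbours there could be added, so [B] would
    already be at the cap; but then [pr_expand] asks for more vertices than the [3 * #|B|] that
    [B :|: nbh c B] can have. Vertices outside [B] have few neighbours in [B] or beside it on the
    list, so rotations starting there can stay outside [B]. *)
Lemma sparse_closure (X0 : {set T}) : g ^ 2 * #|X0| <= 2816 * #|T| ->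
  exists2 B : {set T}, X0 \subset B /\ g ^ 2 * #|B| <= 8 * 1024 * #|T|
    & forall v, v \notin B -> 1024 * dg v (B :|: nbh c B) < d.
Proof using G kap_ge g_ge n_ge uc.
move=> cX0; pose U (B : {set T}) := B :|: nbh c B.
have cU B : #|U B| <= 3 * #|B|.
  have h : #|U B| <= #|B| + #|nbh c B| := leq_card_setU _ _.
  by have := card_nbh B uc; lia.
pose P (B : {set T}) := [&& X0 \subset B, g ^ 2 * #|B| <= 8 * 1024 * #|T|
  & d * #|B :\: X0| <= kap * edges (B :\: X0) (U B)].
have P0 : P X0 by rewrite /P subxx setDv cards0 muln0 leq0n andbT /=; apply: leq_trans cX0 _; rewrite leq_mul2r orbT.
have [B PB Bmax] : exists2 B, P B & forall B', P B' -> #|B'| <= #|B|.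
  by case: (arg_maxnP (fun B : {set T} => #|B|) P0) => B; exists B.
have /and3P[XB cB eB] := PB; exists B => // v vB; rewrite ltnNge; apply/negP => vU.
have cB' : #|v |: B| = #|B|.+1 by rewrite cardsU1 vB.
have vX : v \notin X0 by apply: contra vB => /(subsetP XB).
have DE : (v |: B) :\: X0 = v |: (B :\: X0).
  by apply/setP => y; rewrite !inE; case: eqP => // ->; rewrite vX.
have UU : U B \subset U (v |: B).
  apply/subsetP => y; rewrite !inE => /orP[->|/existsP[x /andP[xB xy]]]; rewrite ?orbT //.
  by apply/orP; right; apply/existsP; exists x; rewrite !inE xB orbT.
have [small|big] := leqP (g ^ 2 * #|B|.+1) (8 * 1024 * #|T|).
  have : P (v |: B); last by move/Bmax; rewrite cB' ltnn.
  rewrite /P cB' small DE (subset_trans XB (subsetUr _ _)) /=.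
  have vD : v \notin B :\: X0 by rewrite inE (negbTE vB) andbF.
  rewrite /Graph.edges cardsU1 vD big_setU1 //=.
  have h1 : d <= kap * dg v (U (v |: B)).
    apply: leq_trans vU _; apply: leq_mul => //; exact: dg_sub.
  have h2 : edges (B :\: X0) (U B) <= \sum_(i in B :\: X0) dg i (U (v |: B)).
    by apply: leq_sum => i _; apply: dg_sub.
  by move: eB; rewrite mulnDr; nia.
have cBX : #|B :\: X0| = #|B| - #|X0| by rewrite cardsD (setIidPr XB).
have g2n : g ^ 2 * g <= #|T| by rewrite -expnSr.
have gk : 128 * kap * (128 * kap) <= g ^ 2 by rewrite expnS expn1 leq_mul.
have g2 : 0 < g ^ 2 by rewrite expn_gt0 g_pos.
have n0 : 0 < #|T| by apply: leq_trans g2n; rewrite muln_gt0 g2 g_pos.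
have cXB := subset_leq_card XB.
have := cU B; case: (pr_expand G eB) => h.
  move: (g ^ 2) #|U B| #|B| #|T| h cB gk n0 => u b B1 n h cB gk n0 hb.
  have h1 : n <= 6 * kap * B1 by apply: leq_trans h _; nia.
  have h2 : u * n <= 6 * kap * (8 * 1024 * n).
    apply: leq_trans (leq_mul (leqnn u) h1) _.
    by rewrite mulnCA leq_mul2l cB orbT.
  have k0 : 0 < kap * n by rewrite muln_gt0 n0 andbT; lia.
  have h3 : 128 * kap * (128 * 1024) <= u.
    by apply: leq_trans gk; rewrite !leq_mul //; lia.
  have : 128 * kap * (128 * 1024) * n <= u * n by rewrite leq_mul2r h3 orbT.
  by lia.
rewrite cBX mulnBr in h => hb.
have u_ge : 24 * 1024 <= g ^ 2.
  by apply: leq_trans gk; apply: (@leq_trans (128 * 1024 * 1)) => //; rewrite leq_mul //; lia.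
have hB : 24 * 1024 * #|B| <= g ^ 2 * #|B| by rewrite leq_mul2r u_ge orbT.
have hn : g ^ 2 <= #|T| by apply: leq_trans g2n; rewrite leq_pmulr ?g_pos.
rewrite (mulnS (g ^ 2)) in big; move: (g ^ 2 * #|B|) (g ^ 2 * #|X0|) h big hB cB cX0 => ub ux.
by lia.
Qed.

End SparseClosure.

Section FewRuns.
Variables (T : finType) (e : rel T) (d kap g : nat).
Hypothesis G : pseudorandom e d kap g.
Hypotheses (kap_ge : 1024 <= kap) (g_ge : 128 * kap <= g) (n_ge : g ^ 3 <= #|T|).
Implicit Types (q a b I : seq T) (x y w : T) (X Y A : {set T}).
Local Notation dg := (dg e).
Local Notation edges := (edges e).
Local Notation nel := (nel e).
Local Notation rotated := (rotated e).

(** Without such an edge [pr_spread] gives [g ^ 2 * #|X| * #|Y| <= #|T| ^ 2], against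
    [g > 12 * kap]. The factor 12, twice that of [posa], leaves room to discard half of a set of
    ends. *)
Lemma linked_large (X Y : {set T}) : #|T| <= 12 * kap * #|X| -> #|T| <= 12 * kap * #|Y| ->
  exists x y, [/\ x \in X, y \in Y & e x y].
Proof.
move=> cX cY; have [/existsP[x /existsP[y /and3P[? ? ?]]]|no] :=
  boolP [exists x, exists y, [&& x \in X, y \in Y & e x y]]; first by exists x, y.
have e0 : edges X Y = 0.
  apply: big1 => x xX; apply/eqP; rewrite cards_eq0; apply/set0Pn => -[y].
  rewrite inE => /andP[yY xy]; case/negP: no.
  by apply/existsP; exists x; apply/existsP; exists y; rewrite xX yY.
have := pr_spread G (X := X) (Y := Y); rewrite e0 muln0 leq0n => /(_ isT) h2.
have g0 : 0 < g by lia.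
have n0 : 0 < #|T| by apply: leq_trans n_ge; rewrite expn_gt0 g0.
have X0 : 0 < #|X| by case: #|X| cX => //; rewrite muln0; lia.
have Y0 : 0 < #|Y| by case: #|Y| cY => //; rewrite muln0; lia.
have XY0 : 0 < #|X| * #|Y| by rewrite muln_gt0 X0 Y0.
have h1 : #|T| * #|T| <= (12 * kap * #|X|) * (12 * kap * #|Y|) by apply: leq_mul.
have h3 : 12 * kap * (12 * kap) < g * g by apply: ltn_mul; lia.
move: h2; rewrite -mulnA !expnS !expn0 !muln1 => h2.
by have := leq_trans h2 h1; rewrite (mulnACA (12 * kap)) leqNgt ltn_pmul2r // h3.
Qed.

Variables (Z : {set T}) (c : seq T).
Hypothesis degZ : forall x, d <= 16 * dg x Z.
Hypotheses (cZ : c =i Z) (uc : uniq c).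
Hypothesis cmin : forall q, perm_eq q c -> nel c <= nel q.

Let g_pos : 0 < g. Proof. by lia. Qed.
Let deg_ge := deg_ge G kap_ge g_ge n_ge.
Let n_big : 1024 * 1024 <= #|T|.
Proof.
apply: leq_trans n_ge; rewrite -[3]/(1 + 1 + 1) !expnD !expn1.
by rewrite -[X in X <= _]muln1 !leq_mul //; lia.
Qed.

Let ell := size c %/ 11.
(** Eleven cells are used: the point where the list is opened and the two times four pivots in
    [few_runs] touch at most nine of them, so two stay intact. *)
Definition cell j := take ell (drop (j * ell) c).

Lemma cell_infix j : infix (cell j) c.
Proof.
apply/infixP; exists (take (j * ell) c), (drop ell (drop (j * ell) c)).
by rewrite /cell !cat_take_drop.
Qed.

Lemma size_cell j : j < 11 -> size (cell j) = ell.
Proof.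
move=> j11; rewrite size_take size_drop.
have : ell * 11 <= size c by apply: leq_divM.
case: ltngtP => //; nia.
Qed.

Lemma cell_disjoint i j x : x \in cell i -> x \in cell j -> i = j.
Proof.
have H k l y : k < l -> y \in cell k -> y \in cell l -> False.
  move=> kl yk yl.
  have yt : y \in take (l * ell) c.
    move: yk; rewrite /cell take_drop => /mem_drop.
    have h : ell + k * ell <= l * ell by rewrite -mulSn leq_mul2r kl orbT.
    by rewrite -(take_takel c h) => /mem_take.
  have yd : y \in drop (l * ell) c by apply: mem_take yl.
  have := uc; rewrite -[in uniq c](cat_take_drop (l * ell) c) cat_uniq.
  by case/and3P => _ /hasPn /(_ _ yd); rewrite /= yt.
by move=> xi xj; case: (ltngtP i j) => // h; [case: (H i j x)|case: (H j i x)].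
Qed.

Lemma cell_large j : j < 11 -> #|T| <= 256 * #|inner (cell j)|.
Proof.
move=> j11.
have uI : uniq (cell j) by apply: subseq_uniq uc; apply: subseq_trans (take_subseq _ _) (drop_subseq _ _).
have := card_inner uI; rewrite size_cell //.
have := card_Z G kap_ge g_ge n_ge degZ.
have -> : #|Z| = size c by rewrite -(card_uniqP uc); apply/esym/eq_card.
have r11 : size c %% 11 < 11 by rewrite ltn_mod.
have := divn_eq (size c) 11; rewrite -/ell. lia.
Qed.

(** By [pr_spread] the vertices with fewer than [d / 512] neighbours inside a given cell satisfy
    [g ^ 2 * #|X j| <= 256 * #|T|], and [2816 = 11 * 256]. Outside the closure [B] of their union,
    fewer than [d / 1024] neighbours are lost to [B :|: nbh c B]. *)
Lemma cells_good : exists2 B : {set T}, g ^ 2 * #|B| <= 8 * 1024 * #|T|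
  & forall v j, j < 11 -> v \notin B -> d <= kap * dg v (inner (cell j) :\: (B :|: nbh c B)).
Proof.
pose X (j : nat) := [set v | 512 * dg v (inner (cell j)) < d].
pose X0 := \bigcup_(j < 11) X j.
have cX j : j < 11 -> g ^ 2 * #|X j| <= 256 * #|T|.
  move=> j11; have cI := cell_large j11.
  have sm : 512 * edges (X j) (inner (cell j)) <= d * #|X j|.
    rewrite /Graph.edges big_distrr mulnC -sum_nat_const leq_sum // => v.
    by rewrite inE => /ltnW.
  have n0 : 0 < #|T| by lia.
  have H : 2 * #|T| * edges (X j) (inner (cell j)) <= d * #|X j| * #|inner (cell j)|.
    have h1 := leq_mul cI sm; lia.
  have := pr_spread G H.
  have : #|T| * (g ^ 2 * #|X j|) <= 256 * #|inner (cell j)| * (g ^ 2 * #|X j|).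
    by rewrite leq_mul2r cI orbT.
  rewrite [#|T| ^ 2]expnS expn1 => h1 h2.
  rewrite -(leq_pmul2l n0); apply: leq_trans h1 _.
  by rewrite [X in _ <= X]mulnCA -mulnA leq_mul2l [#|inner _| * _]mulnC h2 orbT.
have cX0 : g ^ 2 * #|X0| <= 2816 * #|T|.
  have : #|X0| <= \sum_(j < 11) #|X j|.
    rewrite /X0; elim/big_ind2: _ => [|x Y1 y Y2 h1 h2|//]; first by rewrite cards0.
    by apply: leq_trans (leq_add h1 h2); apply: leq_card_setU.
  rewrite -(leq_pmul2l (n1 := _) (m := g ^ 2)) ?expn_gt0 ?g_pos // => h.
  apply: leq_trans h _; rewrite big_distrr /=.
  apply: (@leq_trans (\sum_(j < 11) 256 * #|T|)); first by apply: leq_sum => j _; apply: cX.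
  by rewrite big_const_ord iter_addn_0 mulnAC; apply: leq_mul.
have [B [XB cB] BU] := sparse_closure G kap_ge g_ge n_ge uc cX0.
exists B => // v j j11 vB.
have vX : d <= 512 * dg v (inner (cell j)).
  rewrite leqNgt; apply: contra vB => h; apply: (subsetP XB).
  by apply/bigcupP; exists (Ordinal j11); rewrite ?inE.
have := BU v vB; have := dg_setU e v (inner (cell j)) (B :|: nbh c B).
have : 1024 * dg v (inner (cell j) :\: (B :|: nbh c B))
     <= kap * dg v (inner (cell j) :\: (B :|: nbh c B)) by rewrite leq_mul2r kap_ge orbT.
lia.
Qed.

(** The list read cyclically from [v] on. At a non-edge [(u, v)] this trades the non-edge for the
    pair that closes [c], so [nel] does not grow, and [u] and [v] become the two ends. *)
Definition opened v := drop (index v c) c ++ take (index v c) c.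

Lemma openedP a u v b : c = rcons a u ++ v :: b -> opened v = v :: b ++ rcons a u.
Proof.
move=> E; have iv : index v c = size (rcons a u).
  have := uc; rewrite E cat_uniq => /and3P[_ /hasPn /(_ v (mem_head _ _)) vn _].
  by rewrite index_cat (negbTE vn) /= eqxx addn0.
by rewrite /opened iv E drop_size_cat // take_size_cat.
Qed.

Lemma opened_perm v : perm_eq (opened v) c.
Proof. by rewrite /opened perm_catC cat_take_drop. Qed.

Lemma opened_adj a u v b : c = rcons a u ++ v :: b -> exists2 C : {set T}, #|C| <= 2
  & forall x y, adj (opened v) x y -> adj c x y \/ (x \in C /\ y \in C).
Proof.
move=> E; rewrite (openedP E) E.
have [z [a' Ea]] : exists z a', rcons a u = z :: a'.
  by case: (a) => [|z a']; [exists u, [::]|exists z, (rcons a' u)].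
exists [set last v b; z] => [|x y]; first by rewrite cards2; case: eqP.
rewrite Ea -cat_cons !adj_cat.
case/or4P => [->|->|/andP[/eqP-> /eqP->]|/andP[/eqP-> /eqP->]]; rewrite ?orbT; [by left|by left| |];
  by right; rewrite !inE !eqxx ?orbT.
Qed.

Lemma opened_nel a u v b : c = rcons a u ++ v :: b -> ~~ e u v -> nel (opened v) <= nel c.
Proof.
move=> E uv; rewrite (openedP E) E.
have [z [a' Ea]] : exists z a', rcons a u = z :: a'.
  by case: (a) => [|z a']; [exists u, [::]|exists z, (rcons a' u)].
have lu : last z a' = u by rewrite -[last z a']/(last z (z :: a')) -Ea last_rcons.
rewrite Ea -cat_cons !nel_cat lu uv; case: (e _ z) => /=; lia.
Qed.

Lemma opened_block j a u v b : c = rcons a u ++ v :: b -> v \notin cell j ->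
  block (cell j) (opened v).
Proof.
move=> E vj; rewrite (openedP E); have := cell_infix j; rewrite [X in infix _ X]E.
case/(infix_split vj) => /infixP[p [s ->]]; apply/orP; left; apply/infixP.
  by exists (v :: b ++ p), s; rewrite /= -!catA.
by exists (v :: p), (s ++ rcons a u); rewrite /= -!catA.
Qed.

(* Deep rotations inside one block of the list [q]: the block [I] is the cell [j]
   or its reversal, and only interior good vertices of the cell are pivots. *)
Lemma cell_heads (B : {set T}) j q s r : j < 11 ->
  (forall v, v \notin B -> d <= kap * dg v (inner (cell j) :\: (B :|: nbh c B))) ->
  q = s :: r -> uniq q -> s \notin B -> block (cell j) q ->
  #|T| <= 6 * kap * #|heads e (inner (cell j) :\: (B :|: nbh c B)) q|.
Proof.
move=> j11 degB E uq sB bq; rewrite E; rewrite E in uq bq.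
apply: (posa (Gd := ~: B) G) => //; rewrite ?inE //; first by lia.
  move=> w; rewrite inE => /andP[wU wi].
  have [wB wN] : w \notin B /\ w \notin nbh c B by move: wU; rewrite inE => /norP.
  move: wi; rewrite inE => /existsP[x /existsP[y I]].
  have xw : adj c x w /\ adj c y w.
    have /infixP[p [t Et]] := infix_trans I (cell_infix j).
    split; apply/orP; [left|right]; apply/prsP; [by exists p, (y :: t)|].
    by exists (rcons p x), t; rewrite Et cat_rcons.
  have xB : x \notin B by apply: contra wN => xB; apply: mem_nbh xB _; case: xw.
  have yB : y \notin B by apply: contra wN => yB; apply: mem_nbh yB _; case: xw.
  have I' : infix [:: x; w; y] (s :: r) \/ infix [:: y; w; x] (s :: r).
    case/orP: bq => h; [left|right]; first exact: infix_trans I h.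
    apply: infix_trans h; rewrite -[cell j]revK in I; rewrite -[rev _]revK.
    by rewrite -[[:: y; w; x]]revK infix_rev revK -[cell j]revK.
  split; [by rewrite inE|split].
    by case: I' => /infixP[p [t ->]]; rewrite mem_cat !inE eqxx !orbT.
  by case: I' => h z /(uniq_tri uq h)[->|->]; rewrite inE.
by move=> v _; rewrite inE => /degB.
Qed.

(** With more non-edges the list could be opened at too many places: four rotations multiply a set
    of heads by about [g ^ 8], so the ends cannot all be trapped in the exceptional set [B]. Some
    list gets both ends outside [B] while two of its cells stay intact. Posa's lemma with pivots in
    these cells gives linearly many ends on both sides, an edge between the two sets closes the list
    to a cycle, and [closed_min] leaves no non-edge at all. *)
Theorem few_runs : nel c * g ^ 8 <= #|T|.
Proof using G kap_ge g_ge n_ge degZ cZ uc cmin.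
rewrite leqNgt; apply/negP => big.
have [B cB goodB] := cells_good.
pose P := [set v | [exists u, ((u, v) \in prs c) && ~~ e u v]].
have n0 : 0 < #|T| by lia.
have cP : nel c <= #|P|.
  rewrite /Graph.nel -size_filter -(size_map snd).
  have us : uniq [seq p.2 | p <- prs c & ~~ e p.1 p.2].
    apply: (@subseq_uniq _ _ (map snd (prs c))); first exact: map_subseq (filter_subseq _ _).
    rewrite -/(unzip2 _) unzip2_zip ?size_behead ?leq_pred //.
    by case: (c) uc => //= ? ? /andP[].
  rewrite -(card_uniqP us); apply: subset_leq_card; apply/subsetP => v /mapP[[u v']].
  rewrite mem_filter => /andP[uv mem] ->; rewrite inE; apply/existsP; exists u.
  by rewrite mem uv.
have PP v : v \in P -> exists a u b, c = rcons a u ++ v :: b /\ ~~ e u v.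
  rewrite inE => /existsP[u /andP[/prsP[a [b E]] uv]]; exists a, u, b; split=> //.
  by rewrite cat_rcons.
have g2 : 0 < g ^ 2 by rewrite expn_gt0 g_pos.
have g2_big : 1024 * 1024 <= g ^ 2.
  have h : 1024 <= g by lia.
  by rewrite expnS expn1; apply: leq_mul.
have k_g : 128 * kap * (128 * kap) <= g ^ 2 by rewrite expnS expn1 leq_mul.
have smallB : 4 * kap * #|B| < #|T|.
  rewrite ltnNge; apply/negP => h.
  have h1 : g ^ 2 * #|T| <= 4 * kap * (8 * 1024 * #|T|).
    by apply: leq_trans (leq_mul (leqnn _) h) _; rewrite mulnCA leq_mul2l cB orbT.
  have h2 : 128 * kap * (128 * kap) * #|T| <= g ^ 2 * #|T| by rewrite leq_mul2r k_g orbT.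
  have h3 : 1024 * (kap * #|T|) <= kap * (kap * #|T|) by rewrite leq_mul2r kap_ge orbT.
  have h4 : 0 < kap * #|T| by rewrite muln_gt0 n0 andbT; lia.
  lia.
have four : 32 * (2 + 2 * 4) <= d /\ 32 * (10 + 2 * 4) <= d by lia.
(* Here [#|B|] is at most [2 ^ 13 * #|T| / g ^ 2] and [g ^ 2 >= 2 ^ 20], which absorbs the factor
   [2 * 2 ^ 4]. So fewer than half of the supposed [#|T| / g ^ 8] openings are trapped in [B] at one
   end. *)
have notB H : (g ^ 2) ^ 4 * #|H : {set T}| <= 2 ^ 4 * #|B| ->
    2 * (g ^ 8 * #|H|) < #|T|.
  rewrite -expnM => h; apply: leq_ltn_trans (leq_mul (leqnn 2) h) _.
  rewrite -(ltn_pmul2l g2).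
  have h1 : 1024 * 1024 * #|T| <= g ^ 2 * #|T| by rewrite leq_mul2r g2_big orbT.
  apply: leq_trans h1; rewrite mulnCA (mulnCA (g ^ 2)).
  have -> : 2 ^ 4 = 16 by [].
  by move: (g ^ 2 * #|B|) cB => X; lia.
pose H1 := [set v in P | `[< forall ws x r, size ws <= 4 ->
  rotated (opened v) ws (x :: r) -> x \in B >]].
have s1 : 2 * (g ^ 8 * #|H1|) < #|T|.
  apply: notB; apply: (growth G kap_ge g_ge n_ge degZ cZ uc
    (Q := fun v q => q = opened v) (t := 2)) => //; first by case: four.
  - by move=> v _; exists (opened v).
  - move=> v q; rewrite inE => /andP[vP _] ->; have [a [u [b [E uv]]]] := PP v vP.
    split; [|exact: opened_perm|exact: opened_adj E].
    by exists (b ++ rcons a u); rewrite (openedP E).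
  - by move=> v q ws x r; rewrite inE => /andP[_ /asboolP h] ->; apply: h.
(* The lists whose head was moved out of [B], reversed, so that the other end [u] can be rotated
   next. They differ from [c] on at most ten vertices: two from the opening, eight from four
   rotations. *)
pose Q u q2 := exists a v b ws s r, [/\ c = rcons a u ++ v :: b, ~~ e u v,
  rotated (opened v) ws (s :: r) & [/\ size ws <= 4, s \notin B & q2 = rev (s :: r)]].
pose H2 := [set u | `[< exists q2, Q u q2 >]].
have last_op a u v b ws q : c = rcons a u ++ v :: b -> rotated (opened v) ws q ->
    forall z, last z q = u.
  move=> E R z; rewrite (rotated_last z R) (openedP E) -cat_cons last_cat last_rcons //.
have propQ u q2 : Q u q2 -> [/\ exists r, q2 = u :: r, perm_eq q2 c &
    exists2 C : {set T}, #|C| <= 10 &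
      forall x y, adj q2 x y -> adj c x y \/ (x \in C /\ y \in C)].
  move=> [a [v [b [ws [s [r [E uv R [sw sB ->]]]]]]]]; split.
  - have [r' [-> _]] := rev_last s r; exists r'.
    by rewrite -[last s r]/(last s (s :: r)) (last_op _ _ _ _ _ _ E R).
  - by rewrite perm_rev (perm_trans (rotated_perm R)) // opened_perm.
  - have [C cC CP] := rotated_adj R; have [C' cC' CP'] := opened_adj E.
    exists (C :|: C') => [|x y].
      by have h : #|C :|: C'| <= #|C| + #|C'| := leq_card_setU _ _; lia.
    rewrite adj_rev => /CP[/CP'[|[xC yC]]|[xC yC]]; first by left.
      by right; rewrite !inE xC yC !orbT.
    by right; rewrite !inE xC yC.
have [u [q2 [ws2 [t [r2 [uq2 sw2 R2 tB]]]]]] : exists u q2 ws2 t r2, [/\ Q u q2,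
    size ws2 <= 4, rotated q2 ws2 (t :: r2) & t \notin B].
  apply: contrapT => no.
  have s2 : 2 * (g ^ 8 * #|H2|) < #|T|.
    apply: notB; apply: (growth G kap_ge g_ge n_ge degZ cZ uc (Q := Q) (t := 10)) => //.
    - by case: four.
    - by move=> u; rewrite inE => /asboolP.
    - by move=> u q _ /propQ.
    - move=> u q ws x r _ uq sw R; apply: contrapT => /negP xB; apply: no.
      by exists u, q, ws, x, r.
  have : #|P :\: H1| <= #|H2|.
    pose f v := odflt v [pick u | (u, v) \in prs c].
    have fE a u v b : c = rcons a u ++ v :: b -> f v = u.
      move=> E; have uv : (u, v) \in prs c by apply/prsP; exists a, b; rewrite E cat_rcons.
      rewrite /f; case: pickP => [u' u'v|/(_ u)]; last by rewrite uv.
      exact: uniq_prs_r u'v uv.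
    rewrite -(card_in_imset (f := f)).
      apply: subset_leq_card; apply/subsetP => u /imsetP[v]; rewrite !inE.
      case/andP=> vH vP; have [a [u' [b [E uv]]]] : exists a u b, c = rcons a u ++ v :: b /\ ~~ e u v.
        by apply: PP; rewrite inE.
      rewrite (fE _ _ _ _ E) => ->; move: vH; rewrite vP /= => /asboolP h.
      apply/asboolP; apply: contrapT => no2; apply: h => ws x r sw R.
      apply: contrapT => /negP xB; apply: no2; exists (rev (x :: r)).
      by exists a, v, b, ws, x, r.
    move=> v v'; rewrite !inE => /andP[_ vP] /andP[_ vP'].
    have [|a [u [b [E uv]]]] := PP v; first by rewrite inE.
    have [|a' [u' [b' [E' uv']]]] := PP v'; first by rewrite inE.
    rewrite (fE _ _ _ _ E) (fE _ _ _ _ E') => uu; apply: uniq_prs_l uc _ _.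
      by apply/prsP; exists a, b; rewrite E cat_rcons.
    by apply/prsP; exists a', b'; rewrite uu {1}E' cat_rcons.
  have : #|P| <= #|P :\: H1| + #|H1|.
    by rewrite -(cardsID H1 P) addnC leq_add2l subset_leq_card // subsetIr.
  move: big s1 s2 cP; move: (g ^ 8) => G8; nia.
have [a [v [b [ws [s [r [E uv R [sw sB Eq2]]]]]]]] := uq2.
pose q := t :: r2.
have pq2 : perm_eq q2 c by have [_ ? _] := propQ _ _ uq2.
have pq : perm_eq q c by apply: perm_trans (rotated_perm R2) pq2.
have uq : uniq q by rewrite (perm_uniq pq).
have lq : last t r2 = s.
  have := rotated_last t R2; rewrite /= Eq2 => ->.
  by rewrite rev_cons last_rcons.
have nq : nel q <= nel c.
  apply: leq_trans (rotated_nel (pr_sym G) R2) _.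
  rewrite Eq2 (nel_rev _ (pr_sym G)).
  by apply: leq_trans (rotated_nel (pr_sym G) R) (opened_nel E uv).
have blk j : {in v :: ws ++ ws2, forall w, w \notin cell j} -> block (cell j) q.
  move=> h; apply: rotated_block R2 _ _ => [w wws|]; first by apply: h; rewrite !inE mem_cat wws !orbT.
  have : block (cell j) (s :: r).
    apply: rotated_block R _ _ => [w wws|]; first by apply: h; rewrite !inE mem_cat wws !orbT.
    by apply: opened_block E _; apply: h; rewrite inE eqxx.
  by rewrite Eq2 block_rev.
have ell0 : 0 < ell.
  have := card_Z G kap_ge g_ge n_ge degZ.
  have -> : #|Z| = size c by rewrite -(card_uniqP uc); apply/esym/eq_card.
  by move=> h; rewrite divn_gt0 //; lia.
have cell0 j : j < 11 -> cell j != [::] by move=> j11; rewrite -size_eq0 size_cell // -lt0n.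
have [i [j [ij bi bj]]] : exists i j : 'I_11, [/\ i != j, block (cell i) q & block (cell j) q].
  pose ex := v :: ws ++ ws2.
  pose J := [set j : 'I_11 | has (mem (cell j)) ex].
  have cJ : #|J| <= 9.
    pose f (j : 'I_11) := nth v ex (find (mem (cell j)) ex).
    have fJ j : j \in J -> f j \in ex /\ f j \in cell j.
      rewrite inE => h; split; last exact: (nth_find v h).
      by apply: mem_nth; rewrite -has_find.
    rewrite -(card_in_imset (f := f)).
      apply: (@leq_trans #|[set x in ex]|).
        by apply: subset_leq_card; apply/subsetP => x /imsetP[j /fJ[h _] ->]; rewrite inE.
      by rewrite cardsE (leq_trans (card_size _)) //= size_cat; lia.
    move=> i j /fJ[_ hi] /fJ[_ hj] ff; apply: val_inj; apply: cell_disjoint hi _.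
    by rewrite ff.
  have : 1 < #|~: J| by have := cardsC J; rewrite card_ord; lia.
  case/card_gt1P => i [j [iJ jJ ij]]; exists i, j; split=> //; apply: blk => w wex.
    by move: iJ; rewrite !inE => /hasPn /(_ w wex).
  by move: jJ; rewrite !inE => /hasPn /(_ w wex).
(* A cut between the two intact cells gives halves that can be rotated independently: rotations fix
   the last vertex, so with [q3] reversed the pair at the cut is kept. *)
have [i1 [i2 [q1 [q3 [i1l i2l Eq b1 b2]]]]] : exists i1 i2 q1 q3,
    [/\ i1 < 11, i2 < 11, q = q1 ++ q3, block (cell i1) q1 & block (cell i2) q3].
  have [I [EI /infixP[p [sf Ep]]]] : exists I, (I = cell i \/ I = rev (cell i)) /\ infix I q.
    by case/orP: bi => h; [exists (cell i)|exists (rev (cell i))]; split; auto.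
  have [J [EJ infJ]] : exists J, (J = cell j \/ J = rev (cell j)) /\ infix J q.
    by case/orP: bj => h; [exists (cell j)|exists (rev (cell j))]; split; auto.
  have mI x : (x \in I) = (x \in cell i) by case: EI => ->; rewrite ?mem_rev.
  have mJ x : (x \in J) = (x \in cell j) by case: EJ => ->; rewrite ?mem_rev.
  have I0 : I != [::] by case: EI => ->; rewrite -size_eq0 ?size_rev size_eq0 cell0.
  have J0 : J != [::] by case: EJ => ->; rewrite -size_eq0 ?size_rev size_eq0 cell0.
  have dis : {in I, forall x, x \notin J}.
    move=> x; rewrite mI mJ => xi; apply/negP => xj; case/eqP: ij.
    by apply: val_inj; apply: cell_disjoint xi xj.
  have bI u1 u2 : block (cell i) (u1 ++ I ++ u2).
    by apply/orP; case: EI => <-; [left|right]; apply/infixP; exists u1, u2.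
  have bJ u1 : infix J u1 -> block (cell j) u1.
    by move=> h; apply/orP; case: EJ => EJ; rewrite EJ in h; [left|right].
  rewrite Ep in infJ; case: (infix_disj J0 I0 dis infJ) => h.
    by exists j, i, p, (I ++ sf); split=> //; [apply: bJ|apply: (bI [::])].
  exists i, j, (p ++ I), sf; rewrite -catA; split=> //; last exact: bJ.
  by have := bI p [::]; rewrite cats0.
have [r1 Er1] : exists r1, q1 = t :: r1.
  case: q1 b1 Eq => [|x r1]; last by move=> _; rewrite /q => -[<- _]; exists r1.
  by rewrite /block !infixs0 -!size_eq0 size_rev size_eq0 (negbTE (cell0 _ i1l)).
have [y [r3 Er3]] : exists y r3, q3 = y :: r3.
  case: q3 b2 Eq => [|x r3]; last by exists x, r3.
  by rewrite /block !infixs0 -!size_eq0 size_rev size_eq0 (negbTE (cell0 _ i2l)).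
have uq13 : uniq (q1 ++ q3) by rewrite -Eq.
have [uq1 uq3] : uniq q1 /\ uniq q3 by move: uq13; rewrite cat_uniq => /and3P[].
have [r4 [Er4 Lr4]] := rev_last y r3.
have ls : last y r3 = s.
  by rewrite -lq -[last t r2]/(last t (t :: r2)) -/q Eq Er3 last_cat.
rewrite ls -Er3 in Er4.
have L1 := cell_heads i1l (fun v h => goodB v i1 i1l h) Er1 uq1 tB b1.
have b2' : block (cell i2) (rev q3) by rewrite block_rev.
have L2 := cell_heads i2l (fun v h => goodB v i2 i2l h) Er4 (etrans (rev_uniq _) uq3) sB b2'.
have le612 (X : {set T}) : #|T| <= 6 * kap * #|X| -> #|T| <= 12 * kap * #|X|.
  by move=> h; apply: leq_trans h _; rewrite !leq_mul.
have [x [z [xS zS xz]]] := linked_large (le612 _ L1) (le612 _ L2).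
move: xS zS; rewrite !inE => /asboolP[x1 Rx] /asboolP[z1 Rz].
have [z2 [Ez Lz]] := rev_last z z1.
have lx : last x x1 = last t r1.
  by have := reach_last t Rx; rewrite Er1.
have lz : last z z1 = y.
  have := reach_last z Rz; rewrite /= => ->.
  by rewrite Er3 rev_cons last_rcons.
suff z0 : nel c = 0 by move: big; rewrite z0 mul0n.
apply: (closed_min G kap_ge g_ge n_ge uc cmin (f := (x :: x1) ++ rev (z :: z1)) (x := x) (r := x1 ++ rev (z :: z1))) => //.
- apply: perm_trans pq; rewrite Eq; apply: perm_cat; first exact: reach_perm Rx.
  by rewrite perm_rev (perm_trans (reach_perm Rz)) // perm_rev.
- apply: leq_trans nq; rewrite Eq Er1 Er3 Ez !nel_cat -Ez (nel_rev _ (pr_sym G)) lx lz.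
  have h1 := reach_nel (pr_sym G) Rx; have h2 := reach_nel (pr_sym G) Rz.
  rewrite (nel_rev _ (pr_sym G)) Er3 in h2; rewrite Er1 in h1.
  by rewrite leq_add // leq_add2r.
- by rewrite last_cat rev_cons last_rcons (pr_sym G).
Qed.

End FewRuns.

(** * The Friedman-Pippenger technique *)

Section FriedmanPippenger.
Variables (T : finType) (e : rel T) (Z : {set T}) (D m : nat).
Implicit Types (W X Y : {set T}) (us : seq T) (x y s : T).

Definition nbz X := [set y in Z | [exists x in X, e x y]].

(** The subtraction is truncated: a vertex listed more than [D] times demands nothing. *)
Definition demand us X := \sum_(x in X) (D - count_mem x us).

(* The vertices of [Z] outside [W] can still serve as children of every small
   set [X], where [x] has already received [count_mem x us] of its [D] children. *)
Definition extendable W us :=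
  forall X, #|X| <= 2 * m -> demand us X <= #|nbz X :\: W|.

Lemma nbzS X Y : X \subset Y -> nbz X \subset nbz Y.
Proof.
move=> /subsetP XY; apply/subsetP => y; rewrite !inE => /andP[-> /existsP[x /andP[xX xy]]].
by apply/existsP; exists x; rewrite XY.
Qed.

Lemma nbzU X Y : nbz (X :|: Y) = nbz X :|: nbz Y.
Proof.
apply/eqP; rewrite eqEsubset subUset !nbzS ?subsetUl ?subsetUr //= andbT.
apply/subsetP => y; rewrite !inE => /andP[-> /existsP[x /andP[]]].
by rewrite inE => /orP[xX|xY] xy; apply/orP; [left|right]; apply/existsP; exists x; apply/andP.
Qed.

Lemma demandE us X : demand us X = \sum_x (x \in X) * (D - count_mem x us).
Proof. by rewrite /demand big_mkcond; apply: eq_bigr => x _; case: (x \in X); rewrite ?mul1n. Qed.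

(** Demand is modular, while the size of [nbz X :\: W] is submodular; together they make tight sets
    closed under union in [extendable_leaf]. *)
Lemma demandUI us X Y : demand us (X :|: Y) + demand us (X :&: Y) = demand us X + demand us Y.
Proof.
rewrite !demandE -!big_split; apply: eq_bigr => x _ /=; rewrite !inE.
by case: (x \in X); case: (x \in Y); rewrite /= ?mul1n ?mul0n ?addn0 ?add0n.
Qed.

Lemma demand_cons s us X :
  demand us X = demand (s :: us) X + (s \in X) * (count_mem s us < D).
Proof.
rewrite !demandE (bigD1 s) // [in RHS](bigD1 s) //=.
have -> : \sum_(i | i != s) (i \in X) * (D - ((s == i) + count_mem i us)) =
          \sum_(i | i != s) (i \in X) * (D - count_mem i us).
  by apply: eq_bigr => i; rewrite eq_sym => /negbTE ->.
rewrite eqxx -addnA [X in _ = _ + X]addnC addnA; congr (_ + _).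
by case: (s \in X); case: ltnP => /=; lia.
Qed.

Lemma demand_le us us' X : (forall x, x \in X -> count_mem x us <= count_mem x us') ->
  demand us' X <= demand us X.
Proof. by move=> h; apply: leq_sum => x /h; apply: leq_sub2l. Qed.

Lemma extendable_weaken W us us' : extendable W us ->
  (forall x, count_mem x us <= count_mem x us') -> extendable W us'.
Proof. by move=> E h X cX; apply: leq_trans (demand_le _) (E X cX) => x _. Qed.

(** For a set containing [s], the freed vertex [y] is one more neighbour and the returned child at
    most one more unit of demand. Trees can thus be grown generously and pruned afterwards. *)
Lemma extendable_rollback W us s y : e s y -> y \in Z -> y \notin W ->
  extendable (y |: W) (s :: us) -> extendable W us.
Proof.
move=> sy yZ yW E X cX; have := E X cX.
have -> : nbz X :\: (y |: W) = (nbz X :\: W) :\ y.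
  by apply/setP => z; rewrite !inE; case: (z == y); case: (z \in W).
rewrite (cardsD1 y (nbz X :\: W)) (demand_cons s us X).
have [sX|sX] := boolP (s \in X).
  have -> : y \in nbz X :\: W.
    by rewrite !inE yW yZ /=; apply/existsP; exists s; rewrite sX.
  by case: (_ < D) => h; rewrite addnC leq_add.
by move=> h; rewrite addn0 (leq_trans h) ?leq_addl.
Qed.

Hypotheses (se : symmetric e) (m_gt0 : 0 < m).
Hypothesis joined : forall X Y, m <= #|X| -> m <= #|Y| ->
  exists x y, [/\ x \in X, y \in Y & e x y].

(* Otherwise every free neighbour of [s] lies in [nbz X] for a tight set [X]; tight
   sets are small, hence closed under union, and adding [s] to the largest one
   violates extendability. *)
Lemma extendable_leaf W us s : extendable W us -> count_mem s us < D ->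
  #|W| + m + 2 * D * m < #|Z| ->
  exists y, [/\ y \in Z, y \notin W, e s y & extendable (y |: W) (s :: us)].
Proof using m_gt0 joined.
move=> E cs big; apply: contrapT => no.
pose tight X := [&& #|X| <= 2 * m, #|nbz X :\: W| <= demand us X & s \notin X].
(* By [joined], a set of at least [m] vertices misses fewer than [m] vertices of [Z], so its free
   neighbourhood exceeds any demand up to [2 * D * m]. Tight sets are thus smaller than [m], and the
   union of two is again in the range of [extendable]. *)
have small X : tight X -> #|X| < m.
  case/and3P => cX tX _; rewrite ltnNge; apply/negP => mX.
  have h1 : #|Z :\: nbz X| < m.
    rewrite ltnNge; apply/negP => /(joined mX)[x [y [xX]]].
    rewrite !inE => /andP[/negP h yZ] xy; apply: h; rewrite yZ /=.
    by apply/existsP; exists x; rewrite xX.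
  have h2 : demand us X <= 2 * D * m.
    apply: (@leq_trans (\sum_(x in X) D)); first by apply: leq_sum => x _; apply: leq_subr.
    by rewrite sum_nat_const; move: cX; nia.
  have h3 : #|Z| <= #|Z :\: nbz X| + (#|nbz X :\: W| + #|W|).
    have h4 : #|Z| <= #|(Z :\: nbz X) :|: ((nbz X :\: W) :|: W)|.
      apply: subset_leq_card; apply/subsetP => z zZ; rewrite !inE zZ /=.
      by case: (z \in W); case: [exists _ in _, _].
    apply: leq_trans h4 _; apply: leq_trans (leq_card_setU _ _) _.
    by rewrite leq_add2l; apply: leq_card_setU.
  lia.
have t0 : tight set0.
  rewrite /tight cards0 leq0n inE andbT /=.
  have -> : nbz set0 = set0.
    by apply/setP => z; rewrite !inE; apply/andP => -[_ /existsP[x]]; rewrite inE.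
  by rewrite set0D cards0.
have [M tM maxM] : exists2 M, tight M & forall X, tight X -> #|X| <= #|M|.
  by case: (arg_maxnP (fun X : {set T} => #|X|) t0) => M; exists M.
have subM X : tight X -> X \subset M.
  move=> tX; suff /maxM h : tight (X :|: M).
    suff <- : X :|: M = M by apply: subsetUl.
    by apply/esym/eqP; rewrite eqEcard subsetUr.
  have cU : #|X :|: M| <= #|X| + #|M| := leq_card_setU _ _.
  have sX := small X tX; have sM := small M tM.
  have /and3P[_ dX nX] := tX; have /and3P[_ dM nM] := tM.
  apply/and3P; split; [lia| |by rewrite inE negb_or nX].
  have h := demandUI us X M.
  have cI : demand us (X :&: M) <= #|nbz (X :&: M) :\: W|.
    by apply: E; have := subset_leq_card (subsetIl X M); lia.
  have : #|nbz (X :&: M) :\: W| <= #|(nbz X :\: W) :&: (nbz M :\: W)|.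
    apply: subset_leq_card; rewrite subsetI.
    by rewrite !setSD ?nbzS ?subsetIl ?subsetIr.
  have := cardsUI (nbz X :\: W) (nbz M :\: W).
  by rewrite nbzU setDUl; lia.
have nbM : nbz [set s] :\: W \subset nbz M.
  apply/subsetP => y; rewrite !inE => /andP[yW /andP[yZ /existsP[x]]].
  rewrite inE => /andP[/eqP -> sy].
  (* The set [X] that rules out [y] was satisfied before and has lost only [y]; hence it is tight,
     avoids [s] and has [y] as a neighbour. *)
  have : ~ extendable (y |: W) (s :: us) by move=> h; apply: no; exists y.
  move=> /existsNP[X /not_implyP[cX /negP]]; rewrite -ltnNge => lt.
  have EX := E X cX.
  have DE : nbz X :\: (y |: W) = (nbz X :\: W) :\ y.
    by apply/setP => z; rewrite !inE; case: (z == y); case: (z \in W).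
  have c1 := cardsD1 y (nbz X :\: W); rewrite -DE in c1.
  have sX : s \notin X.
    apply/negP => sX; move: lt EX; rewrite (demand_cons s us X) sX cs c1.
    by case: (y \in _) => /=; lia.
  have dE : demand (s :: us) X = demand us X.
    by rewrite (demand_cons s us X) (negbTE sX) addn0.
  rewrite dE in lt; have yX : y \in nbz X.
    by move: c1; rewrite [y \in _]inE yW /=; case: (y \in nbz X) => //=; lia.
  have tX : tight X.
    apply/and3P; split=> //; move: c1; case: (y \in _) => /=; lia.
  by have := subsetP (nbzS (subM X tX)) y yX; rewrite !inE yZ.
have /and3P[_ dM nM] := tM.
have cM := small M tM.
have : demand us (s |: M) <= #|nbz (s |: M) :\: W|.
  by apply: E; rewrite cardsU1 nM; lia.
have -> : nbz (s |: M) :\: W = nbz M :\: W.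
  rewrite nbzU setDUl; apply/setUidPr; apply/subsetP => y yN.
  by rewrite inE (subsetP nbM y yN) andbT; move: yN; rewrite inE => /andP[].
rewrite /demand big_setU1 // -/(demand us M) -[X in X <= _]/(D - count_mem s us + demand us M); lia.
Qed.

End FriedmanPippenger.

(** * Connecting prescribed pairs by disjoint paths *)

Module Connecting.
Section Connecting.
Variables (T : finType) (e : rel T) (Z : {set T}) (D m : nat).
Implicit Types (W X Y : {set T}) (us p : seq T) (x y s : T) (l : seq (T * T)).
Hypotheses (se : symmetric e) (m_gt0 : 0 < m) (D_gt1 : 1 < D).
Hypothesis joined : forall X Y, m <= #|X| -> m <= #|Y| ->
  exists x y, [/\ x \in X, y \in Y & e x y].
Local Notation extendable := (extendable e Z D m).

Definition slack := m + 2 * D * m.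

(** A vertex of [Z] outside [W] has no children yet, so all its [D] places are free. *)
Definition used_in W us := forall x, x \in Z -> x \in us -> x \in W.

(* A set of (parent, child) pairs added to the state [(W, us)]. *)
Definition added W us l := [/\ uniq (unzip2 l), {subset unzip2 l <= Z :\: W},
  {in l, forall ab, e ab.1 ab.2} & extendable (W :|: [set x in unzip2 l]) (unzip1 l ++ us)].

Lemma added_cons W us l s : added W us l -> count_mem s (unzip1 l ++ us) < D ->
  #|W| + size l + slack < #|Z| ->
  exists y, [/\ y \notin unzip2 l, y \in Z, y \notin W & added W us ((s, y) :: l)].
Proof using m_gt0 joined.
move=> [ul sl el E] cs big.
have [|y [yZ yW sy E']] := extendable_leaf m_gt0 joined E cs.
  apply: leq_ltn_trans big; rewrite /slack addnA !leq_add2r.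
  apply: leq_trans (leq_card_setU _ _) _; rewrite leq_add2l cardsE.
  by apply: leq_trans (card_size _) _; rewrite size_map.
move: yW; rewrite !inE => /norP[yW yl].
exists y; split=> //; split=> /=; first by rewrite yl.
- by move=> x; rewrite inE => /orP[/eqP->|/sl//]; rewrite inE yW.
- by move=> ab; rewrite inE => /orP[/eqP->|/el].
suff -> : W :|: [set x in y :: unzip2 l] = y |: (W :|: [set x in unzip2 l]) by [].
by apply/setP => x; rewrite !inE orbCA.
Qed.

Definition leaf s l j x := [/\ x \in unzip2 l, x \notin unzip1 l &
  exists p, [/\ size p = j, last s p = x, uniq p & {subset prs (s :: p) <= l}]].

Lemma prs_unzip2 s p : unzip2 (prs (s :: p)) = p.
Proof. by rewrite /prs unzip2_zip //= leqnSn. Qed.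

Lemma prs_unzip1 s p : unzip1 (prs (s :: p)) = belast s p.
Proof. by elim: p s => [|x p IH] s //; rewrite prs_cons2 /= IH. Qed.

Lemma leaf_old s l j x a y : leaf s l j x -> x != a -> leaf s ((a, y) :: l) j x.
Proof.
move=> [x2 x1 [p [sp lp up pl]]] xa; split; rewrite /= ?inE ?x2 ?orbT //.
  by rewrite negb_or xa x1.
by exists p; split=> // z /pl; rewrite inE => ->; rewrite orbT.
Qed.

Lemma leaf_new s l j x y : leaf s l j x -> y \notin unzip2 l ->
  y != x -> y \notin unzip1 l -> leaf s ((x, y) :: l) j.+1 y.
Proof.
move=> [x2 x1 [p [sp lp up pl]]] yl yx y1; split; rewrite /= ?inE ?eqxx //.
  by rewrite negb_or yx.
exists (rcons p y); split; rewrite ?size_rcons ?sp ?last_rcons //.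
  rewrite rcons_uniq up andbT; apply: contra yl => yp.
  have : y \in unzip2 (prs (s :: p)) by rewrite prs_unzip2.
  by case/mapP => z /pl zl ->; apply: map_f.
have -> : prs (s :: rcons p y) = rcons (prs (s :: p)) (x, y).
  case: (lastP p) lp => [<-|q z] //; rewrite last_rcons => <-.
  by rewrite -!rcons_cons prs_rcons2.
move=> z; rewrite mem_rcons !inE => /orP[->//|/pl ->]; exact: orbT.
Qed.

Lemma grow_level W us s j todo : used_in W us -> (s \in Z -> s \in W) -> forall l new,
  added W us l -> {subset unzip1 l <= s :: unzip2 l} -> uniq todo -> uniq new ->
  {in todo, forall x, leaf s l j x} -> {in new, forall x, leaf s l j.+1 x} ->
  #|W| + size l + 2 * size todo + slack <= #|Z| ->
  {in todo, forall x, x \notin new} ->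
  exists l' new', [/\ added W us l', {subset unzip1 l' <= s :: unzip2 l'}, uniq new',
    {in new', forall x, leaf s l' j.+1 x} &
    size l' = size l + 2 * size todo /\ size new' = size new + 2 * size todo].
Proof using m_gt0 joined D_gt1.
move=> usW sW; elim: todo => [|x todo IH] l new al pl ut un Lt Ln big dis.
  by exists l, new; rewrite !addn0; split.
have Lx := Lt x (mem_head _ _); have [x2 x1 _] := Lx.
have xW : x \in Z :\: W by case: al => _ sl _ _; apply: sl.
have xus : x \notin us.
  by apply/negP => xu; move: xW; rewrite inE => /andP[/negP xW xZ]; apply: xW (usW x xZ xu).
have c0 : count_mem x (unzip1 l ++ us) = 0.
  by apply/count_memPn; rewrite mem_cat negb_or x1.
have [||y [y2 yZ yW al1]] := @added_cons _ _ _ x al; rewrite ?c0 ?(ltnW D_gt1) //.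
  by apply: leq_trans big => /=; clear; lia.
have [||y' [y'2 y'Z y'W al2]] := @added_cons _ _ _ x al1.
- by rewrite /= eqxx c0.
- by apply: leq_trans big => /=; clear; lia.
have nots z : z \in Z -> z \notin W -> z != s.
  by move=> zZ zW; apply: contraNneq zW => zs; rewrite zs in zZ *; apply: sW.
have yx : y != x by apply: contraNneq y2 => ->.
have y1 : y \notin unzip1 l.
  by apply: contra y2 => /pl; rewrite inE (negbTE (nots y yZ yW)).
have Ly := leaf_new Lx y2 yx y1.
have y'y : y' != y by apply: contraNneq y'2 => ->; rewrite inE eqxx.
have y'l : y' \notin unzip2 l by move: y'2; rewrite inE => /norP[].
have y'x : y' != x by apply: contraNneq y'l => ->.
have y'1 : y' \notin unzip1 l.
  by apply: contra y'l => /pl; rewrite inE (negbTE (nots y' y'Z y'W)).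
have Ly' : leaf s ((x, y') :: (x, y) :: l) j.+1 y'.
  have := leaf_new (y := y') Lx y'l y'x y'1 => -[h2 h1 [p [sp lp up pp]]].
  split; rewrite /= ?inE ?eqxx //; first by rewrite !negb_or y'x y'1.
  exists p; split=> // z /pp; rewrite !inE => /orP[->//|->]; by rewrite !orbT.
have keep z i : leaf s l i z -> z != x -> leaf s ((x, y') :: (x, y) :: l) i z.
  by move=> h zx; apply: leaf_old => //; apply: leaf_old.
have nx z : z \in new -> z != x.
  by move=> zn; apply: contraTneq zn => ->; apply: dis; rewrite mem_head.
have [|||||||l' [new' [h1 h2 h3 h4 [h5 h6]]]] := IH ((x, y') :: (x, y) :: l) (y' :: y :: new) al2.
- move=> z; rewrite /= !inE => /or3P[/eqP->|/eqP->|/pl]; rewrite ?x2 ?orbT //.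
  by rewrite inE => /orP[->//|->]; rewrite !orbT.
- by case/andP: ut.
- have yn z : z \notin unzip2 l -> z \notin new.
    by apply: contra => /Ln[].
  by rewrite /= inE negb_or y'y (yn y') // (yn y).
- move=> z zt; apply: keep; first by apply: Lt; rewrite inE zt orbT.
  by apply: contraTneq zt => ->; case/andP: ut.
- move=> z; rewrite !inE => /or3P[/eqP->|/eqP->|zn] //.
    by apply: leaf_old => //.
  by apply: keep; [apply: Ln|apply: nx].
- by apply: leq_trans big => /=; clear; lia.
- move=> z zt; have [z2 _ _] : leaf s l j z by apply: Lt; rewrite inE zt orbT.
  rewrite !inE !negb_or (dis z) ?inE ?zt ?orbT // andbT.
  by apply/andP; split; [apply: contraNneq y'l => <-|apply: contraNneq y2 => <-].
by exists l', new'; split=> //; split; rewrite ?h5 ?h6 /=; clear; lia.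
Qed.

(** The tree is binary below its first edge: [s] gets only one child, so a connection costs [s] a
    single unit. The [2 ^ j] leaves all have depth [j.+1]. *)
Lemma grow W us s j : used_in W us -> (s \in Z -> s \in W) ->
  extendable W us -> count_mem s us < D ->
  #|W| + 2 ^ j.+1 + slack <= #|Z| ->
  exists l new, [/\ added W us l, {subset unzip1 l <= s :: unzip2 l}, uniq new,
    {in new, forall x, leaf s l j.+1 x} & (size l).+1 = 2 ^ j.+1 /\ size new = 2 ^ j].
Proof using m_gt0 joined D_gt1.
move=> usW sW E cs; elim: j => [|j IH] big.
  have a0 : added W us [::].
    split=> //; suff -> : W :|: [set x in unzip2 ([::] : seq (T * T))] = W by [].
    by apply/setP => x; rewrite !inE orbF.
  have [||y [_ yZ yW al]] := added_cons a0 (s := s) => //; first by rewrite /=; lia.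
  have ys : y != s by apply: contraNneq yW => ys; rewrite ys in yZ *; apply: sW.
  exists [:: (s, y)], [:: y]; split=> //.
    by move=> z; rewrite !inE => ->.
  move=> z; rewrite inE => /eqP->; split; rewrite ?inE ?eqxx //.
  by exists [:: y]; split=> // z; rewrite prs_cons2.
have [|l [new [al pl un Ln [sl sn]]]] := IH; first by rewrite expnS in big; lia.
have [||//|l' [new' [h1 h2 h3 h4 [h5 h6]]]] := grow_level usW sW (new := [::]) al pl un isT Ln.
- by move=> z.
- by move: big sl; rewrite sn !expnS; clear; lia.
by exists l', new'; split=> //; move: sl; rewrite h5 h6 sn !expnS /=; clear; lia.
Qed.

(** The pairs outside [K] are rolled back one by one. [extendable_rollback] does not ask whether the
    removed child has children itself, so any order works. *)
Lemma added_restrict W us l K : added W us l -> uniq K -> {subset K <= l} -> added W us K.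
Proof using Type.
move=> [ul sl el E] uK Kl; have ul' : uniq l by apply: map_uniq ul.
have pe : perm_eq l ([seq ab <- l | ab \notin K] ++ K).
  have h : perm_eq K [seq ab <- l | ab \in K].
    apply: uniq_perm => // [|z]; first exact: filter_uniq.
    by rewrite mem_filter; case: (boolP (z \in K)) => // /Kl ->.
  rewrite perm_sym; apply: perm_trans (_ : perm_eq _ ([seq x <- l | x \in K] ++ [seq x <- l | x \notin K])) _.
    by rewrite perm_catC perm_cat2r.
  by apply/permPl; apply: (perm_filterC (mem K) l).
have : added W us ([seq ab <- l | ab \notin K] ++ K).
  have p2 : perm_eq (unzip2 l) (unzip2 ([seq ab <- l | ab \notin K] ++ K)) by apply: perm_map.
  have p1 : perm_eq (unzip1 l) (unzip1 ([seq ab <- l | ab \notin K] ++ K)) by apply: perm_map.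
  split; first by rewrite -(perm_uniq p2).
  - by move=> z; rewrite -(perm_mem p2); apply: sl.
  - by move=> z; rewrite -(perm_mem pe); apply: el.
  have <- : W :|: [set x in unzip2 l] = W :|: [set x in unzip2 ([seq ab <- l | ab \notin K] ++ K)].
    by apply/setP => z; rewrite !inE (perm_mem p2).
  apply: extendable_weaken E _ => x.
  by rewrite !count_cat (permP p1).
elim: [seq _ <- _ | _] => // [[a y] R IH] [].
rewrite /= => /andP[yR uR] sR eR ER; apply: IH; split=> //.
- by move=> z zR; apply: sR; rewrite inE zR orbT.
- by move=> z zR; apply: eR; rewrite inE zR orbT.
have : y \in Z :\: W by apply: sR; rewrite mem_head.
rewrite inE => /andP[yW yZ].
apply: (extendable_rollback (s := a) (y := y)); rewrite ?yZ //.
- by apply: (eR (a, y)); rewrite mem_head.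
- by rewrite !inE negb_or yW yR.
suff <- : W :|: [set x in y :: unzip2 (R ++ K)] = y |: (W :|: [set x in unzip2 (R ++ K)]) by [].
by apply/setP => x; rewrite !inE orbCA.
Qed.

Lemma path_prs x p : {in prs (x :: p), forall ab, e ab.1 ab.2} -> path e x p.
Proof using Type.
elim: p x => // y p IH x h; rewrite /= (h (x, y)) ?prs_cons2 ?mem_head //=.
by apply: IH => ab abp; apply: h; rewrite prs_cons2 inE abp orbT.
Qed.

Lemma count_belast x p z : count_mem z (belast x p) <= count_mem z (x :: p).
Proof using Type. by rewrite lastI -cats1 count_cat leq_addr. Qed.

(** Trees grown from [x] and from [y] have at least [m] leaves each, so [joined] gives an edge
    between leaves; everything but the resulting path is rolled back. The number of interior
    vertices is exactly [2 * j.+1], which later fixes the parity of the rails and makes all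
    connections non-empty. *)
Lemma connect_pair W us x y j : extendable W us -> used_in W us -> x != y ->
  count_mem x us < D -> count_mem y us < D -> (x \in Z -> x \in W) -> (y \in Z -> y \in W) ->
  m <= 2 ^ j -> #|W| + 2 * 2 ^ j.+1 + slack <= #|Z| ->
  exists P, [/\ size P = 2 * j.+1, path e x (rcons P y), uniq P, {subset P <= Z :\: W}
    & extendable (W :|: [set z in P]) (x :: y :: P ++ us)].
Proof using se m_gt0 joined D_gt1.
move=> E usW xy cx cy xW yW mj big.
have [|l1 [new1 [al1 pl1 un1 Ln1 [sl1 sn1]]]] := grow usW xW E cx (j := j).
  by move: big; clear; lia.
pose W1 := W :|: [set z in unzip2 l1]; pose us1 := unzip1 l1 ++ us.
have [ul1 k1W el1 E1] := al1.
have k1Z z : z \in unzip2 l1 -> z \in Z /\ z \notin W by move/k1W; rewrite inE => /andP[].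
have yk1 : y \notin unzip2 l1.
  by apply/negP => /k1Z[yZ]; rewrite yW.
have y1 : y \notin unzip1 l1.
  by apply/negP => /pl1; rewrite inE eq_sym (negbTE xy) (negbTE yk1).
have usW1 : used_in W1 us1.
  move=> z zZ; rewrite !inE mem_cat => /orP[/pl1|zu]; last by rewrite usW.
  by rewrite inE => /orP[/eqP zx|->]; rewrite ?orbT // zx xW // -zx.
have yW1 : y \in Z -> y \in W1 by move=> /yW; rewrite inE => ->.
have cy1 : count_mem y us1 < D by rewrite count_cat (count_memPn y1).
have cW1 : #|W1| <= #|W| + size l1.
  apply: leq_trans (leq_card_setU _ _) _; rewrite leq_add2l cardsE.
  by rewrite (leq_trans (card_size _)) // size_map.
have [|l2 [new2 [al2 pl2 un2 Ln2 [sl2 sn2]]]] := grow usW1 yW1 E1 cy1 (j := j).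
  by move: big cW1 sl1; clear; lia.
have [ul2 k2W el2 E2] := al2.
have k2Z z : z \in unzip2 l2 -> [/\ z \in Z, z \notin W & z \notin unzip2 l1].
  by move/k2W; rewrite !inE negb_or => /andP[/andP[-> ->] ->].
have al : added W us (l2 ++ l1).
  split.
  - rewrite /unzip2 map_cat cat_uniq ul2 ul1 andbT /=.
    by apply/hasPn => z zk1; apply/negP => /k2Z[_ _]; rewrite zk1.
  - by move=> z; rewrite /unzip2 map_cat mem_cat inE => /orP[/k2Z[-> -> _]|/k1Z[-> ->]].
  - by move=> z; rewrite mem_cat => /orP[/el2|/el1].
  - rewrite /unzip1 map_cat -catA.
    suff -> : W :|: [set z in unzip2 (l2 ++ l1)] = W1 :|: [set z in unzip2 l2] by [].
    by apply/setP => z; rewrite !inE /unzip2 map_cat mem_cat -orbA [_ || (z \in map _ l1)]orbC.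
have card_new (new : seq T) : uniq new -> size new = 2 ^ j -> m <= #|[set z in new]|.
  by move=> un sn; rewrite cardsE (card_uniqP un) sn.
have [a [b []]] := joined (card_new _ un1 sn1) (card_new _ un2 sn2).
rewrite !inE => an bn ab.
have [_ _ [p1 [sp1 lp1 up1 pp1]]] := Ln1 a an.
have [_ _ [p2 [sp2 lp2 up2 pp2]]] := Ln2 b bn.
have p1k z : z \in p1 -> z \in unzip2 l1.
  by rewrite -(prs_unzip2 x p1) => /mapP[w /pp1 wl ->]; apply: map_f.
have p2k z : z \in p2 -> z \in unzip2 l2.
  by rewrite -(prs_unzip2 y p2) => /mapP[w /pp2 wl ->]; apply: map_f.
pose K := prs (x :: p1) ++ prs (y :: p2).
have K2 : unzip2 K = p1 ++ p2 by rewrite /unzip2 map_cat -!/(unzip2 _) !prs_unzip2.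
have K1 : unzip1 K = belast x p1 ++ belast y p2.
  by rewrite /unzip1 map_cat -!/(unzip1 _) !prs_unzip1.
have up12 : uniq (p1 ++ p2).
  rewrite cat_uniq up1 up2 andbT /=; apply/hasPn => z /p2k /k2Z[_ _ h].
  by apply: contra h; apply: p1k.
have [|z|uK sK eK EK] := added_restrict al (K := K).
- by apply: (map_uniq (f := snd)); rewrite -/(unzip2 K) K2.
- by rewrite !mem_cat => /orP[/pp1 ->|/pp2 ->]; rewrite ?orbT.
exists (p1 ++ rev p2); split.
- by rewrite size_cat size_rev sp1 sp2; clear; lia.
- rewrite -cats1 -catA cats1 -rev_cons cat_path lastI rev_rcons /= lp1 lp2 ab /=.
  rewrite path_prs => [|z zp]; last by apply: eK; rewrite mem_cat zp.
  rewrite -lp2 rev_path; under eq_path do rewrite se.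
  by apply: path_prs => z zp; apply: eK; rewrite mem_cat zp orbT.
- move: up12; rewrite !cat_uniq rev_uniq => /and3P[-> h ->]; rewrite andbT /=.
  by apply: contra h => /hasP[z]; rewrite mem_rev => z2 z1; apply/hasP; exists z.
- by move=> z zp; apply: sK; rewrite K2; move: zp; rewrite !mem_cat mem_rev.
have <- : W :|: [set z in unzip2 K] = W :|: [set z in p1 ++ rev p2].
  by apply/setP => z; rewrite !inE K2 !mem_cat mem_rev.
apply: extendable_weaken EK _ => z; rewrite K1 /= !count_cat count_rev.
have := count_belast x p1 z; have := count_belast y p2 z; rewrite /=; clear; lia.
Qed.

Lemma connect_all W us ps j : extendable W us -> used_in W us -> m <= 2 ^ j ->
  {in ps, forall pq, pq.1 != pq.2} ->
  {in unzip1 ps ++ unzip2 ps, forall v, v \in Z -> v \in W} ->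
  {in unzip1 ps ++ unzip2 ps, forall v, count_mem v us + count_mem v (unzip1 ps ++ unzip2 ps) <= D} ->
  #|W| + size ps * (2 * j.+1) + 2 * 2 ^ j.+1 + slack <= #|Z| ->
  exists Ps, [/\ all2 (fun pq P => path e pq.1 (rcons P pq.2)) ps Ps, uniq (flatten Ps),
    {subset flatten Ps <= Z :\: W}, {in Ps, forall P, size P = 2 * j.+1} &
    extendable (W :|: [set z in flatten Ps]) (unzip1 ps ++ unzip2 ps ++ flatten Ps ++ us)].
Proof using se m_gt0 joined D_gt1.
move=> E usW mj; elim: ps W us E usW => [|[x y] ps IH] W us E usW ne inW cD big.
  exists [::]; split=> //=.
  suff -> : W :|: [set z in [::]] = W by [].
  by apply/setP => z; rewrite !inE orbF.
have mem v : v \in unzip1 ps ++ unzip2 ps ->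
    v \in unzip1 ((x, y) :: ps) ++ unzip2 ((x, y) :: ps).
  by rewrite /= !(mem_cat, inE) => /orP[->|->]; rewrite ?orbT.
have xm : x \in unzip1 ((x, y) :: ps) ++ unzip2 ((x, y) :: ps) by rewrite /= mem_head.
have ym : y \in unzip1 ((x, y) :: ps) ++ unzip2 ((x, y) :: ps).
  by rewrite /= inE mem_cat mem_head !orbT.
have cnt v : count_mem v (unzip1 ((x, y) :: ps) ++ unzip2 ((x, y) :: ps)) =
    (x == v) + (y == v) + count_mem v (unzip1 ps ++ unzip2 ps).
  by rewrite /= !count_cat /=; clear; lia.
have xy : x != y by apply: (ne (x, y)); rewrite mem_head.
have [|||P [sP pP uP PZ EP]] := connect_pair E usW xy _ _ (inW x xm) (inW y ym) mj.
- by have := cD x xm; rewrite cnt eqxx; clear; lia.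
- by have := cD y ym; rewrite cnt eqxx; clear; lia.
- by move: big => /=; clear; lia.
have nP v : v \in unzip1 ps ++ unzip2 ps -> v \notin P.
  move=> /mem /inW h; apply/negP => /PZ; rewrite inE => /andP[/negP h1 h2].
  by apply: h1; apply: h.
have cWP : #|W :|: [set z in P]| <= #|W| + 2 * j.+1.
  apply: leq_trans (leq_card_setU _ _) _; rewrite leq_add2l cardsE.
  by rewrite (leq_trans (card_size _)) // sP.
have usW' : used_in (W :|: [set z in P]) (x :: y :: P ++ us).
  move=> z zZ; rewrite 2!in_cons mem_cat 2!inE => /or4P[/eqP zx|/eqP zy|->|/(usW z zZ)->] //.
  - by rewrite zx (inW x xm) // -zx.
  - by rewrite zy (inW y ym) // -zy.
  - by rewrite orbT.
have [||||Ps [aPs uPs PsZ sPs EPs]] := IH _ _ EP usW'.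
- by move=> pq pqs; apply: ne; rewrite inE pqs orbT.
- by move=> v /mem vm vZ; rewrite inE inW.
- move=> v vm; have := cD v (mem v vm); rewrite cnt /= !count_cat (count_memPn (nP v vm)).
  by clear; lia.
- by move: big cWP => /=; clear; lia.
have nPs z : z \in flatten Ps -> [/\ z \in Z, z \notin W & z \notin P].
  by move/PsZ; rewrite !inE negb_or => /andP[/andP[-> ->] ->].
exists (P :: Ps); split=> /=.
- by rewrite pP.
- rewrite cat_uniq uP uPs andbT /=; apply/hasPn => z /nPs[_ _]; exact.
- by move=> z; rewrite mem_cat inE => /orP[/PZ|/nPs[-> -> _]//]; rewrite inE.
- by move=> Q; rewrite inE => /orP[/eqP->|/sPs].
have -> : W :|: [set z in P ++ flatten Ps] = W :|: [set z in P] :|: [set z in flatten Ps].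
  by apply/setP => z; rewrite !inE mem_cat orbA.
apply: extendable_weaken EPs _ => z; rewrite /= !count_cat /= !count_cat; clear; lia.
Qed.

End Connecting.
End Connecting.
Export Connecting.

(** * Ladders *)

Section Gadgets.
Variables (T : finType) (e : rel T).
Implicit Types (x y : T) (l r : seq T) (Rs : seq (seq T)).

(* The zigzag through the ladder with rails [l], [r] and rungs [Rs]: it crosses every
   rung and alternates between the two rails; [zig true] and [zig false] have the
   same vertices but end on different rails. *)
Fixpoint zig (b : bool) l r Rs := match l, r, Rs with
  | x :: l', y :: r', R :: Rs' =>
      (if b then x :: rcons R y else y :: rcons (rev R) x) ++ zig (~~ b) l' r' Rs'
  | _, _, _ => [::]
  end.

Definition joins (pq : T * T) (P : seq T) := path e pq.1 (rcons P pq.2).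

Lemma joins_rev x y R : symmetric e -> joins (x, y) R -> joins (y, x) (rev R).
Proof.
move=> se; rewrite /joins /= => h.
have E : rcons (rev R) x = rev (belast x (rcons R y)).
  by rewrite belast_rcons rev_cons.
have L : y = last x (rcons R y) by rewrite last_rcons.
by rewrite E [in X in path e X]L rev_path; under eq_path do rewrite se.
Qed.

Lemma zig_path b l r Rs x y : symmetric e -> path e x l -> path e y r ->
  size l = size r -> all2 joins (zip l r) Rs ->
  path e (if b then x else y) (zig b l r Rs) /\
  last (if b then x else y) (zig b l r Rs) =
    if b (+) odd (size l) then last x l else last y r.
Proof.
move=> se; elim: l r Rs b x y => [|x1 l IH] [|y1 r] [|R Rs] b x y //=.
  by rewrite addbF; case: b.
move=> /andP[xx1 pl] /andP[yy1 pr] [sz] /andP[jR jRs].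
have := IH r Rs (~~ b) x1 y1 pl pr sz jRs.
have := joins_rev se jR; move: jR; rewrite /joins /= => jR jR'.
rewrite addNb addbN.
case: b => /= -[h1 h2]; rewrite cat_path last_cat last_rcons.
  by rewrite xx1 jR h1 h2.
by rewrite yy1 jR' h1 h2.
Qed.

Lemma zig_perm b l r Rs : size l = size r -> size Rs = size l ->
  perm_eq (zig b l r Rs) (l ++ r ++ flatten Rs).
Proof.
elim: l r Rs b => [|x l IH] [|y r] [|R Rs] b //= [sz] [sR]; apply/permP => a.
have /permP/(_ a) := IH r Rs (~~ b) sz sR; rewrite !count_cat => E.
case: b E => /= E; rewrite -!cats1 ?(count_cat, count_rev) /= ?(count_cat, count_rev) /=;
  by rewrite ?(count_cat, count_rev) /= E; clear; lia.
Qed.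

Lemma mem_zip_pair x y l r : (x, y) \in zip l r -> x \in l /\ y \in r.
Proof.
elim: l r => [|a l IH] [|b r] //=; rewrite !inE => /orP[|/IH[-> ->]]; last by rewrite !orbT.
by rewrite xpair_eqE => /andP[-> ->].
Qed.

Record gadget := Gadget { gu : T; gz : T; gz' : T; gv : T; gM : seq T; gM' : seq T }.

Definition gA G := gu G :: rcons (gM G) (gz G).
Definition gB G := [:: gz' G; gv G].
Definition gverts G := gA G ++ gB G.

(* [gA] and [gB] can be replaced by the paths through [gM'], which exchange the
   ends [gz] and [gz'] and cover the same vertices. *)
Definition switch G := [/\ path e (gu G) (rcons (gM G) (gz G)),
  path e (gu G) (rcons (gM' G) (gz' G)), e (gz G) (gv G) && e (gz' G) (gv G),
  perm_eq (gM G) (gM' G) & uniq (gverts G)].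

Variables (Z : {set T}) (D m : nat).
Hypotheses (se : symmetric e) (m_gt0 : 0 < m) (D_ge : 8 <= D).
Hypothesis joined : forall X Y : {set T}, m <= #|X| -> m <= #|Y| ->
  exists x y, [/\ x \in X, y \in Y & e x y].
Local Notation extendable := (extendable e Z D m).
Local Notation slack := (slack D m).

(** The vertex [h] only supplies two fresh vertices [u] and [v]. Two paths from [u] to [v] become
    the rails once their last vertices [zl] and [zr] are set aside, and corresponding rail vertices
    are connected by rungs. This makes [2 + 2 * (2 * j + 2) + (2 * j + 1) * (2 * j + 2)]
    vertices. *)
Lemma gadget_exists (W : {set T}) us h j : extendable W us -> used_in Z W us ->
  (h \in Z -> h \in W) -> count_mem h us + 2 <= D -> m <= 2 ^ j ->
  #|W| + (2 * j + 4) ^ 2 + 2 * 2 ^ j.+1 + slack <= #|Z| ->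
  exists G us', [/\ switch G, {subset gverts G <= Z :\: W},
    size (gverts G) <= (2 * j + 4) ^ 2,
    extendable (W :|: [set x in gverts G]) us' &
    forall x, count_mem x us' <= count_mem x us + 2 * (x == h) + 2 * (x \in gverts G)].
Proof using se m_gt0 D_ge joined.
move=> E usW hW ch mj big.
have sq : (2 * j + 4) ^ 2 = (2 * j + 4) * (2 * j + 4) by rewrite expnS expn1.
have D1 : 1 < D by apply: leq_trans D_ge.
have [||u [uZ uW hu Eu]] := extendable_leaf m_gt0 joined E (s := h).
- by move: ch; clear; lia.
- by move: big; rewrite /Connecting.slack; clear; lia.
have [||v [vZ vW hv Ev]] := extendable_leaf m_gt0 joined Eu (s := h).
- by move: ch; rewrite /= eqxx; clear; lia.
- by move: big; rewrite /Connecting.slack cardsU1 uW sq; clear; lia.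
move: vW; rewrite !inE => /norP[vu vW].
have us_old x : x \in Z -> x \notin W -> count_mem x us = 0.
  by move=> xZ xW; apply/count_memPn; apply: contra xW; apply: usW.
have hn x : x \in Z -> x \notin W -> (h == x) = false.
  by move=> xZ xW; apply/eqP => hx; case/negP: xW; rewrite -hx hW // hx.
set W1 := v |: (u |: W) in Ev; set us1 := h :: h :: us in Ev.
have cW1 : #|W1| <= #|W| + 2 by rewrite !cardsU1; do 2!case: (_ \notin _); clear; lia.
have usW1 : used_in Z W1 us1.
  move=> x xZ; rewrite !inE => /or3P[/eqP xh|/eqP xh|/(usW x xZ)->]; rewrite ?orbT //;
  by rewrite xh hW ?orbT // -xh.
have [|||||||P1 [sP1 pP1 uP1 P1Z E1]] := connect_pair se m_gt0 D1 joined Ev usW1 (x := u) (y := v) (j := j) => //.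
- by rewrite eq_sym.
- by rewrite /= us_old // hn //; apply: leq_trans D_ge.
- by rewrite /= us_old // hn //; apply: leq_trans D_ge.
- by move=> _; rewrite !inE eqxx orbT.
- by move=> _; rewrite !inE eqxx.
- by move: big cW1; rewrite sq; clear; lia.
set W2 := W1 :|: _ in E1; set us2 := u :: v :: _ in E1.
have cu2 x : count_mem x us2 =
    (u == x) + (v == x) + count_mem x P1 + 2 * (h == x) + count_mem x us.
  by rewrite /us2 /us1 /= count_cat /=; clear; lia.
have P1n x : x \in P1 -> [/\ x \in Z, x \notin W, x != u & x != v].
  by move/P1Z; rewrite !inE !negb_or => /andP[/and3P[-> -> ->] ->].
have uP1' : u \notin P1 by apply/negP => /P1n[_ _]; rewrite eqxx.
have vP1' : v \notin P1 by apply/negP => /P1n[_ _ _]; rewrite eqxx.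
have cW2 : #|W2| <= #|W1| + (2 * j + 2).
  apply: leq_trans (leq_card_setU _ _) _; rewrite leq_add2l cardsE.
  by rewrite (leq_trans (card_size _)) // sP1; clear; lia.
have usW2 : used_in Z W2 us2.
  move=> x xZ; rewrite /us2 2!in_cons mem_cat => /or4P[/eqP->|/eqP->|xP|/(usW1 x xZ) xW1].
  - by rewrite !inE eqxx !orbT.
  - by rewrite !inE eqxx.
  - by rewrite inE [x \in [set _ in _]]inE xP orbT.
  - by rewrite inE xW1.
have [|||||||P2 [sP2 pP2 uP2 P2Z E2]] := connect_pair se m_gt0 D1 joined E1 usW2 (x := u) (y := v) (j := j) => //.
- by rewrite eq_sym.
- by rewrite cu2 eqxx (negbTE vu) (count_memPn uP1') us_old // hn //; apply: leq_trans D_ge.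
- by rewrite cu2 eqxx eq_sym (negbTE vu) (count_memPn vP1') us_old // hn //; apply: leq_trans D_ge.
- by move=> _; rewrite !inE eqxx !orbT.
- by move=> _; rewrite !inE eqxx.
- by move: big cW1 cW2; rewrite sq; clear; lia.
set W3 := W2 :|: _ in E2; set us3 := u :: v :: _ in E2.
have cu3 x : count_mem x us3 = 2 * (u == x) + 2 * (v == x) + count_mem x P1
    + count_mem x P2 + 2 * (h == x) + count_mem x us.
  rewrite /us3 /= count_cat cu2; move: (count_mem x P1) (count_mem x P2) (count_mem x us); clear.
  by case: (u == x) (v == x) (h == x) => [] [] [] *; lia.
have P2n x : x \in P2 -> [/\ x \in Z, x \notin W, x != u, x != v & x \notin P1].
  by move/P2Z; rewrite !inE !negb_or => /andP[/andP[/and3P[-> -> ->] ->] ->].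
have uP2' : u \notin P2 by apply/negP => /P2n[_ _]; rewrite eqxx.
have vP2' : v \notin P2 by apply/negP => /P2n[_ _ _]; rewrite eqxx.
have cW3 : #|W3| <= #|W2| + (2 * j + 2).
  apply: leq_trans (leq_card_setU _ _) _; rewrite leq_add2l cardsE.
  by rewrite (leq_trans (card_size _)) // sP2; clear; lia.
have usW3 : used_in Z W3 us3.
  move=> x xZ; rewrite /us3 2!in_cons mem_cat => /or4P[/eqP->|/eqP->|xP|/(usW2 x xZ) xW1].
  - by rewrite !inE eqxx !orbT.
  - by rewrite !inE eqxx.
  - by rewrite inE [x \in [set _ in _]]inE xP orbT.
  - by rewrite inE xW1.
have [l [zl El]] : exists l z, P1 = rcons l z.
  by case: (lastP P1) sP1 => [|l z] //= _; exists l, z.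
have [r [zr Er]] : exists r z, P2 = rcons r z.
  by case: (lastP P2) sP2 => [|r z] //= _; exists r, z.
have sl : size l = 2 * j + 1 by move: sP1; rewrite El size_rcons; clear; lia.
have sr : size r = 2 * j + 1 by move: sP2; rewrite Er size_rcons; clear; lia.
have slr : size l = size r by rewrite sl sr.
have U1 : unzip1 (zip l r) = l by rewrite unzip1_zip // slr.
have U2 : unzip2 (zip l r) = r by rewrite unzip2_zip // slr.
have lP x : x \in l -> x \in P1 by rewrite El mem_rcons inE => ->; rewrite orbT.
have rP x : x \in r -> x \in P2 by rewrite Er mem_rcons inE => ->; rewrite orbT.
have ulr : uniq (l ++ r).
  move: uP1 uP2; rewrite El Er !rcons_uniq => /andP[_ ul] /andP[_ ur].
  rewrite cat_uniq ul ur andbT /=; apply/hasPn => x xr; apply/negP => xl.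
  by have [_ _ _ _ /negP[]] := P2n x (rP x xr); apply: lP.
have [|||| Rs [aRs uRs RsZ sRs E4]] := connect_all se m_gt0 D1 joined E2 usW3 mj (ps := zip l r).
- move=> [a b] /mem_zip_pair[al br].
  by apply/eqP => /= ab; have [_ _ _ _ /negP[]] := P2n b (rP b br); rewrite -ab; apply: lP.
- move=> x; rewrite U1 U2 mem_cat => /orP[/lP|/rP] xP _; rewrite !inE xP ?orbT //.
- move=> x; rewrite U1 U2 => xlr; rewrite (count_uniq_mem _ ulr) xlr.
  have xx : [/\ x \in Z, x \notin W, u == x = false & v == x = false] /\ (x \in P1) + (x \in P2) <= 1.
    move: xlr; rewrite mem_cat => /orP[/lP|/rP] xP.
      have [xZ xW xu xv] := P1n x xP; split; first by rewrite !(eq_sym _ x) (negbTE xu) (negbTE xv).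
      by rewrite xP; case: (boolP (x \in P2)) => // /P2n[_ _ _ _]; rewrite xP.
    have [xZ xW xu xv /negbTE->] := P2n x xP; split; last by case: (x \in P2).
    by rewrite !(eq_sym _ x) (negbTE xu) (negbTE xv).
  have [[xZ xW xu xv] cP] := xx.
  rewrite cu3 xu xv (hn x) // us_old //.
  by rewrite (count_uniq_mem _ uP1) (count_uniq_mem _ uP2); move: cP D_ge; clear; lia.
- rewrite size_zip -slr minnn sl; move: big cW1 cW2 cW3; rewrite sq; clear; nia.
have Rn x : x \in flatten Rs -> [/\ x \in Z, x \notin W, x != u, x != v & x \notin P1 ++ P2].
  move/RsZ; rewrite !inE !negb_or mem_cat negb_or.
  by move=> /andP[/andP[/andP[/and3P[-> -> ->] ->] ->] ->].
have pu : path e u l /\ e (last u l) zl /\ e zl v.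
  by move: pP1; rewrite El !rcons_path last_rcons => /andP[/andP[-> ->] ->].
have pv : path e u r /\ e (last u r) zr /\ e zr v.
  by move: pP2; rewrite Er !rcons_path last_rcons => /andP[/andP[-> ->] ->].
have [[pl [ll vl]] [pr [lr vr]]] := (pu, pv).
have sRs' : size Rs = size l.
  by move: aRs; rewrite all2E => /andP[/eqP <- _]; rewrite size_zip -slr minnn.
(* With an odd number of rungs the zigzag starting on [l] ends on [r], next to [zr], and the other
   one ends on [l], next to [zl]. This is what makes the exchange possible. *)
have od : odd (size l) by rewrite sl addn1 /= mul2n odd_double.
have [pt lt] := zig_path true se pl pr slr aRs.
have [pf lf] := zig_path false se pl pr slr aRs.
rewrite od /= in lt lf.
have pz b : perm_eq (zig b l r Rs) (l ++ r ++ flatten Rs) by apply: zig_perm.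
pose G := Gadget u zr zl v (zig true l r Rs) (zig false l r Rs).
have pG : perm_eq (gverts G) (u :: v :: P1 ++ P2 ++ flatten Rs).
  apply/permP => a; rewrite /gverts /gA /gB /= count_cat -cats1 count_cat (permP (pz true)).
  by rewrite El Er -!cats1 !count_cat /=; clear; lia.
have uR x : x \in flatten Rs -> x \notin P1 ++ P2 by case/Rn.
have uG : uniq (gverts G).
  rewrite (perm_uniq pG) /= inE mem_cat negb_or eq_sym vu negb_or uP1' mem_cat negb_or uP2' /=.
  rewrite !mem_cat !negb_or vP1' vP2' /= !cat_uniq uP1 uP2 uRs /= !andbT.
  apply/and4P; split.
  - by apply/negP => /Rn[_ _]; rewrite eqxx.
  - by apply/negP => /Rn[_ _ _]; rewrite eqxx.
  - apply/hasPn => x; rewrite mem_cat => /orP[/P2n[]//|/uR].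
    by rewrite mem_cat negb_or => /andP[].
  - by apply/hasPn => x /uR; rewrite mem_cat negb_or => /andP[].
exists G, (l ++ r ++ flatten Rs ++ us3); split.
- split=> //; rewrite /= ?vl ?vr //; first by rewrite rcons_path pt lt.
    by rewrite rcons_path pf lf.
  by rewrite (perm_trans (pz true)) // perm_sym.
- move=> x; rewrite (perm_mem pG) !in_cons !mem_cat inE => /or4P[/eqP->|/eqP->|/P1n[-> ->]//|].
  + by rewrite uZ uW.
  + by rewrite vZ vW.
  + by case/orP => [/P2n[-> ->]//|/Rn[-> ->]].
- rewrite (perm_size pG) /= !size_cat sP1 sP2 sq.
  have -> : size (flatten Rs) = (2 * j + 1) * (2 * j + 2).
    rewrite size_flatten /shape; have -> : map size Rs = nseq (size Rs) (2 * j + 2).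
      elim: Rs sRs {aRs uRs RsZ E4 sRs' Rn pt lt pf lf pz G pG uR uG} => //= R Rs IH hR.
      by rewrite hR ?mem_head // IH => [|Q QR]; [congr (_ :: _); clear; lia|rewrite hR ?inE ?QR ?orbT].
    by rewrite sumn_nseq sRs' sl mulnC.
  by clear; nia.
- rewrite U1 U2 in E4.
  suff -> : W :|: [set x in gverts G] = W3 :|: [set x in flatten Rs] by [].
  apply/setP => x; rewrite in_setU in_set (perm_mem pG) !in_cons !mem_cat.
  rewrite /W3 /W2 /W1 !in_setU !in_set !in_set1.
  by case: (x \in W) (x \in P1) (x \in P2) (x \in flatten Rs) (x == u) (x == v) => [] [] [] [] [] [].
- move=> x; rewrite (perm_mem pG) !count_cat cu3.
  rewrite (count_uniq_mem _ uP1) (count_uniq_mem _ uP2) (count_uniq_mem _ uRs).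
  have ux : uniq [:: u, v & P1 ++ P2 ++ flatten Rs] by rewrite -(perm_uniq pG).
  have := count_uniq_mem x ux.
  rewrite /= !count_cat (count_uniq_mem _ uP1) (count_uniq_mem _ uP2) (count_uniq_mem _ uRs) => <-.
  have lx : count_mem x l <= (x \in P1) by rewrite -(count_uniq_mem _ uP1) El -cats1 count_cat leq_addr.
  have rx : count_mem x r <= (x \in P2) by rewrite -(count_uniq_mem _ uP2) Er -cats1 count_cat leq_addr.
  rewrite (eq_sym x h); move: lx rx; clear.
  move: (count_mem x l) (count_mem x r) (count_mem x us).
  by case: (x \in P1) (x \in P2) (x \in flatten Rs) (h == x) (u == x) (v == x) => [] [] [] [] [] [] *; lia.
Qed.

End Gadgets.

HB.instance Definition _ (T : finType) := gen_eqMixin (gadget T).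

(** * The path through all ladders *)

Section Gadgets.
Variables (T : finType) (e : rel T).
Variables (Z : {set T}) (D m : nat).
Hypotheses (se : symmetric e) (m_gt0 : 0 < m) (D_ge : 8 <= D).
Hypothesis joined : forall X Y : {set T}, m <= #|X| -> m <= #|Y| ->
  exists x y, [/\ x \in X, y \in Y & e x y].
Local Notation extendable := (extendable e Z D m).
Local Notation slack := (slack D m).

(** Each further ladder is rooted at the vertex [gv] of the previous one. That vertex has used at
    most two of its units and spends two more as a root, whence the factor 4. *)
Lemma gadgets_exist N (W : {set T}) us h j : extendable W us -> used_in Z W us ->
  (h \in Z -> h \in W) -> count_mem h us + 2 <= D -> m <= 2 ^ j ->
  #|W| + N * (2 * j + 4) ^ 2 + 2 * 2 ^ j.+1 + slack <= #|Z| ->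
  exists (gs : seq (gadget T)) us', let vs := flatten [seq gverts G | G <- gs] in
    [/\ size gs = N, {in gs, forall G, switch e G} /\ uniq vs, {subset vs <= Z :\: W},
      size vs <= N * (2 * j + 4) ^ 2 /\ extendable (W :|: [set x in vs]) us' &
      forall x, count_mem x us' <= count_mem x us + 2 * (x == h) + 4 * (x \in vs)].
Proof using se m_gt0 D_ge joined.
move=> E usW hW ch mj; elim: N W us h E usW hW ch => [|N IH] W us h E usW hW ch big.
  exists [::], us; split=> //; last by move=> x; rewrite -addnA leq_addr.
  split=> //; suff -> : W :|: [set x in flatten [seq gverts G | G <- [::] : seq (gadget T)]] = W by [].
  by apply/setP => x; rewrite !inE orbF.
have [|G [us1 [swG GZ sG E1 c1]]] := gadget_exists se m_gt0 D_ge joined E usW hW ch mj.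
  by apply: leq_trans big; rewrite mulSn; clear; lia.
have uG : uniq (gverts G) by case: swG.
have vG : gv G \in gverts G by rewrite mem_cat !inE eqxx !orbT.
set W1 := W :|: _ in E1.
have usW1 : used_in Z W1 us1.
  move=> x xZ; rewrite -has_pred1 has_count => x1; rewrite !in_setU in_set.
  case: (boolP (x \in gverts G)) => xG; first by rewrite orbT.
  rewrite orbF; have := leq_trans x1 (c1 x); rewrite (negbTE xG) muln0 addn0.
  case: eqP => [xh _|_]; first by rewrite xh hW // -xh.
  by rewrite addn0 -has_count has_pred1; apply: usW.
have /setDP[vZ vW] := GZ _ vG.
have vh : gv G != h by apply: contraNneq vW => vh; rewrite vh hW // -vh.
have v0 : count_mem (gv G) us = 0 by apply/count_memPn; apply: contra vW; apply: usW.
have [|||gs [us2 [sgs [swgs ugs] gsZ [szgs E2] c2]]] := IH W1 us1 (gv G) E1 usW1.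
- by move=> _; rewrite !in_setU in_set vG orbT.
- have := c1 (gv G); rewrite v0 vG (negbTE vh); move: D_ge; clear; lia.
- have := leq_card_setU W [set x in gverts G]; rewrite -/W1 => -[cW _].
  have cG : #|[set x in gverts G]| <= size (gverts G) by rewrite cardsE card_size.
  move: cG cW sG big; clear.
  by move: ((_ + 4) ^ 2) (2 ^ _) slack => q ? ?; rewrite mulSn; move: (N * q) => *; lia.
have dis x : x \in flatten [seq gverts G | G <- gs] -> x \notin gverts G.
  by move/gsZ; rewrite in_setD in_setU in_set negb_or => /andP[/andP[]].
exists (G :: gs), us2.
have -> : flatten [seq gverts H | H <- G :: gs] = gverts G ++ flatten [seq gverts H | H <- gs].
  by [].
split; first by rewrite /= sgs.
- split; first by move=> H; rewrite inE => /orP[/eqP->|/swgs].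
  rewrite cat_uniq uG ugs andbT; apply/hasPn => x; exact: dis.
- move=> x; rewrite mem_cat => /orP[/GZ//|/gsZ].
  by rewrite !in_setD in_setU negb_or => /andP[/andP[-> _] ->].
- split; first by rewrite size_cat mulSn leq_add.
  suff -> : W :|: [set x in gverts G ++ flatten [seq gverts G | G <- gs]] =
    W1 :|: [set x in flatten [seq gverts G | G <- gs]] by [].
  by apply/setP => x; rewrite !in_setU !in_set mem_cat orbA.
- move=> x; rewrite mem_cat; have := c1 x; have := c2 x.
  case: (boolP (x \in flatten _)) => [/dis xG|_]; first rewrite (negbTE xG) /=.
    have -> : (x == gv G) = false by apply: contraNF xG => /eqP->.
    by clear; lia.
  case: (boolP (x \in gverts G)) => xG /=; last first.
    have -> : (x == gv G) = false by apply: contraNF xG => /eqP->.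
    by clear; lia.
  by case: eqP; case: eqP; clear; lia.
Qed.

End Gadgets.

Section Weave.
Variable T : eqType.
Implicit Types (X Y c L : seq T) (Ps Cs : seq (seq T)).

Fixpoint weave X Cs Ps := match Cs, Ps with
  | c :: Cs', Y :: Ps' => X ++ c ++ weave Y Cs' Ps'
  | _, _ => X
  end.

Lemma prs_catS X Y : {subset prs X <= prs (X ++ Y)} /\ {subset prs Y <= prs (X ++ Y)}.
Proof.
case: X => [|x X]; first by split.
case: Y => [|y Y]; first by rewrite cats0; split.
by split=> p pp; rewrite prs_cat mem_cat ?in_cons pp ?orbT.
Qed.

Lemma prs_cat_inv X Y x y : (x, y) \in prs (X ++ Y) ->
  [\/ (x, y) \in prs X, (x, y) \in prs Y | [/\ x \in X, y \in Y & y = head y Y]].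
Proof.
case: X => [|a X]; first by move=> h; constructor 2.
case: Y => [|b Y]; first by rewrite cats0 => h; constructor 1.
rewrite prs_cat mem_cat in_cons => /or3P[h|/eqP[-> ->]|h].
- by constructor 1.
- by constructor 3; split; [exact: mem_last|exact: mem_head|].
- by constructor 2.
Qed.

Lemma weave_perm X Cs Ps : size Cs = size Ps ->
  perm_eq (weave X Cs Ps) (X ++ flatten Ps ++ flatten Cs).
Proof.
elim: Ps X Cs => [|Y Ps IH] X [|c Cs] //=; first by rewrite cats0.
move=> [sz].
rewrite perm_cat2l.
apply/permP => a; rewrite !count_cat; have /permP/(_ a) := IH Y Cs sz.
by rewrite !count_cat => ->; clear; lia.
Qed.

(** Since all connections are non-empty, two different pieces are never joined directly. So on the
    vertices of a ladder the long path has no consecutive pairs beyond those of its two pieces. *)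
Lemma weave_prs X Cs Ps x y : size Cs = size Ps -> all (fun c => c != [::]) Cs ->
  {in flatten Cs, forall z, z \notin X ++ flatten Ps} -> uniq (weave X Cs Ps) -> (x, y) \in prs (weave X Cs Ps) ->
  x \in X ++ flatten Ps -> y \in X ++ flatten Ps ->
  exists2 Y, Y \in X :: Ps & (x, y) \in prs Y.
Proof.
elim: Ps X Cs => [|Y Ps IH] X [|c Cs] //=.
  by move=> _ _ _ _ h _ _; exists X; rewrite ?mem_head.
move=> [sz] /andP[c0 C0] dis uw xy xP yP.
have disc z : z \in c -> z \in X ++ flatten (Y :: Ps) -> False.
  by move=> zc zP; have := dis z; rewrite mem_cat zc zP => /(_ isT).
move: uw; rewrite cat_uniq has_cat negb_or => /and3P[_ /andP[_ /hasPn Xw]].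
rewrite cat_uniq => /and3P[_ _ uw].
have Yw z : z \in weave Y Cs Ps -> z \in X ++ flatten (Y :: Ps) -> z \in Y ++ flatten Ps.
  by move=> /Xw /negbTE zX; rewrite mem_cat zX.
case/prs_cat_inv: xy => [h|/prs_cat_inv[h|h|[/disc/(_ xP)//]]|[xX _]].
- by exists X; rewrite ?mem_head.
- by have [/disc/(_ xP)] := prs_mem h.
- have [xw yw] := prs_mem h.
  have dis' : {in flatten Cs, forall z, z \notin Y ++ flatten Ps}.
    move=> z zC; have := dis z; rewrite !mem_cat zC orbT => /(_ isT).
    by rewrite !negb_or => /andP[].
  have [Z ZP xyZ] := IH Y Cs sz C0 dis' uw h (Yw _ xw xP) (Yw _ yw yP).
  by exists Z => //; rewrite inE ZP orbT.
- by case: c c0 disc {dis} => // a c _ disc /= ya; case: (disc a (mem_head _ _)); rewrite -ya.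
Qed.

Lemma weave_sub X Cs Ps Y Y' : size Cs = size Ps -> (Y, Y') \in prs (X :: Ps) ->
  exists2 c, c \in Cs & {subset prs (Y ++ c ++ Y') <= prs (weave X Cs Ps)}.
Proof.
elim: Ps X Cs => [|X' Ps IH] X [|c Cs] //=.
move=> [sz].
have H : {subset prs (X ++ c ++ X') <= prs (X ++ c ++ weave X' Cs Ps)}.
  have [r ->] : exists r, weave X' Cs Ps = X' ++ r.
    by case: Cs Ps {IH sz} => [|c2 Cs] [|X2 Ps] /=; [exists [::]; rewrite cats0..|
      exists (c2 ++ weave X2 Cs Ps)].
  have -> : X ++ c ++ X' ++ r = (X ++ c ++ X') ++ r by rewrite -!catA.
  exact: (prs_catS _ _).1.
rewrite prs_cons2 inE => /orP[/eqP[-> ->]|YY].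
  by exists c; rewrite ?mem_head.
have [c' cC sub] := IH X' Cs sz YY; exists c'; first by rewrite inE cC orbT.
by move=> p /sub h; rewrite catA; apply: (prs_catS _ _).2.
Qed.

Lemma weave_piece X Cs Ps Y : size Cs = size Ps -> Y \in X :: Ps ->
  {subset prs Y <= prs (weave X Cs Ps)}.
Proof.
elim: Ps X Cs => [|X' Ps IH] X [|c Cs] //=.
  by rewrite inE => _ /eqP->.
move=> [sz]; rewrite inE => /orP[/eqP->|YP] p pp; first exact: (prs_catS _ _).1.
by rewrite catA; apply: (prs_catS _ _).2; apply: (IH X').
Qed.

Lemma weave_sorted (e : rel T) x0 X Cs Ps : size Cs = size Ps -> all (sorted e) (X :: Ps) ->
  all (fun Y => Y != [::]) (X :: Ps) -> all (fun c => c != [::]) Cs ->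
  all2 (fun pq c => path e pq.1 (rcons c pq.2))
    [seq (last x0 p.1, head x0 p.2) | p <- prs (X :: Ps)] Cs ->
  sorted e (weave X Cs Ps).
Proof.
elim: Ps X Cs => [|Y Ps IH] X [|c Cs] //=; first by rewrite !andbT.
move=> [sz] /andP[sX sP] /andP[X0 P0] /andP[c0 C0].
move=> /andP[pc pC].
have sw := IH Y Cs sz sP P0 C0 pC.
have [Y0 _] := andP P0.
have [w Ew] : exists w, weave Y Cs Ps = head x0 Y :: w.
  case: Y Y0 {IH sP P0 pC pc sw} => // y Y _.
  by case: Cs Ps sz {C0} => [|c1 Cs] [|Y1 Ps] //= _; [exists Y|exists (Y ++ c1 ++ weave Y1 Cs Ps)].
case: X X0 sX pc => // x X _ /= sX; rewrite /= rcons_path Ew => /andP[pc lc].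
rewrite /= !cat_path sX pc /= lc /=.
by move: sw; rewrite Ew.
Qed.

Lemma last_weave x0 X Cs Ps : size Cs = size Ps -> all (fun Y => Y != [::]) (X :: Ps) ->
  last x0 (weave X Cs Ps) = last x0 (last X Ps).
Proof.
elim: Ps X Cs x0 => [|Y Ps IH] X [|c Cs] x0 //=.
move=> [sz] /andP[_ P0].
rewrite !last_cat IH //; case/lastP: Ps {IH sz} P0 => [|Ps P] /=.
  by case: Y.
by rewrite last_rcons all_rcons => /andP[_ /andP[]]; case: P.
Qed.

End Weave.

Section Frame.
Variables (T : finType) (e : rel T).
Implicit Types (G H : gadget T) (gs : seq (gadget T)) (X Y c L : seq T) (Ps runs : seq (seq T)).

Lemma sorted_runs c : exists runs, [/\ flatten runs = c, all (sorted e) runs,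
  all (fun X => X != [::]) runs & size runs <= (nel e c).+1].
Proof.
elim: c => [|x [|y c] [runs [Er sr r0 zr]]]; first by exists [::].
  by exists [:: [:: x]].
case: runs Er sr r0 zr => [|[|z X] runs] //= [-> E] /andP[sX sr] r0 zr.
have nE : nel e [:: x, y & c] = ~~ e x y + nel e (y :: c) by [].
case: (boolP (e x y)) => xy; [exists ((x :: y :: X) :: runs)|exists ([:: x] :: (y :: X) :: runs)].
  by split; rewrite /= ?E ?xy ?sX // nE xy.
by split; rewrite /= ?E ?sX // nE xy.
Qed.

Definition inner_pieces gs := flatten [seq [:: gA H; gB H] | H <- gs].

(** To be preceded by [gB G]: the ladder [G] is split between the two ends of the path, which
    therefore ends in [gz G]. If the path is cut behind some vertices [gz], every part, also one
    that carries runs, then ends on a ladder. *)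
Definition pieces G gs runs := inner_pieces gs ++ runs ++ [:: gA G].

(* [L] covers the zone [V2] and runs through the gadgets [G :: gs], each of which it
   traverses along its two pieces; the second piece of a gadget is joined to the
   first piece of the next one inside [V3]. *)
Record frame (V2 V3 : {set T}) L G gs : Prop := {
  fr_uniq : uniq L;
  fr_sorted : sorted e L;
  fr_cover : {subset V2 <= L};
  fr_sub : forall x, x \in L -> x \in V2 :|: V3;
  fr_switch : {in G :: gs, forall H, switch e H};
  fr_disj : uniq (flatten [seq gverts H | H <- G :: gs]);
  fr_V3 : {in G :: gs, forall H, {subset gverts H <= V3}};
  fr_last : last (gz G) L = gz G;
  fr_in : {in G :: gs, forall H, {subset gverts H <= L}};
  fr_pieces : {in G :: gs, forall H x y, (x, y) \in prs (gA H) ++ prs (gB H) -> (x, y) \in prs L};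
  fr_adj : {in G :: gs, forall H x y, x \in gverts H -> y \in gverts H ->
    (x, y) \in prs L -> (x, y) \in prs (gA H) ++ prs (gB H)};
  fr_link : forall H H', (H, H') \in prs (G :: gs) -> exists2 c,
    {in c, forall x, x \in V3 /\ x \notin flatten [seq gverts H | H <- G :: gs]} &
    {subset prs (gB H ++ c ++ gA H') <= prs L} }.

Lemma pieces_perm G gs runs :
  perm_eq (gB G ++ flatten (pieces G gs runs))
    (flatten [seq gverts H | H <- G :: gs] ++ flatten runs).
Proof.
have gvE K l : flatten [seq gverts H | H <- K :: l] = gverts K ++ flatten [seq gverts H | H <- l].
  by [].
have iE K l : flatten (inner_pieces (K :: l)) = gA K ++ gB K ++ flatten (inner_pieces l) by [].
have aE : flatten [:: gA G] = gA G := cats0 _.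
apply/permP => a; rewrite /pieces gvE !flatten_cat aE !count_cat.
suff -> : count a (flatten (inner_pieces gs)) = count a (flatten [seq gverts H | H <- gs]).
  by clear; lia.
by elim: gs => // H gs IH; rewrite iE gvE !count_cat IH addnA.
Qed.

Lemma pieces_link G gs runs H H' : (H, H') \in prs (G :: gs) ->
  (gB H, gA H') \in prs (gB G :: pieces G gs runs).
Proof.
rewrite /pieces; move: (runs ++ _) => tl; elim: gs G => // K gs IH G.
rewrite prs_cons2 inE => /orP[/eqP[-> ->]|/IH h].
  by rewrite /inner_pieces /= prs_cons2 mem_head.
rewrite /inner_pieces /= prs_cons2 inE prs_cons2 inE; apply/orP; right; apply/orP; right.
exact: h.
Qed.

Lemma mem_pieces G gs runs H : H \in G :: gs ->
  gA H \in gB G :: pieces G gs runs /\ gB H \in gB G :: pieces G gs runs.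
Proof.
rewrite inE => /orP[/eqP->|Hgs].
  by rewrite mem_head /pieces !(inE, mem_cat) eqxx !orbT.
suff : gA H \in inner_pieces gs /\ gB H \in inner_pieces gs.
  by rewrite /pieces !(inE, mem_cat) => -[-> ->]; rewrite !orbT.
by split; apply/flattenP; exists [:: gA H; gB H]; rewrite ?inE ?eqxx ?orbT //; apply/mapP; exists H.
Qed.

Lemma count_ends (x0 v : T) (f : seq T -> T) Ps : all (fun X => X != [::]) Ps ->
  (forall X, X != [::] -> f X \in X) -> count_mem v (map f Ps) <= count_mem v (flatten Ps).
Proof.
move=> P0 hf; elim: Ps P0 => //= X Ps IH /andP[X0 /IH h]; rewrite count_cat leq_add //.
by case: eqP => //= <-; rewrite -has_count has_pred1 hf.
Qed.

Lemma mem_last_head (x0 : T) X : X != [::] -> last x0 X \in X /\ head x0 X \in X.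
Proof. by case: X => // a X _; rewrite mem_head /= mem_last. Qed.

Lemma flatten_disj Ps X Y x : uniq (flatten Ps) -> X \in Ps -> Y \in Ps -> x \in X -> x \in Y -> X = Y.
Proof.
elim: Ps => //= Q Ps IH; rewrite cat_uniq => /and3P[_ /hasPn dis uP].
rewrite !inE => /orP[/eqP->|XP] /orP[/eqP->|YP] xX xY //; last exact: IH.
- have := dis x; rewrite xX => H; have : x \in flatten Ps by apply/flattenP; exists Y.
  by move/H.
- have := dis x; rewrite xY => H; have : x \in flatten Ps by apply/flattenP; exists X.
  by move/H.
Qed.

Variables (V2 V3 : {set T}) (m : nat).
Hypotheses (se : symmetric e) (m_gt0 : 0 < m).
Hypothesis joined : forall X Y : {set T}, m <= #|X| -> m <= #|Y| ->
  exists x y, [/\ x \in X, y \in Y & e x y].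
Hypothesis dis : [disjoint V2 & V3].

(** Eight children per vertex suffice: the ladders use at most four at a ladder vertex and two at
    the root [h], and a vertex is an end at no more than two junctions. Since [extendable] concerns
    sets in the whole graph, vertices of [V2] too can be connected through [V3]. *)
Lemma frame_exists N j c2 : extendable e V3 8 m set0 [::] -> c2 =i V2 -> uniq c2 ->
  0 < #|V2| -> m <= 2 ^ j ->
  N.+1 * (2 * j + 4) ^ 2 + (2 * N + nel e c2 + 3) * (2 * j + 2) + 2 * 2 ^ j.+1 + slack 8 m <= #|V3| ->
  exists L G gs, size gs = N /\ frame V2 V3 L G gs.
Proof.
move=> E cV2 uc /card_gt0P[h hV2] mj big.
have V23 x : x \in V2 -> x \in V3 -> False by move=> x2; rewrite (disjointFr dis x2).
have hV3 : h \in V3 -> h \in set0 by move/(V23 h hV2).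
have u0 : used_in V3 set0 [::] by [].
have [|gs0 [us [sgs [sw ug] gsV [szg E1] cus]]] :=
    gadgets_exist se m_gt0 (leqnn 8) joined (N := N.+1) E u0 hV3 isT mj.
  by rewrite cards0; move: big; move: ((_ + 4) ^ 2) (2 ^ _) ((_ + 3) * _) (slack _ _) => *; lia.
case: gs0 sgs sw ug gsV szg E1 cus => // G gs [sgs] sw ug gsV szg E1 cus.
have [runs [Er sr r0 zr]] := sorted_runs c2.
set vs := flatten _ in ug gsV szg E1 cus.
have pP := pieces_perm G gs runs; rewrite -/vs Er in pP.
set X0 := gB G in pP *; set Ps := pieces G gs runs in pP *.
have gv3 H : H \in G :: gs -> {subset gverts H <= vs}.
  by move=> HG x xH; apply/flattenP; exists (gverts H) => //; apply: map_f.
have vs3 x : x \in vs -> x \in V3 by move/gsV; rewrite in_setD => /andP[].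
have uP : uniq (X0 ++ flatten Ps).
  rewrite (perm_uniq pP) cat_uniq ug uc andbT; apply/hasPn => x; rewrite /= cV2 => x2.
  by apply/negP => /vs3/(V23 x x2).
have zP : size Ps <= 2 * N + nel e c2 + 2.
  rewrite /Ps /pieces !size_cat /= addn1.
  have -> : size (inner_pieces gs) = 2 * size gs by elim: (gs) => //= ? ? ->; clear; lia.
  by rewrite sgs; move: zr; clear; lia.
have P0 : all (fun X => X != [::]) (X0 :: Ps).
  rewrite /Ps /pieces /= !all_cat r0 /= andbT.
  by apply/allP => X /flattenP[Q /mapP[H _ ->]]; rewrite !inE => /orP[] /eqP->.
pose x0 := gz G; pose f p := (last x0 p.1, head x0 p.2) : T * T.
pose ps := [seq f p | p <- prs (X0 :: Ps)].
have U1 : unzip1 ps = map (last x0) (belast X0 Ps).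
  rewrite /ps /unzip1 -map_comp; elim: (Ps) (X0) => // Y Qs IH X.
  by rewrite prs_cons2 /= IH.
have U2 : unzip2 ps = map (head x0) Ps.
  rewrite /ps /unzip2 -map_comp; elim: (Ps) (X0) => // Y Qs IH X.
  by rewrite prs_cons2 /= IH.
have lP : belast X0 Ps = take (size Ps) (X0 :: Ps).
  by rewrite lastI -cats1 take_size_cat // size_belast.
have mem_end v : v \in unzip1 ps ++ unzip2 ps -> v \in X0 ++ flatten Ps.
  rewrite -[X0 ++ _]/(flatten (X0 :: Ps)) U1 U2 mem_cat => /orP[] /mapP[X XP ->].
    have XP' : X \in X0 :: Ps by rewrite lastI mem_rcons inE XP orbT.
    by apply/flattenP; exists X => //; case: (mem_last_head x0 (allP P0 _ XP')).
  have XP' : X \in X0 :: Ps by rewrite inE XP orbT.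
  by apply/flattenP; exists X => //; case: (mem_last_head x0 (allP P0 _ XP')).
have count_end v : count_mem v (unzip1 ps ++ unzip2 ps) <= 2.
  rewrite U1 U2 count_cat.
  have c1 : count_mem v (flatten (X0 :: Ps)) <= 1 by rewrite (count_uniq_mem _ uP) leq_b1.
  have := c1; rewrite [X0 :: Ps]lastI -cats1 flatten_cat count_cat => c2'.
  have := P0; rewrite [X0 :: Ps]lastI all_rcons => /andP[_ P0'].
  have := count_ends x0 v P0' (fun X h => (mem_last_head x0 h).1).
  have /andP[_ P0''] := P0.
  have := count_ends x0 v P0'' (fun X h => (mem_last_head x0 h).2).
  have fE : flatten (X0 :: Ps) = X0 ++ flatten Ps by [].
  move: c1; rewrite fE count_cat; move: c2'; clear; lia.
have W1E x : (x \in set0 :|: [set z in vs]) = (x \in vs) by rewrite in_setU in_set0 in_set.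
have us1 : used_in V3 (set0 :|: [set z in vs]) us.
  move=> x x3; rewrite W1E -has_pred1 has_count => x1; have := leq_trans x1 (cus x).
  by case: eqP => [xh|_]; [case: (V23 h hV2); rewrite -xh|case: (x \in vs)].
have vP x : (x \in X0 ++ flatten Ps) = (x \in vs) || (x \in V2).
  by rewrite (perm_mem pP) mem_cat cV2.
have cvs : #|set0 :|: [set z in vs]| <= N.+1 * (2 * j + 4) ^ 2.
  by apply: leq_trans szg; rewrite set0U cardsE card_size.
have szps : size ps = size Ps by rewrite -(size_map snd) -/(unzip2 ps) U2 size_map.
have [||||Cs [aC uC CV sC _]] := connect_all se m_gt0 (isT : 1 < 8) joined E1 us1 mj (ps := ps).
- have Puniq : uniq (flatten (X0 :: Ps)) by [].
  move=> p /mapP[[X Y] /prsP[a [b EP]] ->] /=; apply/eqP => xy.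
  have XP : X \in X0 :: Ps by rewrite EP mem_cat inE eqxx orbT.
  have YP : Y \in X0 :: Ps by rewrite EP mem_cat !inE eqxx !orbT.
  have [lX _] := mem_last_head x0 (allP P0 _ XP).
  have [_ hY] := mem_last_head x0 (allP P0 _ YP).
  move: Puniq; rewrite EP flatten_cat cat_uniq => /and3P[_ _] /=.
  rewrite cat_uniq => /and3P[_ /hasPn/(_ (last x0 X)) + _].
  by rewrite -xy in hY; rewrite mem_cat hY /= lX => /(_ isT).
- by move=> v /mem_end; rewrite vP W1E => /orP[//|v2 /(V23 v v2)].
- move=> v /[dup] /mem_end; rewrite vP => vv vps; have := cus v; have := count_end v.
  case/orP: vv => [vs1|v2].
    have -> : (v == h) = false by apply: contraTF (vs3 v vs1) => /eqP->; apply/negP => /(V23 h hV2).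
    by rewrite vs1 [count_mem v [::]]/=; move: (count_mem _ _) (count_mem _ _); clear; lia.
  have -> : (v \in vs) = false by apply/negP => /vs3/(V23 v v2).
  by rewrite [count_mem v [::]]/=; move: (count_mem _ _) (count_mem _ _); case: (v == h); clear; lia.
- apply: leq_trans big; rewrite szps; move: cvs zP; clear.
  move: ((_ + 4) ^ 2) => q cvs zP; have -> : 2 * j.+1 = 2 * j + 2 by lia.
  have h1 := leq_mul zP (leqnn (2 * j + 2)).
  have -> : 2 * N + nel e c2 + 3 = (2 * N + nel e c2 + 2).+1 by lia.
  rewrite (mulSn _ (2 * j + 2)); move: h1 cvs.
  set t := 2 * j + 2; move: (N.+1 * q) (size Ps * t) ((2 * N + nel e c2 + 2) * t) (2 ^ _) (slack _ _).
  by clear; lia.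
have szC : size Cs = size Ps by move: aC; rewrite all2E szps => /andP[/eqP<-].
pose L := weave X0 Cs Ps.
have disC : {in flatten Cs, forall z, z \notin X0 ++ flatten Ps}.
  move=> z /CV; rewrite in_setD W1E vP => /andP[zv z3]; rewrite negb_or zv.
  by apply/negP => /V23/(_ z3).
have pL : perm_eq L ((X0 ++ flatten Ps) ++ flatten Cs) by rewrite -catA weave_perm.
have C0 : all (fun c => c != [::]) Cs by apply/allP => c /sC; case: c.
have uL : uniq L.
  rewrite (perm_uniq pL) cat_uniq uP uC andbT; apply/hasPn => z; exact: disC.
have sP : all (sorted e) (X0 :: Ps).
  have sA H : H \in G :: gs -> sorted e (gA H) by case/sw.
  have sB H : H \in G :: gs -> sorted e (gB H) by case/sw => _ _ /andP[_ zv] _ _; rewrite /= zv.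
  apply/allP => X; rewrite in_cons !mem_cat mem_seq1.
  case/or4P => [/eqP->|/flattenP[Q /mapP[H Hg ->]]|/(allP sr)//|/eqP->].
  + exact: (sB G (mem_head _ _)).
  + have HG : H \in G :: gs by rewrite inE Hg orbT.
    by rewrite in_cons mem_seq1 => /orP[] /eqP->; [apply: sA|apply: sB].
  + exact: (sA G (mem_head _ _)).
have memL x : (x \in L) = [|| x \in vs, x \in V2 | x \in flatten Cs].
  by rewrite (perm_mem pL) mem_cat vP orbA.
exists L, G, gs; split=> //; split=> //.
- exact: weave_sorted aC.
- by move=> x; rewrite memL => ->; rewrite orbT.
- move=> x; rewrite memL in_setU => /or3P[/vs3 x3|->//|/CV]; first by rewrite x3 orbT.
  by rewrite in_setD => /andP[_ ->]; rewrite orbT.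
- by move=> H /gv3 h1 x /h1/vs3.
- rewrite /L last_weave // /Ps /pieces catA cats1 last_rcons /= last_rcons //.
- by move=> H /gv3 h1 x /h1 xv; rewrite memL xv.
- move=> H /(mem_pieces runs)[hA hB] x y; rewrite mem_cat => /orP[] xy.
    exact: weave_piece xy.
  exact: weave_piece xy.
- move=> H HG x y xH yH xy; have [hA hB] := mem_pieces runs HG.
  have [||Y YP xyY] := weave_prs szC C0 disC uL xy.
  + by rewrite vP (gv3 H).
  + by rewrite vP (gv3 H).
  have [xY yY] := prs_mem xyY; rewrite mem_cat.
  have uPs : uniq (flatten (X0 :: Ps)) by [].
  move: xH; rewrite mem_cat => /orP[] xH.
    by rewrite (flatten_disj uPs hA YP xH xY) xyY.
  by rewrite (flatten_disj uPs hB YP xH xY) xyY orbT.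
- move=> H H' /(pieces_link runs)/(weave_sub szC)[c cC sub]; exists c => //.
  move=> x xc; have : x \in flatten Cs by apply/flattenP; exists c.
  move/CV; rewrite in_setD W1E => /andP[h1 h2]; by split.
Qed.

End Frame.

Section FrameInGraph.
Variables (T : finType) (e : rel T) (d kap g : nat).
Hypothesis G : pseudorandom e d kap g.
Hypotheses (kap_ge : 1024 <= kap) (g_ge : 128 * kap <= g) (n_ge : g ^ 20 <= #|T|).
Variables (V2 V3 : {set T}) (j : nat).
Hypotheses (deg2 : forall x, d <= 16 * dg e x V2) (deg3 : forall x, d <= 16 * dg e x V3).
Hypothesis dis : [disjoint V2 & V3].
Hypotheses (j_lo : #|T| < g * 2 ^ j) (j_hi : g * 2 ^ j <= 2 * #|T|) (j_g : 2 * j + 4 <= g ^ 3).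

Let g0 : 0 < g. Proof. by lia. Qed.
Let n_ge3 : g ^ 3 <= #|T|. Proof. by apply: leq_trans n_ge; rewrite leq_pexp2l. Qed.

Lemma joined_pow (X Y : {set T}) : 2 ^ j <= #|X| -> 2 ^ j <= #|Y| ->
  exists x y, [/\ x \in X, y \in Y & e x y].
Proof using G j_lo.
move=> cX cY; have [/existsP[x /existsP[y /and3P[? ? ?]]]|no] :=
  boolP [exists x, exists y, [&& x \in X, y \in Y & e x y]]; first by exists x, y.
have e0 : edges e X Y = 0.
  apply: big1 => x xX; apply/eqP; rewrite cards_eq0; apply/set0Pn => -[y].
  rewrite inE => /andP[yY xy]; case/negP: no.
  by apply/existsP; exists x; apply/existsP; exists y; rewrite xX yY.
have := pr_spread G (X := X) (Y := Y); rewrite e0 muln0 leq0n => /(_ isT).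
have h1 : #|T| * #|T| < (g * 2 ^ j) * (g * 2 ^ j) by apply: ltn_mul.
have h2 : (g * 2 ^ j) * (g * 2 ^ j) <= g ^ 2 * #|X| * #|Y|.
  have -> : g ^ 2 * #|X| * #|Y| = (g * g) * (#|X| * #|Y|) by rewrite -mulnA -[g ^ 2]/(g * g).
  by rewrite mulnACA leq_mul2l leq_mul ?orbT.
by rewrite leqNgt (leq_trans h1 h2).
Qed.

(** As [#|X|] is at most [4 * #|T| / g], both alternatives of [pr_expand] provide [8 * #|X|]
    neighbours in [V3]. *)
Lemma extendable0 : extendable e V3 8 (2 ^ j) set0 [::].
Proof using G kap_ge g_ge n_ge deg3 dis j_lo j_hi j_g.
move=> X cX; rewrite setD0.
have -> : demand 8 [::] X = 8 * #|X| by rewrite /demand sum_nat_const mulnC.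
have k0 : d * #|X| <= kap * edges e X (nbz e V3 X).
  have h := @edges_ge T e (d %/ 16) X (nbz e V3 X).
  have h2 : d * #|X| <= 16 * edges e X (nbz e V3 X).
    rewrite /edges big_distrr mulnC -sum_nat_const leq_sum //= => x xX.
    apply: leq_trans (deg3 x) _; rewrite leq_mul2l; apply: subset_leq_card.
    apply/subsetP => y; rewrite !inE => /andP[y3 xy]; rewrite y3 xy andbT /=.
    by apply/existsP; exists x; rewrite xX.
  by apply: leq_trans h2 _; rewrite leq_mul2r; apply/orP; right; lia.
have [h|h] := pr_expand G k0; last first.
  apply: leq_trans h; rewrite leq_mul2r; apply/orP; right.
  by rewrite expnS expn1; nia.
have h1 : g * #|X| <= 4 * #|T| by nia.
have : 128 * kap * #|X| <= 8 * kap * #|nbz e V3 X|.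
  by apply: leq_trans (_ : g * #|X| <= _); [rewrite leq_mul2r g_ge orbT|lia].
have -> : 128 * kap * #|X| = 8 * kap * (16 * #|X|) by lia.
by rewrite leq_mul2l; lia.
Qed.

(** A ladder has at most [(2 * j + 4) ^ 2 <= g ^ 6] vertices and a connection fewer; with at most
    [#|T| / g ^ 8] ladders and runs, everything fits into order [#|T| / g ^ 2] vertices of [V3]. *)
Lemma frame_pr N c2 : N * g ^ 8 <= #|T| -> nel e c2 * g ^ 8 <= #|T| -> c2 =i V2 -> uniq c2 ->
  exists L H gs, size gs = N /\ frame e V2 V3 L H gs.
Proof using G kap_ge g_ge n_ge deg2 deg3 dis j_lo j_hi j_g.
move=> hN hc cV2 uc.
have n0 : 0 < #|T| by apply: leq_trans n_ge; rewrite expn_gt0 g0.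
have V2_0 : 0 < #|V2|.
  have [x _] : exists x : T, True by have /card_gt0P[x] := n0; exists x.
  have := deg2 x; have := deg_ge G kap_ge g_ge n_ge3.
  have : dg e x V2 <= #|V2| by apply: subset_leq_card; apply/subsetP => y; rewrite !inE => /andP[].
  by lia.
have Z3 : #|T| <= 16 * #|V3| by apply: (card_Z G kap_ge g_ge n_ge3 deg3).
apply: (frame_exists (pr_sym G) _ joined_pow dis extendable0) => //; first by rewrite expn_gt0.
set q := (_ + 4) ^ 2; set t := 2 * j + 2; set M := 2 * N + _ + 3.
have qg : q <= g ^ 6 by rewrite /q -[6]/(3 * 2) expnM leq_exp2r.
have tq : t <= q by rewrite /q /t expnS expn1; nia.
have g2 : (128 * 1024) * (128 * 1024) <= g ^ 2 by rewrite expnS expn1 leq_mul //; lia.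
have nq : 4 * q * g ^ 2 <= #|T|.
  apply: leq_trans n_ge; apply: leq_trans (_ : g * g ^ 6 * g ^ 2 <= _).
    by rewrite leq_mul2r leq_mul ?orbT //; lia.
  by rewrite -expnS -expnD leq_pexp2l.
have aux a : a * g ^ 8 <= #|T| -> a * q * g ^ 2 <= #|T|.
  by apply: leq_trans; rewrite -mulnA leq_mul2l (expnD g 6 2) leq_mul2r qg !orbT.
have h1 := aux _ hN; have h2 := aux _ hc.
have h3 : N.+1 * q + M * t <= (3 * N + nel e c2 + 4) * q.
  have : M * t <= M * q by rewrite leq_mul2l tq orbT.
  by rewrite /M; move: (nel e c2) => u; move: q t {qg tq nq aux h1 h2} => q t; nia.
have h4 : (3 * N + nel e c2 + 4) * q * g ^ 2 <= 5 * #|T|.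
  have -> : (3 * N + nel e c2 + 4) * q * g ^ 2 =
      3 * (N * q * g ^ 2) + nel e c2 * q * g ^ 2 + 4 * q * g ^ 2.
    by move: (nel e c2) (g ^ 2) (q) => u v w; clear; lia.
  move: h1 h2 nq.
  move: (N * q * _) (nel e c2 * q * _) (4 * q * _) => *; lia.
have h5 : (128 * 1024) * 2 ^ j <= 2 * #|T|.
  by apply: leq_trans j_hi; rewrite leq_mul2r; apply/orP; right; lia.
have h6 : (3 * N + nel e c2 + 4) * q * ((128 * 1024) * (128 * 1024)) <= 5 * #|T|.
  by apply: leq_trans h4; rewrite leq_mul2l g2 orbT.
rewrite /slack expnS; move: h3 h5 h6 Z3; move: (_ * q) (M * t) (_ * q) (2 ^ j).
clear; lia.
Qed.

End FrameInGraph.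

(** * Linking *)

Section Relations.
Variable T : finType.
Implicit Types (F : rel T) (x y v w s : T).

Definition pair2 a b x y := (x == a) && (y == b) || (x == b) && (y == a) :> bool.

Definition valency F v := #|[set x | F v x]|.

Definition add_pair F a b : rel T := fun x y => F x y || @pair2 a b x y.

(** A rotation in terms of edges, without a vertex order: components may be paths or cycles, and the
    pivot may lie in another component than [s]. *)
Definition rotate_rel F s w w' : rel T :=
  fun x y => F x y && ~~ pair2 w w' x y || pair2 s w x y.

Lemma pair2C a b x y : pair2 a b x y = pair2 a b y x.
Proof. by rewrite /pair2 orbC andbC [X in _ || X]andbC. Qed.

Lemma rotate_rel_sym F s w w' : symmetric F -> symmetric (rotate_rel F s w w').
Proof. by move=> sF x y; rewrite /rotate_rel sF !(pair2C _ _ x). Qed.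

(** The missing unit of valency moves from [s] to [w'], while [w] exchanges one edge for another. *)
Lemma valency_rotate F s w w' v : symmetric F -> irreflexive F -> s != w -> ~~ F s w -> F w w' ->
  valency (rotate_rel F s w w') v + (v == w') = valency F v + (v == s).
Proof.
move=> sF iF sw nsw ww'.
have sw' : s != w' by apply: contraNneq nsw => ->; rewrite sF.
have w'w : w' != w by apply: contraTneq ww' => ->; rewrite iF.
have ne : ((s == w = false) * (w == s = false) * (s == w' = false) * (w' == s = false)
    * (w' == w = false) * (w == w' = false))%type.
  by rewrite !(eq_sym w) !(eq_sym w' s) !(negbTE sw) !(negbTE sw') !(negbTE w'w).
rewrite /valency; have [->|vs] := eqVneq v s.
  have -> : [set x | rotate_rel F s w w' s x] = w |: [set x | F s x].
    by apply/setP => x; rewrite !inE /rotate_rel /pair2 eqxx !ne /= andbT orbF orbC.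
  by rewrite ne cardsU1 inE nsw addn0 addnC.
have [->|vw] := eqVneq v w.
  have -> : [set x | rotate_rel F s w w' w x] = s |: ([set x | F w x] :\ w').
    by apply/setP => x; rewrite !inE /rotate_rel /pair2 eqxx !ne /= orbF orbC andbC.
  by rewrite ne cardsU1 !inE ne sF nsw /= (cardsD1 w' [set x | F w x]) inE ww'; lia.
have [->|vw'] := eqVneq v w'.
  have -> : [set x | rotate_rel F s w w' w' x] = [set x | F w' x] :\ w.
    by apply/setP => x; rewrite !inE /rotate_rel /pair2 eqxx !ne /= orbF andbC.
  by rewrite (cardsD1 w [set x | F w' x]) inE sF ww' addn0 addnC.
congr (#|pred_of_set _| + _); apply/setP => x.
by rewrite !inE /rotate_rel /pair2 (negbTE vs) (negbTE vw) (negbTE vw') /= orbF andbT.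
Qed.

Lemma connect_sub F F' : (forall x y, F x y -> connect F' x y) ->
  forall x y, connect F x y -> connect F' x y.
Proof.
move=> h x y /connectP[p pp ->]; elim: p x pp => //= z p IH x /andP[xz pz].
exact: connect_trans (h _ _ xz) (IH z pz).
Qed.

Definition marked (K : {set T}) F v := exists2 k, k \in K & connect F v k.

Lemma marked_step K F F' : (forall x y, F x y -> marked K F' y -> marked K F' x) ->
  forall v, marked K F v -> marked K F' v.
Proof.
move=> h v [k kK /connectP[p pp Ek]]; elim: p v pp Ek => /= [v _ <-|z p IH v /andP[vz pz] Ek].
  by exists k.
exact: h vz (IH z pz Ek).
Qed.

Lemma path_uniq F x y : connect F x y -> x != y ->
  exists x' p, [/\ F x x', path F x' p, y = last x' p & x \notin x' :: p].
Proof.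
move=> /connectP[p pp ->]; case/shortenP: pp => [[|x' p']] /=; first by rewrite eqxx.
by move=> /andP[xx' pp] /andP[xn _] _ _; exists x', p'.
Qed.

Lemma path_avoid F F' w x p : (forall a b, a != w -> b != w -> F a b -> F' a b) ->
  w \notin x :: p -> path F x p -> path F' x p.
Proof.
move=> h; elim: p x => //= y p IH x; rewrite !inE !negb_or => /and3P[wx wy wp] /andP[xy pp].
by rewrite h ?IH ?inE ?negb_or ?wy //= eq_sym.
Qed.

(* Which neighbour [w'] of the pivot [w] to give up: the one towards [s] if [w] and [s]
   are connected, and otherwise the one towards a mark. *)
Lemma pivot K F s w : symmetric F -> marked K F w -> marked K F s -> w \notin K -> s != w ->
  exists2 w', F w w' & forall v, marked K F v -> marked K (rotate_rel F s w w') v.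
Proof.
move=> sF mw [k2 k2K sk2] wK sw.
have keep w' a b : a != w -> b != w -> F a b -> rotate_rel F s w w' a b.
  by move=> aw bw ab; rewrite /rotate_rel ab /pair2 (negbTE aw) (negbTE bw) !andbF.
have new w' : rotate_rel F s w w' s w by rewrite /rotate_rel /pair2 !eqxx orbT.
have newC w' : rotate_rel F s w w' w s by rewrite rotate_rel_sym.
case: (boolP (connect F w s)) => ws.
  have ns : w != s by rewrite eq_sym.
  have [w' [p [ww' pp Es wp]]] := path_uniq ws ns.
  (* The path from [w'] to [s] avoids [w] and continues over the new edge to [w]. So [w] and [w']
     stay connected and no component is torn apart. *)
  exists w' => //; apply: marked_step => x y xy [k kK yk]; exists k => //; apply: connect_trans yk.
  have w's : connect (rotate_rel F s w w') w' s.
    by apply/connectP; exists p => //; apply: path_avoid wp pp => a b; apply: keep.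
  have w'w : connect (rotate_rel F s w w') w' w by apply: connect_trans w's (connect1 (new w')).
  have sR := rotate_rel_sym s w w' sF.
  case: (boolP (pair2 w w' x y)) => [|n]; last by apply: connect1; rewrite /rotate_rel xy n.
  case/orP => /andP[/eqP-> /eqP->] //.
  by rewrite (sym_connect_sym sR).
have [k kK wk] := mw; have nk : w != k by apply: contraNneq wK => ->.
have [w' [p [ww' pp Ek wp]]] := path_uniq wk nk.
(* Here [w'] reaches a mark without passing through [w], and [w] inherits the mark of [s] over the
   new edge, since no path from [s] passes through [w]. *)
have mw' : marked K (rotate_rel F s w w') w'.
  by exists k => //; apply/connectP; exists p => //; apply: path_avoid wp pp => a b; apply: keep.
have mw1 : marked K (rotate_rel F s w w') w.
  exists k2 => //; apply: connect_trans (connect1 (newC w')) _.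
  have /connectP[q pq Eq] := sk2; apply/connectP; exists q => //.
  apply: (path_avoid (w := w) _ _ pq); first by move=> a b; apply: keep.
  rewrite inE negb_or eq_sym sw; apply: contra ws => wq.
  have [q1 [q2 E]] := split_mem wq; rewrite (sym_connect_sym sF).
  move: pq; rewrite E -cat_rcons cat_path => /andP[pq _].
  by apply/connectP; exists (rcons q1 w) => //; rewrite last_rcons.
exists w' => //; apply: marked_step => x y xy [k' k'K yk].
case: (boolP (pair2 w w' x y)) => [/orP[]/andP[/eqP-> _]|n] //.
by exists k' => //; apply: connect_trans yk; apply: connect1; rewrite /rotate_rel xy n.
Qed.
End Relations.

Section Rotations.
Variables (T : finType) (e : rel T) (d kap g : nat).
Hypothesis G : pseudorandom e d kap g.
Hypotheses (kap_ge : 16 <= kap) (g_ge : 2 <= g).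
Variables (Lam A K : {set T}).
Hypotheses (degA : forall x, d <= 16 * dg e x A).
Hypotheses (AL : A \subset Lam) (AK : [disjoint A & K]).
Implicit Types (F : rel T) (x y v w s t : T).

(** In the application [A] is the second zone, and [sp_off] then protects the ladders and their
    connections in the third. *)
Record spanning F0 F : Prop := {
  sp_sym : symmetric F;
  sp_sub : subrel F e;
  sp_supp : forall x y, F x y -> x \in Lam;
  sp_off : forall x y, x \notin A -> y \notin A -> F x y = F0 x y;
  sp_marked : forall v, v \in Lam -> marked K F v }.

Inductive turned F0 s0 : rel T -> T -> Prop :=
  | turned0 : turned F0 s0 F0 s0
  | turnedS F s w w' : turned F0 s0 F s -> w \in A -> e s w -> ~~ F s w -> F w w' ->
      spanning F0 (rotate_rel F s w w') -> turned F0 s0 (rotate_rel F s w w') w'.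

Variables (F0 : rel T) (s0 : T).
Hypotheses (sp0 : spanning F0 F0) (s0L : s0 \in Lam) (val0 : forall v, valency F0 v <= 2).

Lemma turned_inv F s : turned F0 s0 F s -> [/\ spanning F0 F, s \in Lam &
  forall v, valency F v + (v == s) = valency F0 v + (v == s0)].
Proof using G sp0 s0L.
elim=> [|{}F {}s w w' R [sp sL E] wA sw nsw ww' sp']; first by split.
have iF : irreflexive F by move=> x; apply/negP => /(sp_sub sp); rewrite (pr_irr G).
have nw : s != w by apply: contraTneq sw => ->; rewrite (pr_irr G).
split=> // [|v]; first by apply: (sp_supp sp (y := w)); rewrite (sp_sym sp).
by rewrite -E valency_rotate //; apply: sp_sym sp.
Qed.

Lemma turned_step F s w : turned F0 s0 F s -> w \in A -> e s w -> ~~ F s w ->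
  exists2 w', F w w' & turned F0 s0 (rotate_rel F s w w') w'.
Proof using G AL AK sp0 s0L.
move=> R wA sw nsw; have [sp sL _] := turned_inv R.
have wL := subsetP AL _ wA.
have nw : s != w by apply: contraTneq sw => ->; rewrite (pr_irr G).
have wK : w \notin K by rewrite (disjointFr AK wA).
have [w' ww' mR] := pivot (sp_sym sp) (sp_marked sp wL) (sp_marked sp sL) wK nw.
have w'L : w' \in Lam by apply: (sp_supp sp (y := w)); rewrite (sp_sym sp).
exists w' => //; apply: turnedS => //; split.
- exact: rotate_rel_sym (sp_sym sp).
- move=> x y /orP[/andP[/(sp_sub sp)//]|/orP[]/andP[/eqP-> /eqP->] //].
  by rewrite (pr_sym G).
- by move=> x y /orP[/andP[/(sp_supp sp)//]|/orP[]/andP[/eqP-> _]].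
- move=> x y xA yA; rewrite /rotate_rel (sp_off sp) // /pair2.
  have nx z : z \notin A -> (z == w) = false by move=> zA; apply: contraNF zA => /eqP->.
  by rewrite (nx x) // (nx y) // !andbF /= orbF andbT.
- by move=> v vL; apply: mR; apply: (sp_marked sp vL).
Qed.

Definition ends := [set v | `[< exists F, turned F0 s0 F v >]].

(** Posa's argument for edge relations. Edges change only inside [B], the ends and their
    [F0]-neighbours. If a neighbour [w] in [A] of an end were outside [B], its edges would be
    unchanged, and a rotation at [w] would turn one of its [F0]-neighbours into an end. So each end
    has [d / 16] neighbours in [B :&: A], although [B] has at most [3 * #|ends|] vertices. *)
Lemma card_ends : #|T| <= 6 * kap * #|ends|.
Proof using G kap_ge g_ge degA AL AK sp0 s0L val0.
pose N := [set x | [exists t in ends, F0 t x]]; pose B := ends :|: N.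
have inE' F v : turned F0 s0 F v -> v \in ends.
  by move=> R; rewrite inE; apply/asboolP; exists F.
have changed F s : turned F0 s0 F s -> forall x y, F x y <> F0 x y -> x \in B /\ y \in B.
  elim=> // {}F {}s w w' R IH wA sw nsw ww' sp' x y xy.
  have R' := turnedS R wA sw nsw ww' sp'.
  have sB : s \in B by rewrite inE (inE' _ _ R).
  have w'B : w' \in B by rewrite inE (inE' _ _ R').
  have wB : w \in B.
    have [FF|/eqP h] := eqVneq (F w w') (F0 w w'); last by case: (IH _ _ h).
    rewrite !inE; apply/orP; right; apply/existsP; exists w'.
    by rewrite (inE' _ _ R') (sp_sym sp0) -FF.
  move: xy; rewrite /rotate_rel.
  case: (boolP (pair2 w w' x y)) => [/orP[]/andP[/eqP-> /eqP->]//|_].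
  case: (boolP (pair2 s w x y)) => [/orP[]/andP[/eqP-> /eqP->]//|_].
  by rewrite andbT orbF => /IH.
have deg v : v \in ends -> d <= 16 * dg e v (B :&: A).
  rewrite inE => /asboolP[F R]; apply: leq_trans (degA v) _; rewrite leq_mul2l.
  apply: subset_leq_card; apply/subsetP => w; rewrite in_set => /andP[wA vw].
  rewrite in_set in_setI wA vw !andbT; case: (boolP (w \in B)) => // wB; exfalso; case/negP: (wB).
  have keep x : F w x = F0 w x.
    by apply/eqP/negPn/negP => /eqP/(changed _ _ R)[]; rewrite (negbTE wB).
  have [sp _ _] := turned_inv R.
  case: (boolP (F v w)) => nvw.
    rewrite !inE; apply/orP; right; apply/existsP; exists v.
    by rewrite (inE' _ _ R) (sp_sym sp0) -keep (sp_sym sp).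
  have [w' ww' R'] := turned_step R wA vw nvw.
  rewrite !inE; apply/orP; right; apply/existsP; exists w'.
  by rewrite (inE' _ _ R') (sp_sym sp0) -keep.
have s0E : s0 \in ends by apply: inE' (turned0 _ _).
have cB : #|B| <= 3 * #|ends|.
  have cN : #|N| <= \sum_(t in ends) #|[set x | F0 t x]|.
    have -> : N = \bigcup_(t in ends) [set x | F0 t x].
      apply/setP => x; rewrite inE; apply/existsP/bigcupP => [[t /andP[tE tx]]|[t tE tx]].
        by exists t => //; rewrite inE.
      by exists t; rewrite tE; move: tx; rewrite inE.
    apply: (big_ind2 (fun (X : {set T}) n => #|X| <= n)) => // [|X a Y b Xa Yb].
      by rewrite cards0.
    by apply: leq_trans (leq_add Xa Yb); apply: leq_card_setU.
  have : \sum_(t in ends) #|[set x | F0 t x]| <= \sum_(t in ends) 2 by apply: leq_sum => t _; apply: val0.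
  rewrite sum_nat_const; have : #|B| <= #|ends| + #|N| := leq_card_setU _ _.
  by move: cN; clear; lia.
have k0 : d * #|ends| <= kap * edges e ends (B :&: A).
  apply: leq_trans (_ : 16 * edges e ends (B :&: A) <= _); last by rewrite leq_mul2r kap_ge orbT.
  by rewrite /edges big_distrr mulnC -sum_nat_const leq_sum.
have cBA : #|B :&: A| <= #|B| by rewrite subset_leq_card // subsetIl.
have e0 : 0 < #|ends| by apply/card_gt0P; exists s0.
have [h|h] := pr_expand G k0.
  apply: leq_trans h _; have := leq_mul (leqnn (2 * kap)) (leq_trans cBA cB).
  by move/leq_trans; apply; rewrite mulnACA mulnA; clear; lia.
have : 4 * #|ends| <= 3 * #|ends|.
  apply: leq_trans (leq_trans h (leq_trans cBA cB)); rewrite leq_mul2r.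
  by rewrite (leq_mul g_ge g_ge) orbT.
by move: e0; clear; lia.
Qed.

End Rotations.

(** * Forests cut from a list *)

Section Kept.
Variable T : finType.
Implicit Types (F M : rel T) (x y v w s u : T) (q : seq T) (a : pred (T * T)).

(** The paths left when a list is cut at the pairs failing [a]. It serves both sides of the linking:
    the cover of the complement is cut at non-edges, the long path behind selected vertices. *)
Definition kept a q : rel T := fun x y =>
  ((x, y) \in prs q) && a (x, y) || ((y, x) \in prs q) && a (y, x).

Lemma kept_sym a q : symmetric (kept a q).
Proof. by move=> x y; rewrite /kept orbC. Qed.

Lemma uniq_prs q : uniq q -> uniq (prs q).
Proof.
elim: q => [|x [|y q] IH] // /andP[xq /IH u]; rewrite prs_cons2 cons_uniq u andbT.
by apply: contra xq => /prs_mem[].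
Qed.

Lemma prs_antisym q x y : uniq q -> (x, y) \in prs q -> (y, x) \in prs q -> False.
Proof.
elim: q => [|z [|t q] IH] // /andP[zq u]; rewrite prs_cons2 !inE.
move=> /orP[/eqP[-> ->]|xy] /orP[/eqP[E1 E2]|yx]; last exact: IH.
- by move: zq; rewrite E1 mem_head.
- by have [_] := prs_mem yx; rewrite (negbTE zq).
- by move: xy; rewrite E1 E2 => /prs_mem[_]; rewrite (negbTE zq).
Qed.

Lemma sum_valency F : \sum_v valency F v = \sum_x \sum_y F x y.
Proof.
apply: eq_bigr => x _; rewrite /valency -sum1_card big_mkcond /=.
by apply: eq_bigr => y _; rewrite inE; case: (F x y).
Qed.

Lemma sum_mem_pairs (E : seq (T * T)) : uniq E -> \sum_x \sum_y ((x, y) \in E) = size E.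
Proof.
move=> uE; rewrite pair_big /= -(card_uniqP uE) -sum1_card [RHS]big_mkcond /=.
by apply: eq_bigr => -[x y] _ /=; case: (_ \in _).
Qed.

Lemma kept_sum a q : uniq q -> \sum_v valency (kept a q) v = 2 * count a (prs q).
Proof.
move=> uq; rewrite sum_valency -size_filter; set E := filter _ _.
have uE : uniq E by rewrite filter_uniq // uniq_prs.
rewrite mul2n -addnn -{1}(sum_mem_pairs uE) -(sum_mem_pairs uE) [X in _ = _ + X]exchange_big.
rewrite -big_split; apply: eq_bigr => x _ /=; rewrite -big_split; apply: eq_bigr => y _ /=.
rewrite /kept !mem_filter andbC [X in _ || X]andbC.
case: (boolP (_ && _)) => [/andP[_ xy]|_] /=; last by case: (_ && _).
by case: (boolP (_ && _)) => [/andP[_ yx]|_] //; case: (prs_antisym uq xy yx).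
Qed.

Lemma kept_valency a q v : uniq q -> valency (kept a q) v <= 2.
Proof.
move=> uq; have := card_nbh [set v] uq; rewrite cards1; apply: leq_trans; apply: subset_leq_card.
apply/subsetP => y; rewrite !inE => h; apply/existsP; exists v; rewrite set11 /adj.
by case/orP: h => /andP[-> _]; rewrite ?orbT.
Qed.

Lemma kept_valency_end a q u : uniq q -> (forall y, (u, y) \in prs q -> ~~ a (u, y)) ->
  valency (kept a q) u <= 1.
Proof.
move=> uq no; rewrite /valency; apply/card_le1P => x; rewrite inE => ux y; rewrite !inE.
have H z : kept a q u z -> (z, u) \in prs q.
  by case/orP => /andP[h1 h2] //; have := no z h1; rewrite h2.
apply/idP/eqP => [uy|-> //]; exact: uniq_prs_r uq (H _ uy) (H _ ux).
Qed.

(** Walk forward along the list until the first cut or the end of the list. *)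
Lemma kept_connect a q v x0 : v \in q -> exists u, [/\ connect (kept a q) v u, u \in q &
  u = last x0 q \/ exists2 y, (u, y) \in prs q & ~~ a (u, y)].
Proof.
move=> /split_mem[p [r ->]]; elim: r p v => [|y r IH] p v.
  by exists v; rewrite mem_cat mem_head orbT last_cat; split=> //; left.
have vy : (v, y) \in prs (p ++ v :: y :: r) by apply/prsP; exists p, r.
have vq : v \in p ++ v :: y :: r by rewrite mem_cat mem_head orbT.
case: (boolP (a (v, y))) => avy; last by exists v; split=> //; right; exists y.
have := IH (rcons p v) y; rewrite cat_rcons => -[u [yu uq h]]; exists u; split=> //.
by apply: connect_trans yu; apply: connect1; rewrite /kept vy avy.
Qed.

Lemma valency_eq F F' v : F =2 F' -> valency F v = valency F' v.
Proof. by move=> h; apply: eq_card => x; rewrite !inE h. Qed.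

Lemma valency_add_pair M (a b : T) v : symmetric M -> ~~ M a b -> a != b ->
  valency (add_pair M a b) v = valency M v + (v == a) + (v == b).
Proof.
move=> sM nab ab; rewrite /valency.
have [->|va] := eqVneq v a.
  have -> : [set x | add_pair M a b a x] = b |: [set x | M a x].
    by apply/setP => x; rewrite !inE /add_pair /pair2 eqxx (negbTE ab) orbF orbC.
  by rewrite cardsU1 inE nab (negbTE ab); clear; lia.
have [->|vb] := eqVneq v b.
  have -> : [set x | add_pair M a b b x] = a |: [set x | M b x].
    by apply/setP => x; rewrite !inE /add_pair /pair2 eqxx eq_sym (negbTE ab) orbC.
  by rewrite cardsU1 inE sM nab; clear; lia.
rewrite !addn0; congr (#|pred_of_set _|); apply/setP => x.
by rewrite !inE /add_pair /pair2 (negbTE va) (negbTE vb) orbF.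
Qed.
End Kept.

Section MinimalList.
Variables (T : finType) (e : rel T).
Hypotheses (se : symmetric e) (ie : irreflexive e).
Implicit Types (x y v w s u : T) (q c P Q : seq T) (a b : T).
Local Notation nel := (nel e).

Definition forest q := kept (fun p => e p.1 p.2) q.

Definition minimal c := forall q, perm_eq q c -> nel c <= nel q.

Lemma forestE q x y : forest q x y = adj q x y && e x y.
Proof. by rewrite /forest /kept /adj /= (se y) andb_orl. Qed.

Lemma minimal_perm c q : minimal c -> perm_eq q c -> nel q <= nel c -> minimal q.
Proof. by move=> mc pq le q' /perm_trans/(_ pq)/mc; apply: leq_trans. Qed.

Lemma forest_rev q : forest (rev q) =2 forest q.
Proof. by move=> x y; rewrite !forestE adj_rev. Qed.

(** Exchanging the halves at a non-edge would save a non-edge if the first and last vertices were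
    adjacent. By minimality they are not, so the exchange leaves the forest unchanged. *)
Lemma forest_swap x P y Q : minimal ((x :: P) ++ (y :: Q)) -> ~~ e (last x P) y ->
  forest ((y :: Q) ++ (x :: P)) =2 forest ((x :: P) ++ (y :: Q)) /\
  nel ((y :: Q) ++ (x :: P)) <= nel ((x :: P) ++ (y :: Q)).
Proof.
move=> mc ne; have := mc ((y :: Q) ++ (x :: P)); rewrite perm_catC => /(_ (perm_refl _)).
rewrite !nel_cat ne => le; have ne' : ~~ e (last y Q) x by move: le; case: (e _ x) => //; lia.
split; last by rewrite ne'; lia.
move=> u v; rewrite !forestE !adj_cat.
have H a b : ~~ e a b -> (u == a) && (v == b) || (u == b) && (v == a) -> e u v = false.
  by move=> nab /orP[]/andP[/eqP-> /eqP->]; rewrite ?(se b) (negbTE nab).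
have H1 := H _ _ ne; have H2 := H _ _ ne'.
case E1 : (_ && _ || _ && _) H2 => H2; first by rewrite H2 // !andbF.
case E2 : ((u == last x P) && _ || _) H1 => H1; first by rewrite H1 // !andbF.
by rewrite !orbF orbC.
Qed.

(** Rotations act on the head of a list. A vertex that lacks a forest edge is brought there by an
    exchange of halves at an adjacent non-edge, a reversal, or both. *)
Lemma reopen c y : minimal c -> uniq c -> y \in c -> valency (forest c) y < 2 ->
  exists r, [/\ perm_eq (y :: r) c, nel (y :: r) <= nel c & forest (y :: r) =2 forest c].
Proof.
move=> mc uc /split_mem[l [r Ec]] val.
case: (lastP l) Ec => [|l' x] Ec; first by exists r; rewrite Ec.
have rotE P Q : uniq (P ++ Q) -> perm_eq (Q ++ P) (P ++ Q) by move=> _; rewrite perm_catC.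
case: (boolP (e x y)) => xy; last first.
  have [x1 [l1 E1]] : exists x1 l1, rcons l' x = x1 :: l1 by case: (l') => [|b l1] /=; eexists; eexists.
  have Lx : last x1 l1 = x by have := congr1 (last x1) E1; rewrite last_rcons /= => ->.
  move: mc; rewrite Ec E1 => mc; rewrite -{1}Lx in xy.
  have [h1 h2] := forest_swap mc xy; exists (r ++ x1 :: l1).
  by split; [rewrite -cat_cons perm_catC|exact: h2|exact: h1].
case: r Ec => [|z r] Ec.
  have Er : rev c = y :: rev (rcons l' x) by rewrite Ec rev_cat.
  exists (rev (rcons l' x)); rewrite -Er; split; first by rewrite perm_rev.
    by rewrite nel_rev.
  exact: forest_rev.
have yz : ~~ e y z.
  apply: contraL val => yz; rewrite -leqNgt.
  have xz : x != z.
    by move: uc; rewrite Ec cat_uniq => /and3P[_ /hasPn/(_ z) + _]; rewrite !inE eqxx orbT mem_rcons inE eq_sym => /(_ isT)/norP[].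
  have <- : #|[set x; z]| = 2 by rewrite cards2 xz.
  apply: subset_leq_card; apply/subsetP => t; rewrite !inE => /orP[]/eqP->.
    rewrite forestE se xy andbT adjC /adj; apply/orP; left; apply/prsP.
    by exists l', (z :: r); rewrite Ec cat_rcons.
  rewrite forestE yz andbT /adj; apply/orP; left; apply/prsP.
  by exists (rcons l' x), r.
have [x1 [l1 E1]] : exists x1 l1, rcons (rcons l' x) y = x1 :: l1.
  by case: (rcons l' x) => [|b l1] /=; eexists; eexists.
have Ly : last x1 l1 = y by have := congr1 (last x1) E1; rewrite last_rcons /= => ->.
have Ec' : c = (x1 :: l1) ++ z :: r by rewrite Ec -E1 (cat_rcons y).
move: mc; rewrite Ec' => mc; rewrite -{1}Ly in yz.
have [h1 h2] := forest_swap mc yz.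
have Er : rev ((z :: r) ++ x1 :: l1) = y :: (rev (rcons l' x) ++ rev (z :: r)).
  by rewrite -E1 rev_cat rev_rcons.
exists (rev (rcons l' x) ++ rev (z :: r)); rewrite -Er; split.
- by rewrite perm_rev perm_catC.
- by rewrite nel_rev.
- by move=> u v; rewrite forest_rev h1.
Qed.

(** In a minimal list the pair given up by a rotation is an edge. So the rotation acts on the forest
    as [rotate_rel], and the missing valency moves with the head. *)
Lemma reach_valency A c c' v x0 : minimal c -> uniq c -> reach e A c c' ->
  valency (forest c') v + (v == head x0 c') = valency (forest c) v + (v == head x0 c).
Proof.
move=> mc uc R; elim: R => // s a w b R IH wA sw.
have pq := reach_perm R; have le := reach_nel se R.
have mq := minimal_perm mc pq le.
have uq : uniq ((s :: a) ++ w :: b) by rewrite (perm_uniq pq).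
rewrite -IH; have [c2 [E2 L2]] := rev_last s a; rewrite E2 /=.
set z := last s a.
have zw : e z w.
  have := mq (rev (s :: a) ++ w :: b).
  rewrite perm_cat2r perm_rev => /(_ (perm_refl _)); have := nel_rot a b se sw.
  by case: (e _ _) => //= <-; rewrite addn1 ltnn.
have wsa : w \notin s :: a.
  by move: uq; rewrite cat_uniq => /and3P[_ /hasPn/(_ w (mem_head _ _))].
have zwb : z \notin w :: b.
  move: uq; rewrite uniq_catC cat_uniq => /and3P[_ /hasPn/(_ z) + _]; apply.
  exact: mem_last.
have sw' : s != w by apply: contraTneq sw => ->; rewrite ie.
(* A pivot directly behind the head leaves the list unchanged. *)
case: a @z pq uq mq le R IH c2 E2 L2 zw wsa zwb => [|a0 a] z pq uq mq le R IH c2 E2 L2 zw wsa zwb.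
  by move: E2; rewrite /z /= => -[<-].
have zs : s != z.
  apply/eqP => sz; move: uq; rewrite cat_uniq cons_uniq => /andP[/andP[+ _] _].
  by rewrite sz /z /= mem_last.
rewrite -(@valency_rotate _ (forest ((s :: a0 :: a) ++ w :: b)) s w z).
- congr (_ + _); apply: valency_eq => x y.
  rewrite /rotate_rel !forestE -cat_cons -E2 {1}E2 !adj_cat -E2 adj_rev L2 -/z.
  have P p : pair2 s w x y = ((x == s) && (y == w) || (x == w) && (y == s)) by [].
  rewrite -/(pair2 s w x y) -/(pair2 z w x y).
  have -> : pair2 w z x y = pair2 z w x y by rewrite /pair2 orbC.
  have n1 : adj (s :: a0 :: a) x y -> pair2 z w x y = false.
    move=> /adj_mem[xs ys]; apply: contraNF wsa.
    by case/orP => /andP[/eqP hx /eqP hy]; [rewrite -hy|rewrite -hx].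
  have n2 : adj (w :: b) x y -> pair2 z w x y = false.
    move=> /adj_mem[xs ys]; apply: contraNF zwb.
    by case/orP => /andP[/eqP hx /eqP hy]; [rewrite -hx|rewrite -hy].
  have n3 : pair2 s w x y -> e x y.
    by case/orP => /andP[/eqP-> /eqP->] //; rewrite se.
  move: n1 n2 n3; move: (adj _ x y) (adj _ x y) (pair2 z _ _ _) (pair2 s _ _ _) (e x y).
  clear; move=> [] [] [] [] [] //= h1 h2 h3;
    first [done|by have := h1 isT|by have := h2 isT|by have := h3 isT].
- exact: kept_sym.
- by move=> x; rewrite forestE ie andbF.
- exact: sw'.
- rewrite forestE sw andbT adj_cat; apply/negP => /or3P[/adj_mem[_]|/adj_mem[]|].
  + by rewrite (negbTE wsa).
  + move: uq; rewrite cat_uniq => /and3P[_ /hasPn H _] sb _.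
    by have := H s sb; rewrite /= mem_head.
  + by rewrite -/z (negbTE zs) (negbTE sw').
- by rewrite forestE se zw andbT adjC adj_cat -/z !eqxx !orbT.
Qed.

Lemma forest_end c v x0 : uniq c -> v \in c ->
  exists u, [/\ connect (forest c) v u, u \in c & valency (forest c) u <= 1].
Proof.
move=> uc /(kept_connect (fun p => e p.1 p.2) x0)[u [vu uc' h]]; exists u; split=> //.
apply: kept_valency_end => // y uy; case: h => [ul|[y' uy' n]].
  case: {vu} c uc uc' uy ul => // x c uc _ uy ul.
  have [p [r E]] := prsP _ _ _ uy; move: uc; rewrite E cat_uniq /= => /and5P[_ _ + _ _].
  by rewrite ul E last_cat /= mem_last.
by rewrite (uniq_prs_l uc uy uy').
Qed.

End MinimalList.

Lemma valencyU (T : finType) (F F' : rel T) v : (forall x, F v x -> F' v x = false) ->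
  valency (fun x y => F x y || F' x y) v = valency F v + valency F' v.
Proof.
move=> dis; rewrite /valency -(cardsUI [set x | F v x]).
have -> : [set x | F v x] :&: [set x | F' v x] = set0.
  by apply/setP => x; rewrite !inE; case: (boolP (F v x)) => //= /dis.
by rewrite cards0 addn0; apply: eq_card => x; rewrite !inE.
Qed.

Section Linking.
Variables (T : finType) (e : rel T) (d kap g : nat).
Hypothesis G : pseudorandom e d kap g.
Hypotheses (kap_ge : 1024 <= kap) (g_ge : 128 * kap <= g) (n_ge : g ^ 3 <= #|T|).
Variables (Lam A K : {set T}) (c1 : seq T) (F0 : rel T).
Hypotheses (deg1 : forall x, d <= 16 * dg e x (~: Lam)) (degA : forall x, d <= 16 * dg e x A).
Hypotheses (AL : A \subset Lam) (AK : [disjoint A & K]).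
Hypotheses (c1E : c1 =i ~: Lam) (uc1 : uniq c1) (mc1 : minimal e c1).
Hypothesis few : 48 * kap * (nel e c1).+1 <= #|T|.
Implicit Types (F M : rel T) (x y v w s t : T) (c : seq T).

Let se : symmetric e := pr_sym G.
Let ie : irreflexive e := pr_irr G.

Definition load c F M v := valency (forest e c) v + valency F v + valency M v.

Definition defect c F M (X : {set T}) := \sum_(v in X) (2 - load c F M v).

Definition linked M := [set v | [exists x, M v x]].

(** Both sides always lack the same total valency, so edges between them can complete both. [lk_few]
    keeps the linked vertices few during the whole process: a link adds at most two of them and
    lowers the defect of each side by one. *)
Record linking c F M : Prop := {
  lk_perm : perm_eq c c1;
  lk_nel : nel e c <= nel e c1;
  lk_sp : spanning e Lam A K F0 F;
  lk_sym : symmetric M;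
  lk_sub : subrel M e;
  lk_cross : forall x y, M x y -> (x \in Lam) != (y \in Lam);
  lk_load : forall v, load c F M v <= 2;
  lk_bal : defect c F M Lam = defect c F M (~: Lam);
  lk_few : #|linked M| + 2 * defect c F M (~: Lam) <= 4 * (nel e c1).+1 }.

Lemma defect_dec c F M c' F' M' (X : {set T}) y : y \in X -> load c F M y < 2 ->
  {in X, forall v, load c' F' M' v = load c F M v + (v == y)} ->
  defect c F M X = (defect c' F' M' X).+1.
Proof.
move=> yX ly h; rewrite /defect (bigD1 y) // [in RHS](bigD1 y) //= h // eqxx.
rewrite (eq_bigr (fun v => 2 - load c' F' M' v)); first by move: ly; clear; lia.
by move=> v /andP[vX vy]; rewrite h // (negbTE vy) addn0.
Qed.

(** A deficient [y] outside [Lam] and a deficient [t0] inside are rotated until an edge joins two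
    unlinked ends [s] and [t]. At [s] and [t] the rotations and the new edge cancel, so only the
    loads of [y] and [t0] grow. Avoiding linked vertices makes the edge new. *)
Lemma link_step c F M : linking c F M -> 0 < defect c F M (~: Lam) ->
  exists c' F' M', linking c' F' M' /\ (defect c' F' M' (~: Lam)).+1 = defect c F M (~: Lam).
Proof.
case=> pc nc sp sM Me Mx ld bal cl pos.
have [y yV ly] : exists2 y, y \in ~: Lam & load c F M y < 2.
  have : defect c F M (~: Lam) != 0 by rewrite -lt0n.
  by rewrite sum_nat_eq0 negb_forall => /existsP[y]; rewrite negb_imply subn_eq0 -ltnNge => /andP[]; exists y.
have [t0 tL lt] : exists2 y, y \in Lam & load c F M y < 2.
  have : defect c F M Lam != 0 by rewrite bal -lt0n.
  by rewrite sum_nat_eq0 negb_forall => /existsP[t]; rewrite negb_imply subn_eq0 -ltnNge => /andP[]; exists t.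
have mc := minimal_perm mc1 pc nc.
have uc : uniq c by rewrite (perm_uniq pc).
have yc : y \in c by rewrite (perm_mem pc) c1E.
have [|r [pr nr fr]] := reopen se mc uc yc.
  by apply: leq_trans ly; rewrite /load; clear; lia.
have ur : uniq (y :: r) by rewrite (perm_uniq pr).
have mr := minimal_perm mc pr nr.
have g1 : 1 < g by move: kap_ge g_ge; clear; lia.
have cS : #|T| <= 6 * kap * #|heads e (~: Lam) (y :: r)|.
  apply: (posa (Gd := [set: T]) G g1 ur); rewrite ?inE //.
    by move=> w wV; rewrite inE (perm_mem pr) (perm_mem pc) c1E wV; split=> //; split=> // z _; rewrite inE.
  by move=> v _ _; apply: leq_trans (deg1 v) _; rewrite leq_mul2r; apply/orP; right; move: kap_ge; clear; lia.
have sp0 : spanning e Lam A K F F by case: sp; split.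
have valF v : valency F v <= 2 by apply: leq_trans (ld v); rewrite /load; clear; lia.
have k16 : 16 <= kap by move: kap_ge; clear; lia.
have cE := card_ends G k16 g1 degA AL AK sp0 tL valF.
have cL : 12 * kap * #|linked M| <= #|T|.
  apply: leq_trans few; have -> : 48 * kap = 12 * kap * 4 by clear; lia.
  by rewrite -(mulnA (12 * kap)) leq_mul2l; apply/orP; right; move: cl; clear; lia.
have big (X : {set T}) : #|T| <= 6 * kap * #|X| -> #|T| <= 12 * kap * #|X :\: linked M|.
  have : #|X| <= #|X :\: linked M| + #|linked M|.
    by rewrite -(cardsID (linked M) X) addnC leq_add2l subset_leq_card // subsetIr.
  have -> : 12 * kap * #|X :\: linked M| = 2 * (6 * kap * #|X :\: linked M|) by clear; lia.
  move=> h /leq_trans h1; have := leq_mul (leqnn (6 * kap)) h; rewrite mulnDr.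
  have := cL; have -> : 12 * kap * #|linked M| = 2 * (6 * kap * #|linked M|) by clear; lia.
  move=> h2 h3; have := h1 _ h3; move: h2; move: (6 * kap * _) (6 * kap * _) => a b; clear; lia.
have [s [t [sS tE st]]] := linked_large G kap_ge g_ge n_ge (big _ cS) (big _ cE).
move: sS tE; rewrite !in_setD => /andP[sM' sS] /andP[tM' tE].
move: sS; rewrite in_set => /asboolP[q Rq].
move: tE; rewrite in_set => /asboolP[F' RF].
have [spF' tL' valF'] := turned_inv G sp0 tL RF.
have pq := perm_trans (reach_perm Rq) (perm_trans pr pc).
have sV : s \in ~: Lam by rewrite -c1E -(perm_mem pq) mem_head.
have sL : s \notin Lam by move: sV; rewrite inE.
have yL : y \notin Lam by move: yV; rewrite inE.
have nst : s != t by apply: contraNneq sL => ->.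
have nM : ~~ M s t by apply: contra sM' => h; rewrite inE; apply/existsP; exists t.
have ldE v : load (s :: q) F' (add_pair M s t) v = load c F M v + (v == y) + (v == t0).
  have := reach_valency se ie v s mr ur Rq; have := valF' v.
  rewrite /load (valency_add_pair v sM nM nst) (valency_eq v fr) /=; clear; lia.
have neyt v : v \in ~: Lam -> (v == t0) = false by rewrite inE; apply: contraNF => /eqP->.
have neLy v : v \in Lam -> (v == y) = false by move=> h; apply: contraNF yL => /eqP<-.
have dV : defect c F M (~: Lam) = (defect (s :: q) F' (add_pair M s t) (~: Lam)).+1.
  by apply: (defect_dec yV ly) => v vV; rewrite ldE neyt // addn0.
have dL : defect c F M Lam = (defect (s :: q) F' (add_pair M s t) Lam).+1.
  by apply: (defect_dec tL lt) => v vV; rewrite ldE neLy // addn0.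
exists (s :: q), F', (add_pair M s t); split; last by rewrite dV.
split=> //.
- exact: leq_trans (reach_nel se Rq) (leq_trans nr nc).
- case: spF' => h1 h2 h3 h4 h5; split=> // u v uA vA.
  by rewrite h4 // (sp_off sp).
- by move=> u v; rewrite /add_pair sM pair2C.
- move=> u v /orP[/Me//|/orP[]/andP[/eqP-> /eqP->]] //.
  by rewrite se.
- by move=> u v /orP[/Mx//|/orP[]/andP[/eqP-> /eqP->]]; rewrite tL' (negbTE sL).
- move=> v; rewrite ldE; have := ld v.
  have [->|vy] := eqVneq v y; first by rewrite neyt //; move: ly; clear; lia.
  by have [->|_] := eqVneq v t0; [move: lt|]; clear; lia.
- by apply: succn_inj; rewrite -dV -dL.
- have : #|linked (add_pair M s t)| <= #|linked M| + 2.
    apply: leq_trans (_ : #|linked M :|: [set s; t]| <= _).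
      apply: subset_leq_card; apply/subsetP => v; rewrite !inE => /existsP[x /orP[Mv|]].
        by apply/orP; left; apply/existsP; exists x.
      by case/orP => /andP[-> _]; rewrite ?orbT.
    apply: leq_trans (leq_card_setU _ _) _; rewrite leq_add2l cards2.
    by case: (_ != _).
  by move: cl; rewrite dV; clear; lia.
Qed.

Hypotheses (sp0 : spanning e Lam A K F0 F0) (val0 : forall v, valency F0 v <= 2).
Hypothesis bal0 : \sum_(v in Lam) (2 - valency F0 v) = 2 * (nel e c1).+1.

(** With no defect left, the forest, [F] and [M] together are 2-regular. A vertex outside [Lam]
    reaches a mark because its forest path has an end of valency at most one, from which a link
    leads into [Lam]. *)
Theorem two_factor : exists R : rel T, [/\ symmetric R, subrel R e,
  forall v, valency R v = 2, forall v, marked K R v &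
  forall x y, x \in Lam -> y \in Lam -> x \notin A -> y \notin A -> R x y = F0 x y].
Proof.
have forest_supp c x y : perm_eq c c1 -> forest e c x y -> x \notin Lam /\ y \notin Lam.
  move=> pc; rewrite forestE // => /andP[/adj_mem[]].
  by rewrite !(perm_mem pc) !c1E !inE.
have valency0 F v : (forall x, F v x = false) -> valency F v = 0.
  by move=> h; apply: eq_card0 => x; rewrite !inE h.
have suppF0 v : v \notin Lam -> valency F0 v = 0.
  by move=> vL; apply: valency0 => x; apply: contraNF vL => /(sp_supp sp0).
have suppc c v : perm_eq c c1 -> v \in Lam -> valency (forest e c) v = 0.
  by move=> pc vL; apply: valency0 => x; apply: contraTF vL => /(forest_supp _ _ _ pc)[].
pose M0 : rel T := fun _ _ => false.
have vM0 v : valency M0 v = 0 by apply: valency0.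
have valc v : valency (forest e c1) v <= 2 by apply: kept_valency.
have d1 : defect c1 F0 M0 (~: Lam) = 2 * (nel e c1).+1.
  have c0 : 0 < size c1.
    have [x _] : exists x : T, True.
      have /card_gt0P[x] : 0 < #|T| by apply: leq_trans n_ge; rewrite expn_gt0; move: kap_ge g_ge; clear; lia.
      by exists x.
    have := deg1 x; have := deg_ge G kap_ge g_ge n_ge => h1 h2.
    have /card_gt0P[y] : 0 < #|[set y in ~: Lam | e x y]| by move: h1 h2 kap_ge; rewrite /dg; clear; lia.
    by rewrite inE => /andP[+ _]; rewrite -c1E; case: (c1).
  have -> : defect c1 F0 M0 (~: Lam) = \sum_(v in ~: Lam) (2 - valency (forest e c1) v).
    by apply: eq_bigr => v; rewrite inE => vL; rewrite /load vM0 suppF0 // !addn0.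
  have E : \sum_(v in ~: Lam) (2 - valency (forest e c1) v) + \sum_v valency (forest e c1) v = 2 * size c1.
    rewrite [X in _ + X](bigID (mem (~: Lam))) /= [X in _ + (_ + X)]big1 ?addn0 => [|v].
      rewrite -big_split /= (eq_bigr (fun=> 2)) => [|v _]; last by rewrite subnK.
      by rewrite sum_nat_const mulnC -(card_uniqP uc1); congr (2 * _); apply: eq_card => x; rewrite -c1E.
    by rewrite inE negbK => vL; apply: suppc.
  have := kept_sum (fun p => e p.1 p.2) uc1; rewrite -/(forest e c1) => E2.
  have E3 : count (fun p => e p.1 p.2) (prs c1) + nel e c1 = (size c1).-1.
    by rewrite /nel count_predC /prs size_zip size_behead (minn_idPr (leq_pred _)).
  by move: E E2 E3 c0; clear; lia.
have dL : defect c1 F0 M0 Lam = 2 * (nel e c1).+1.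
  by rewrite -bal0; apply: eq_bigr => v vL; rewrite /load vM0 (suppc c1) // addn0.
have lk0 : linking c1 F0 M0.
  split=> //; last 2 first.
  - by rewrite d1 dL.
  - have -> : linked M0 = set0 by apply/setP => v; rewrite !inE; apply/existsP => -[].
    by rewrite d1 cards0; clear; lia.
  - move=> v; rewrite /load vM0 addn0; case: (boolP (v \in Lam)) => vL.
      by rewrite (suppc c1) // add0n.
    by rewrite suppF0 // addn0.
have [c [F [M [[pc nc sp sM Me Mx ld bal _] dz]]]] :
    exists c F M, linking c F M /\ defect c F M (~: Lam) = 0.
  have reduce D c F M : linking c F M -> defect c F M (~: Lam) = D ->
      exists c F M, linking c F M /\ defect c F M (~: Lam) = 0.
    elim: D c F M => [|D IH] c F M lk E; first by exists c, F, M.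
    have [|c' [F' [M' [lk' E']]]] := link_step lk; first by rewrite E.
    by apply: IH lk' _; apply: succn_inj; rewrite E' E.
  exact: reduce lk0 erefl.
have full v : load c F M v = 2.
  have H (X : {set T}) : v \in X -> defect c F M X = 0 -> load c F M v = 2.
    move=> vX /eqP; rewrite sum_nat_eq0 => /forallP/(_ v); rewrite vX subn_eq0 => /= h.
    by apply/eqP; rewrite eqn_leq ld.
  by case: (boolP (v \in Lam)) => vL; [apply: (H Lam); rewrite ?bal|apply: (H (~: Lam)); rewrite ?inE].
have FL x y : F x y -> x \in Lam /\ y \in Lam.
  by move=> xy; split; [exact: (sp_supp sp xy)|apply: (sp_supp sp (y := x)); rewrite (sp_sym sp)].
pose R : rel T := fun x y => [|| forest e c x y, F x y | M x y].
have subF x y : F x y -> connect R x y by move=> xy; apply: connect1; rewrite /R xy orbT.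
have mLam v : v \in Lam -> marked K R v.
  by move=> /(sp_marked sp)[k kK vk]; exists k => //; apply: connect_sub vk.
exists R; split.
- by move=> x y; rewrite /R /forest (kept_sym _ c) (sp_sym sp) sM.
- move=> x y /or3P[|/(sp_sub sp)//|/Me//].
  by rewrite forestE // => /andP[].
- move=> v; rewrite -(full v) /load -addnA.
  rewrite (valencyU (F := forest e c) (F' := fun x y => F x y || M x y)) => [|x /forest_supp].
    rewrite valencyU // => x /FL[vL xL]; apply: contraTF isT => /Mx; by rewrite vL xL.
  case/(_ pc) => vL xL; apply/negP => /orP[/FL[]|/Mx]; first by rewrite (negbTE vL).
  by rewrite (negbTE vL) (negbTE xL).
- move=> v; case: (boolP (v \in Lam)) => [/mLam//|vL].
  have vc : v \in c by rewrite (perm_mem pc) c1E inE.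
  have uc : uniq c by rewrite (perm_uniq pc).
  have [u [vu uc' uv]] := forest_end e v uc vc.
  have uL : u \notin Lam by move: uc'; rewrite (perm_mem pc) c1E inE.
  have Fu : valency F u = 0 by apply: valency0 => x; apply: contraNF uL => /FL[].
  have : 0 < valency M u by have := full u; rewrite /load Fu; move: uv; clear; lia.
  case/card_gt0P => x; rewrite inE => ux.
  have xL : x \in Lam by have := Mx _ _ ux; rewrite (negbTE uL); case: (x \in Lam).
  have [k kK xk] := mLam x xL; exists k => //.
  apply: connect_trans xk; apply: connect_trans (_ : connect R u x); last first.
    by apply: connect1; rewrite /R ux !orbT.
  by apply: connect_sub vu => a b ab; apply: connect1; rewrite /R ab.
- move=> x y xL yL xA yA; rewrite -(sp_off sp) // /R.
  have -> : forest e c x y = false by apply: contraTF xL => /(forest_supp _ _ _ pc)[].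
  have -> : M x y = false by apply: contraTF isT => /Mx; rewrite xL yL.
  by rewrite orbF.
Qed.
End Linking.

(** * Merging the cycles *)

Section TwoRegular.
Variables (T : finType) (R : rel T).
Hypotheses (sR : symmetric R) (iR : irreflexive R).

Lemma sum_valency_even : ~~ odd (\sum_v valency R v).
Proof using sR iR.
rewrite sum_valency; pose lt (x y : T) := enum_rank x < enum_rank y.
have -> : \sum_x \sum_y R x y = \sum_x \sum_y (R x y && lt x y) + \sum_x \sum_y (R x y && lt y x).
  rewrite -big_split; apply: eq_bigr => x _ /=; rewrite -big_split; apply: eq_bigr => y _ /=.
  case: (boolP (R x y)) => //= xy; rewrite /lt; case: ltngtP => //= h.
  by move: xy; rewrite (enum_rank_inj (val_inj h)) iR.
rewrite [X in _ + X]exchange_big /=.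
have -> : \sum_j \sum_i (R i j && lt j i) = \sum_x \sum_y (R x y && lt x y).
  by apply: eq_bigr => x _; apply: eq_bigr => y _; rewrite sR.
by rewrite addnn odd_double.
Qed.

Hypotheses (two : forall v, valency R v = 2) (conn : forall x y, connect R x y).

(** A longest path closes up: the second neighbour of its first vertex lies on it and must be the
    last vertex, as an inner vertex would get a third neighbour. By connectivity, a vertex off this
    cycle would yield a longer path. *)
Lemma hamilton_cycle (x0 : T) : exists p, [/\ uniq p, p =i T & cycle R p].
Proof using sR iR two conn.
pose P k := `[< exists x p, [/\ path R x p, uniq (x :: p) & size p = k] >].
have exP : exists k, P k by exists 0; apply/asboolP; exists x0, [::].
have boundP k : P k -> k <= #|T|.
  by move/asboolP => [x [p [_ up <-]]]; apply: leq_trans (ltnW _) (max_card (mem (x :: p))); rewrite (card_uniqP up).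
case: (ex_maxnP exP boundP) => k /asboolP[x [p [pp up sp]]] mx.
have maxP y q : path R y q -> uniq (y :: q) -> size q <= k.
  by move=> h1 h2; apply: mx; apply/asboolP; exists y, q.
have nbr z : R x z -> z \in x :: p.
  move=> xz; apply: contraT => zp; have := maxP z (x :: p).
  by rewrite /= sR xz pp => /(_ isT); rewrite (zp : z \notin x :: p) -/(uniq (x :: p)) up sp ltnn => /(_ isT).
have no3 w a b c : R w a -> R w b -> R w c -> uniq [:: a; b; c] -> False.
  move=> wa wb wc u; have := two w; rewrite /valency => E.
  have : #|[set y | R w y]| >= #|[:: a; b; c]|.
    apply: subset_leq_card; apply/subsetP => y; rewrite !inE.
    by case/or3P => /eqP->.
  by rewrite E (card_uniqP u).
have closed_cycle : cycle R (x :: p).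
  case: p pp up sp nbr => [|p1 p] pp up sp nbr.
    have /card_gt0P[y] : 0 < #|[set y | R x y]| by have := two x; rewrite /valency => ->.
    by rewrite inE => /[dup] /nbr; rewrite inE => /eqP->; rewrite iR.
  have /card_gt0P[w] : 0 < #|[set y | R x y] :\ p1|.
    by have := two x; rewrite /valency (cardsD1 p1) => h; case: (_ \in _) h => //=; lia.
  rewrite !inE => /andP[wp1 xw].
  have := nbr w xw; rewrite inE => /orP[/eqP wx|]; first by rewrite wx iR in xw.
  rewrite inE (negbTE wp1) => /split_mem[l [r E]].
  have pE : p1 :: p = (p1 :: l) ++ w :: r by rewrite E.
  case: r E pE => [|b r] E pE.
    have -> : cycle R [:: x, p1 & p] = path R x (rcons (p1 :: p) x) by [].
    by rewrite rcons_path pp pE last_cat /= sR.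
  exfalso; move: pp up; rewrite pE cat_path cons_uniq mem_cat negb_or cat_uniq.
  move=> /andP[_ pr] /andP[/andP[xl xr] /and3P[_ /hasPn dis _]].
  have /and3P[lw wb _] : [&& R (last p1 l) w, R w b & path R b r] := pr.
  have bI : b \in w :: b :: r by rewrite !inE eqxx orbT.
  have lI : last p1 l \in p1 :: l by apply: mem_last.
  apply: (no3 w x (last p1 l) b); rewrite ?(sR w x) ?(sR w (last _ _)) //.
  rewrite /= !inE !negb_or !andbT.
  rewrite -andbA; apply/and3P; split.
  - by apply: contraNneq xl => ->.
  - by apply: contraNneq xr => ->.
  - by apply/eqP => lb; have := dis b bI; rewrite /= -lb lI.
have full v : v \in x :: p.
  apply: contraT => vp; have /connectP[q pq Ev] := conn x v.
  have [y [z [yp zp yz]]] : exists y z, [/\ y \in x :: p, z \notin x :: p & R y z].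
    have leave a : a \in x :: p -> path R a q -> v = last a q ->
        exists y z, [/\ y \in x :: p, z \notin x :: p & R y z].
      elim: q a {pq Ev} => [|z q IH] a ap /=; first by move=> _ va; rewrite va ap in vp.
      move=> /andP[az pz] Ev; case: (boolP (z \in x :: p)) => zp; last by exists a, z.
      exact: IH zp pz Ev.
    exact: leave (mem_head _ _) pq Ev.
  have [i r Er] := rot_to yp.
  have := maxP z (y :: r); rewrite /= sR yz.
  have pr : path R y r.
    by have := closed_cycle; rewrite -(rot_cycle i) Er /= rcons_path => /andP[].
  have sz : size r = k by apply: succn_inj; rewrite -sp -[(size r).+1]/(size (y :: r)) -Er size_rot.
  have ur : uniq (y :: r) by rewrite -Er rot_uniq.
  have zr : z \notin y :: r by rewrite -Er mem_rot.
  by rewrite pr sz -/(uniq (y :: r)) zr ur ltnn => /(_ isT isT).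
by exists (x :: p); split=> // v; rewrite full.
Qed.
End TwoRegular.

Section Merge.
Variables (T : finType) (e : rel T).
Hypotheses (se : symmetric e) (ie : irreflexive e).
Implicit Types (R F : rel T) (x y v a : T) (P A B : seq T) (H : gadget T).

Lemma adj_sym P : symmetric (adj P).
Proof. by move=> x y; apply: adjC. Qed.

Lemma valency_path x P v : uniq (x :: P) ->
  valency (adj (x :: P)) v + (v == x) + (v == last x P) = 2 * (v \in x :: P).
Proof.
elim: P x => [|y P IH] x u.
  rewrite inE /valency; have -> : [set z | adj [:: x] v z] = set0 by apply/setP => z; rewrite !inE.
  by rewrite cards0; case: (v == x).
have [xP uP] := andP u.
have E : adj [:: x, y & P] =2 add_pair (adj (y :: P)) x y.
  move=> a b; rewrite /add_pair /pair2 /adj prs_cons2 !inE !xpair_eqE.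
  by do !case: (_ \in _); do !case: (_ == _).
have nxy : ~~ adj (y :: P) x y by apply: contra xP => /adj_mem[].
have xy : x != y by apply: contraNneq xP => ->; rewrite mem_head.
rewrite (valency_eq v E) valency_add_pair //; last exact: adj_sym.
have := IH y uP; rewrite [v \in [:: x, _ & _]]in_cons [last x _]/=.
have : v == x -> (v \in y :: P) = false by move=> /eqP->; apply/negbTE.
case: (v == x) => [/(_ isT)->|_] /=; clear; lia.
Qed.

Definition ladder A B : rel T := fun x y => adj A x y || adj B x y.

Lemma ladder_sym A B : symmetric (ladder A B).
Proof. by move=> x y; rewrite /ladder !(adj_sym _ x). Qed.

Lemma valency_ladder a A b B v : uniq ((a :: A) ++ (b :: B)) ->
  valency (ladder (a :: A) (b :: B)) v +
    ((v == a) + (v == last a A) + ((v == b) + (v == last b B))) = 2 * (v \in (a :: A) ++ (b :: B)).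
Proof.
rewrite cat_uniq => /and3P[uA /hasPn dis uB]; rewrite /ladder valencyU.
  have := valency_path v uA; have := valency_path v uB; rewrite mem_cat.
  have := dis v; case: (v \in b :: B) => [/(_ isT)|_] /=; last by case: (_ \in _); clear; lia.
  by move/negbTE; rewrite [X in X = false -> _]/= => ->; clear; lia.
move=> x /adj_mem[vA _]; apply/negP => /adj_mem[vB _].
by have := dis v vB; rewrite /= vA.
Qed.

Definition gA' H := gu H :: rcons (gM' H) (gz' H).
Definition gB' H := [:: gz H; gv H].

Lemma adj_sub P x y : sorted e P -> adj P x y -> e x y.
Proof.
have sub : forall u w, sorted e P -> (u, w) \in prs P -> e u w.
  move=> u w sP /prsP[p [r E]]; move: sP; rewrite E.
  by case: p {E} => [|p0 p] /=; rewrite ?cat_path /=; [case/andP|case/and4P].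
by move=> sP /orP[/(sub _ _ sP)//|/(sub _ _ sP)]; rewrite se.
Qed.

Lemma path_connect F x P y : path F x P -> y \in x :: P -> connect F x y.
Proof.
rewrite inE => pp /orP[/eqP->|/split_mem[p [r E]]]; first exact: connect0.
move: pp; rewrite E -cat_rcons cat_path => /andP[pp _].
by apply/connectP; exists (rcons p y); rewrite ?last_rcons.
Qed.

Lemma adj_path x P : path (adj (x :: P)) x P.
Proof.
elim: P x => //= y P IH x; rewrite {1}/adj prs_cons2 mem_head /=.
by apply: sub_path (IH y) => a b; rewrite /adj prs_cons2 !inE => /orP[]->; rewrite ?orbT.
Qed.

(** Outside the ladder exactly the four vertices counted by [t] have odd valency, and each component
    contains an even number of them. If [gu] and [gv] are on different cycles, [gz'] is on that of
    [gv], which leaves [gz] as the only partner of [gu]. *)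
Lemma merge R H : symmetric R -> subrel R e -> (forall v, valency R v = 2) -> switch e H ->
  {in gverts H &, forall x y, R x y = ladder (gA H) (gB H) x y} ->
  exists R', [/\ symmetric R' /\ subrel R' e, forall v, valency R' v = 2,
    forall x y, connect R x y -> connect R' x y, connect R' (gu H) (gv H) &
    forall x y, ~~ ((x \in gverts H) && (y \in gverts H)) -> R' x y = R x y].
Proof using se ie.
move=> sR Re two [pA pA' /andP[zv z'v] pM ug] RW.
have [uv|uv] := boolP (connect R (gu H) (gv H)); first by exists R.
set W := gverts H in ug RW *.
pose Ro : rel T := fun x y => R x y && ~~ ((x \in W) && (y \in W)).
have uA : gA H ++ gB H = gverts H by [].
have pW' : perm_eq (gA' H ++ gB' H) W.
  apply/permP => f; rewrite /W /gverts /gA /gB /gA' /gB'.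
  by rewrite -!cats1 !count_cat /= !count_cat (permP pM) /=; clear; lia.
have ug' : uniq (gA' H ++ gB' H) by rewrite (perm_uniq pW').
pose t v := (v == gu H) + (v == gz H) + ((v == gz' H) + (v == gv H)).
have vl v : valency (ladder (gA H) (gB H)) v + t v = 2 * (v \in W).
  by have := valency_ladder v ug; rewrite last_rcons.
have vl' v : valency (ladder (gA' H) (gB' H)) v + t v = 2 * (v \in W).
  have := valency_ladder v ug'; rewrite last_rcons (perm_mem pW') => <-.
  rewrite -/(gA' H) -/(gB' H) /t [last _ [:: _]]/=.
  move: (v == _) (v == _) (v == _) (v == _) (valency _ _); clear => [] [] [] [] [] n; lia.
have lW x y : ladder (gA H) (gB H) x y -> x \in W /\ y \in W.
  by rewrite /W /gverts !mem_cat => /orP[]/adj_mem[-> ->]; rewrite ?orbT.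
have lW' x y : ladder (gA' H) (gB' H) x y -> x \in W /\ y \in W.
  by rewrite -!(perm_mem pW') !mem_cat => /orP[]/adj_mem[-> ->]; rewrite ?orbT.
have split_val v : 2 = valency (ladder (gA H) (gB H)) v + valency Ro v.
  rewrite -(two v) -valencyU => [|x /lW[vW xW]]; last by rewrite /Ro vW xW andbF.
  apply: valency_eq => x y; rewrite /Ro; case: (boolP ((x \in W) && (y \in W))) => [/andP[xW yW]|n].
    by rewrite andbF orbF RW.
  rewrite andbT; case: (boolP (ladder _ _ _ _)) => // /lW[xW yW].
  by rewrite xW yW in n.
pose R' : rel T := fun x y => ladder (gA' H) (gB' H) x y || Ro x y.
have two' v : valency R' v = 2.
  rewrite valencyU => [|x /lW'[vW xW]]; last by rewrite /Ro vW xW andbF.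
  by have := split_val v; have := vl v; have := vl' v; clear; lia.
have sRo : symmetric Ro by move=> x y; rewrite /Ro sR andbC [X in _ = _ && ~~ X]andbC andbC.
have iRo : irreflexive Ro.
  by move=> x; apply/negP => /andP[/Re]; rewrite ie.
(* The handshake lemma in the [Ro]-component of [a]: valencies are [t v] on the ladder and 2
   elsewhere. *)
have even a : ~~ odd (connect Ro a (gu H) + connect Ro a (gz H) +
                      (connect Ro a (gz' H) + connect Ro a (gv H))).
  pose F : rel T := fun x y => Ro x y && connect Ro a x.
  have sF : symmetric F.
    move=> x y; rewrite /F sRo; case: (boolP (Ro y x)) => //= yx.
    have xy : Ro x y by rewrite sRo.
    by apply/idP/idP => h; apply: connect_trans h (connect1 _).
  have iF : irreflexive F by move=> x; rewrite /F iRo.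
  have := sum_valency_even sF iF.
  have -> : \sum_v valency F v = \sum_v (connect Ro a v * (t v + 2 * (v \notin W))).
    apply: eq_bigr => v _; case: (boolP (connect Ro a v)) => av.
      have -> : valency F v = valency Ro v by apply: eq_card => x; rewrite !inE /F av andbT.
      have := split_val v; have := vl v; have tW : v \notin W -> t v = 0.
        by have := vl v; case: (v \in W) => //=; clear; lia.
      by case: (v \in W) tW => [_|/(_ isT)->]; rewrite /= ?mul1n; clear; lia.
    by apply: eq_card0 => x; rewrite !inE /F (negbTE av) andbF.
  have sum1 b : \sum_v connect Ro a v * (v == b) = connect Ro a b.
    rewrite (bigD1 b) //= eqxx muln1 big1 ?addn0 // => v /negbTE->; by rewrite muln0.
  rewrite (eq_bigr (fun v => connect Ro a v * (v == gu H) + connect Ro a v * (v == gz H) +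
     (connect Ro a v * (v == gz' H) + connect Ro a v * (v == gv H)) +
     2 * (connect Ro a v * (v \notin W)))); last by move=> v _; rewrite /t; clear; lia.
  by rewrite !big_split /= !sum1 sum_nat_const muln0 addn0 addnn oddD odd_double addbF.
have RoR x y : connect Ro x y -> connect R x y.
  by apply: connect_sub => u w /andP[uw _]; apply: connect1.
have RoR' x y : connect Ro x y -> connect R' x y.
  by apply: connect_sub => u w uw; apply: connect1; rewrite /R' uw orbT.
have sR' : symmetric R' by move=> x y; rewrite /R' ladder_sym sRo.
have cR := sym_connect_sym sR; have cR' := sym_connect_sym sR'.
have inW : [/\ gu H \in W, gz H \in W, gz' H \in W & gv H \in W].
  by split; rewrite /W /gverts /gA /gB mem_cat !inE ?mem_rcons ?inE ?eqxx ?orbT.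
have [uW zW z'W vW] := inW.
have z'v_R : connect R (gz' H) (gv H).
  by apply: connect1; rewrite RW // /ladder /adj /gB prs_cons2 mem_head !orbT.
have uz : connect Ro (gu H) (gz H).
  have := even (gu H); rewrite connect0.
  have -> : connect Ro (gu H) (gv H) = false by apply/negP => /RoR; apply/negP.
  have -> : connect Ro (gu H) (gz' H) = false.
    by apply: contraNF uv => /RoR/connect_trans; apply.
  by case: (connect _ _ _).
have vz' : connect Ro (gv H) (gz' H).
  have := even (gv H); rewrite connect0.
  have -> : connect Ro (gv H) (gu H) = false by apply: contraNF uv => /RoR; rewrite cR.
  have -> : connect Ro (gv H) (gz H) = false.
    apply: contraNF uv => /RoR h; rewrite cR; apply: connect_trans h _.
    by rewrite cR; apply: RoR.
  by case: (connect _ _ _).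
(* The new paths run from [gu] to [gz'] and from [gz] to [gv]; the connection of [gu] with [gz]
   outside the ladder ties them together. *)
have allW x : x \in W -> connect R' (gu H) x.
  have ladR' P Q : P = gA' H \/ P = gB' H -> Q \in P -> connect R' (head Q P) Q.
    case=> -> QP; apply: path_connect QP; apply: sub_path (adj_path _ _) => a b ab;
    by rewrite /R' /ladder ab ?orbT.
  rewrite -(perm_mem pW') mem_cat => /orP[h|h].
    by have := ladR' _ _ (or_introl erefl) h.
  have := ladR' _ _ (or_intror erefl) h; rewrite [head _ _]/=.
  by apply: connect_trans; apply: RoR'.
exists R'; split=> //; [split=> // | |exact: allW|].
- move=> x y /orP[/orP[]|/andP[/Re]//]; apply: adj_sub => //=.
  by rewrite zv.
- apply: connect_sub => x y xy; case: (boolP ((x \in W) && (y \in W))) => [/andP[xW yW]|n].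
    by apply: connect_trans (allW y yW); rewrite cR' allW.
  by apply: connect1; rewrite /R' /Ro xy n orbT.
- move=> x y n; rewrite /R' /Ro n andbT.
  by case: (boolP (ladder _ _ _ _)) => // /lW'[xW yW]; rewrite xW yW in n.
Qed.

End Merge.

(** * Assembling the Hamilton cycle *)

Lemma flatten_map_inj (I U : eqType) (f : I -> seq U) s a b x :
  uniq (flatten (map f s)) -> a \in s -> b \in s -> x \in f a -> x \in f b -> a = b.
Proof.
elim: s => //= i s IH; rewrite cat_uniq => /and3P[_ /hasPn dis us].
have out c : c \in s -> x \in f c -> x \in flatten (map f s).
  by move=> cs xc; apply/flattenP; exists (f c); rewrite ?map_f.
rewrite !inE => /orP[/eqP->|ai] /orP[/eqP->|bi] xa xb //; last exact: IH.
  by have := dis x (out _ bi xb); rewrite /= xa.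
by have := dis x (out _ ai xa); rewrite /= xb.
Qed.

Lemma flatten_map_uniq (I U : eqType) (f : I -> seq U) (h : I -> U) s :
  uniq (flatten (map f s)) -> (forall a, h a \in f a) -> uniq (map h s).
Proof.
move=> + hf; elim: s => //= i s IH; rewrite cat_uniq => /and3P[_ /hasPn dis /IH->].
rewrite andbT; apply/mapP => -[k ks E]; have := dis (h k).
rewrite -{2}E /= hf => H; suff : h k \in flatten (map f s) by move/H.
by apply/flattenP; exists (f k); rewrite ?map_f.
Qed.

Lemma prs_last (U : eqType) (x y : U) c : uniq (x :: c) -> (last x c, y) \in prs (x :: c) -> False.
Proof.
move=> uc /prsP[p [r E]]; have L := congr1 (last x) E; move: uc.
rewrite /= last_cat /= in L; rewrite E cat_uniq cons_uniq => /and3P[_ _ /andP[+ _]].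
by rewrite L mem_last.
Qed.

Section Assemble.
Variables (T : finType) (e : rel T).
Implicit Types (R : rel T) (x y v : T) (H : gadget T) (hs : seq (gadget T)).

Lemma mem_gadget H :
  [/\ gu H \in gverts H, gz H \in gverts H, gz' H \in gverts H & gv H \in gverts H].
Proof.
by split; rewrite /gverts /gA /gB mem_cat !inE ?mem_rcons ?inE ?eqxx ?orbT.
Qed.

(** A merge changes edges only inside its own ladder. As ladders are disjoint, the remaining ones
    are still traversed along their two pieces, and connections are never lost. *)
Lemma merge_all hs R : symmetric e -> irreflexive e ->
  symmetric R -> subrel R e -> (forall v, valency R v = 2) ->
  {in hs, forall H, switch e H} -> uniq (flatten [seq gverts H | H <- hs]) ->
  {in hs, forall H, {in gverts H &, forall x y, R x y = ladder (gA H) (gB H) x y}} ->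
  exists R', [/\ symmetric R', subrel R' e, forall v, valency R' v = 2,
    forall x y, connect R x y -> connect R' x y & {in hs, forall H, connect R' (gu H) (gv H)}].
Proof.
move=> se ie; elim: hs R => [|H hs IH] R sR Re two sw; first by exists R.
have -> : flatten [seq gverts K | K <- H :: hs] = gverts H ++ flatten [seq gverts K | K <- hs] by [].
rewrite cat_uniq => /and3P[_ /hasPn dis ug] RW.
have HH : H \in H :: hs by apply: mem_head.
have [R1 [[sR1 R1e] two1 c1 uv1 R1E]] := merge se ie sR Re two (sw H HH) (RW H HH).
have [|K Kh x y xK yK|R2 [sR2 R2e two2 c2 uv2]] := IH R1 sR1 R1e two1 _ ug.
- by move=> K Kh; apply: sw; rewrite inE Kh orbT.
- rewrite R1E; first by apply: RW => //; rewrite inE Kh orbT.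
  have := dis x; rewrite negb_and => -> //.
  by apply/flattenP; exists (gverts K); rewrite ?map_f.
exists R2; split=> // [x y /c1/c2//|K]; rewrite inE => /orP[/eqP->|/uv2//].
exact: c2.
Qed.

Lemma minimal_exists (Z : {set T}) : exists c, [/\ c =i Z, uniq c & minimal e c].
Proof.
pose P k := `[< exists c, perm_eq c (enum Z) /\ nel e c = k >].
have exP : exists k, P k by exists (nel e (enum Z)); apply/asboolP; exists (enum Z).
case: (ex_minnP exP) => k /asboolP[c [pc <-]] mn; exists c; split.
- by move=> x; rewrite (perm_mem pc) mem_enum.
- by rewrite (perm_uniq pc) enum_uniq.
- by move=> q pq; apply: mn; apply/asboolP; exists q; rewrite (perm_trans pq).
Qed.

Variables (d kap g j : nat).
Hypothesis G : pseudorandom e d kap g.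
Hypotheses (kap_ge : 1024 <= kap) (g_ge : 128 * kap <= g) (n_ge : g ^ 20 <= #|T|).
Hypotheses (j_lo : #|T| < g * 2 ^ j) (j_hi : g * 2 ^ j <= 2 * #|T|) (j_g : 2 * j + 4 <= g ^ 3).
Variables (Z1 V2 V3 : {set T}).
Hypotheses (deg1 : forall x, d <= 16 * dg e x Z1) (deg2 : forall x, d <= 16 * dg e x V2)
  (deg3 : forall x, d <= 16 * dg e x V3).
Hypotheses (dis12 : [disjoint Z1 & V2]) (dis13 : [disjoint Z1 & V3]) (dis23 : [disjoint V2 & V3]).

Theorem hamilton_of_zones : exists p, [/\ uniq p, p =i T & cycle e p].
Proof.
have g0 : 0 < g by move: kap_ge g_ge; clear; lia.
have n3 : g ^ 3 <= #|T| by apply: leq_trans n_ge; rewrite leq_pexp2l.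
have se := pr_sym G; have ie := pr_irr G.
have [c2 [c2E uc2 mc2]] := minimal_exists V2.
have r2 := few_runs G kap_ge g_ge n3 deg2 c2E uc2 mc2.
(* As many ladders as [few_runs] allows non-edges: the cover of the complement, known only after
   [L], cannot require more cuts than there are ladders. *)
pose N := #|T| %/ g ^ 8.
have hN : N * g ^ 8 <= #|T| by apply: leq_divM.
have [L [H0 [gs [sgs fr]]]] := frame_pr G kap_ge g_ge n_ge deg2 deg3 dis23 j_lo j_hi j_g hN r2 c2E uc2.
case: fr => uL sL V2L Lsub sw ug gsV lastL gsL pcs adjL link.
set vs := flatten _ in ug link.
pose Lam := [set x in L]; pose K := [set x in vs].
have LamE x : (x \in Lam) = (x \in L) by rewrite inE.
have V23 x : x \in V3 -> x \notin V2 by move=> x3; rewrite (disjointFl dis23 x3).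
have vsP x : x \in vs -> exists2 H, H \in H0 :: gs & x \in gverts H.
  by move=> /flattenP[Q /mapP[H HG ->] xQ]; exists H.
have invs H x : H \in H0 :: gs -> x \in gverts H -> x \in vs.
  by move=> HG xH; apply/flattenP; exists (gverts H); rewrite ?map_f.
(* The first zone is disjoint from [L], so its degrees make [few_runs] applicable to the complement
   of [L]. *)
have degL x : d <= 16 * dg e x (~: Lam).
  apply: leq_trans (deg1 x) _; rewrite leq_mul2l; apply: dg_sub; apply/subsetP => y yZ.
  rewrite in_setC LamE; apply/negP => /Lsub; rewrite in_setU.
  by rewrite (disjointFr dis12 yZ) (disjointFr dis13 yZ).
have [c1 [c1E uc1 mc1]] := minimal_exists (~: Lam).
have r1 := few_runs G kap_ge g_ge n3 degL c1E uc1 mc1.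
have kN : nel e c1 <= N by rewrite leq_divRL // expn_gt0 g0.
(* [L] is cut behind [gz] of [nel e c1] ladders, which gives as many pieces as the complement has
   paths. The pair leaving [gz] lies outside the ladder; [H0] is spared because its [gz] is already
   the end of [L]. *)
pose Zc := [seq gz H | H <- take (nel e c1) gs].
have ZcP x : x \in Zc -> exists2 H, H \in gs & x = gz H.
  by move=> /mapP[H /mem_take Hg ->]; exists H.
pose a : pred (T * T) := fun p => p.1 \notin Zc.
pose F0 := kept a L.
have disj H H' x : H \in H0 :: gs -> H' \in H0 :: gs -> x \in gverts H -> x \in gverts H' -> H = H'.
  by move=> h1 h2; apply: (flatten_map_inj (f := @gverts T) ug h1 h2).
have uZc : uniq Zc.
  rewrite /Zc map_take take_uniq //.
  have := flatten_map_uniq (h := @gz T) ug (fun H => let: And4 _ h _ _ := mem_gadget H in h).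
  by move=> /= /andP[].
have szZ : size Zc = nel e c1 by rewrite size_map size_takel // sgs.
have notZ H x : H \in H0 :: gs -> x \in gverts H -> x != gz H -> x \notin Zc.
  move=> HG xH nx; apply/negP => /ZcP[H' Hg' E].
  have HG' : H' \in H0 :: gs by rewrite inE Hg' orbT.
  have [_ zH' _ _] := mem_gadget H'.
  by move: nx; rewrite (disj H H' x) // ?E ?eqxx.
have swu H : H \in H0 :: gs -> uniq (gverts H) by case/sw.
have ne_z H : H \in H0 :: gs -> [/\ gu H != gz H, gz' H != gz H & gv H != gz H].
  move=> /swu; rewrite /gverts /gA /gB => u.
  have [u1 u2] : uniq (gu H :: rcons (gM H) (gz H)) /\ {in [:: gz' H; gv H], forall x, x != gz H}.
    move: u; rewrite cat_uniq => /and3P[u1 /hasPn h _]; split=> // x /h; apply: contraNneq => ->.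
    by rewrite /= inE mem_rcons mem_head orbT.
  split; [|by apply: u2; rewrite mem_head|by apply: u2; rewrite !inE eqxx orbT].
  by move: u1 => /= /andP[+ _]; apply: contraNneq => ->; rewrite mem_rcons mem_head.
have F0E H : H \in H0 :: gs -> {in gverts H &, forall x y, F0 x y = ladder (gA H) (gB H) x y}.
  move=> HG x y xH yH.
  have E u w : u \in gverts H -> w \in gverts H ->
      ((u, w) \in prs L) && a (u, w) = ((u, w) \in prs (gA H)) || ((u, w) \in prs (gB H)).
    move=> uH wH; apply/andP/idP => [[uw _]|uw].
      by have := adjL H HG u w uH wH uw; rewrite mem_cat.
    split; first by apply: (pcs H HG); rewrite mem_cat.
    apply: (notZ H) => //; case/orP: uw => uw.
      apply/eqP => uz; apply: (@prs_last _ (gu H) w (rcons (gM H) (gz H))).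
        by have := swu H HG; rewrite /gverts cat_uniq => /and3P[].
      by rewrite last_rcons; move: uw; rewrite [u]uz.
    by move: uw; rewrite /gB prs_cons2 !inE => /eqP[-> _]; case: (ne_z H HG).
  by rewrite /F0 /kept !E // /ladder /adj orbACA.
have AL : V2 \subset Lam by apply/subsetP => x /V2L; rewrite LamE.
have AK : [disjoint V2 & K].
  rewrite disjoint_sym; apply/pred0P => x /=; rewrite inE; apply/negP => /andP[/vsP[H HG xH]].
  by apply/negP; apply: V23; apply: (gsV H).
have sp0 : spanning e Lam V2 K F0 F0.
  split=> //; first exact: kept_sym.
  - move=> x y xy; apply: (@adj_sub _ _ se L) => //.
    by case/orP: xy => /andP[xy _]; rewrite /adj xy ?orbT.
  - by move=> x y; rewrite LamE => /orP[]/andP[/prs_mem[]].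
  (* Walking forward from any vertex stops at a cut or at the end of [L]; both are vertices [gz] and
     hence marked. *)
  - move=> v; rewrite LamE => /(kept_connect a (gz H0))[u [vu uL' h]]; exists u => //.
    rewrite inE; case: h => [->|[y _]].
      rewrite lastL; apply: (invs H0); first exact: mem_head.
      by case: (mem_gadget H0).
    rewrite /a negbK /= => /ZcP[H Hg ->]; apply: (invs H); first by rewrite inE Hg orbT.
    by case: (mem_gadget H).
have val0 v : valency F0 v <= 2 by apply: kept_valency.
have bal0 : \sum_(v in Lam) (2 - valency F0 v) = 2 * (nel e c1).+1.
  have E : \sum_(v in Lam) (2 - valency F0 v) + \sum_v valency F0 v = 2 * size L.
    rewrite [X in _ + X](bigID (mem Lam)) /= [X in _ + (_ + X)]big1 ?addn0 => [|v].
      rewrite -big_split /= (eq_bigr (fun=> 2)) => [|v _]; last by rewrite subnK.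
      by rewrite sum_nat_const mulnC -(card_uniqP uL); congr (2 * _); apply: eq_card => x; rewrite LamE.
    move=> vL; apply: eq_card0 => x; rewrite !inE; apply: contraNF vL => /(sp_supp sp0).
    by [].
  have := kept_sum a uL; rewrite -/F0 => E2.
  have L0 : gz H0 \in L.
    by apply: (gsL H0); [exact: mem_head|case: (mem_gadget H0)].
  have E3 : count a (prs L) + count (predC a) (prs L) = (size L).-1.
    by rewrite count_predC /prs size_zip size_behead (minn_idPr (leq_pred _)).
  have E4 : count (predC a) (prs L) = nel e c1.
    have [x [P EL]] : exists x P, L = x :: P by case: (L) L0 => // x P _; exists x, P.
    have -> : count (predC a) (prs L) = count (mem Zc) (belast x P).
      have <- : map fst (prs L) = belast x P.
        by rewrite EL; elim: P x {EL} => // y P IH x; rewrite prs_cons2 /= IH.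
      by rewrite count_map; apply: eq_count => p; rewrite /a /= negbK.
    have ub : uniq (belast x P).
      by move: uL; rewrite EL lastI rcons_uniq => /andP[].
    rewrite -szZ -size_filter; apply: perm_size; apply: uniq_perm => //; first exact: filter_uniq.
    move=> z; rewrite mem_filter /=; case: (boolP (z \in Zc)) => //= /ZcP[H Hg ->].
    have HG : H \in H0 :: gs by rewrite inE Hg orbT.
    have zL : gz H \in L by apply: (gsL H HG); case: (mem_gadget H).
    move: zL; rewrite EL lastI mem_rcons inE => /orP[/eqP E5|//].
    have E6 : gz H = gz H0 by rewrite E5 -lastL EL.
    have HH : H = H0.
      have [_ zH _ _] := mem_gadget H; have [_ zH0 _ _] := mem_gadget H0.
      by apply: (disj H H0 (gz H)) => //; rewrite ?mem_head ?E6.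
    move: ug; rewrite /vs -HH map_cons.
    have -> : flatten (gverts H :: [seq gverts i | i <- gs]) = gverts H ++ flatten [seq gverts i | i <- gs] by [].
    rewrite cat_uniq => /and3P[_ /hasPn/(_ (gz H)) h _]; exfalso.
    have [_ zH _ _] := mem_gadget H; move: h; rewrite /= zH => h.
    suff : gz H \in flatten [seq gverts i | i <- gs] by move/h.
    by apply/flattenP; exists (gverts H); rewrite ?map_f.
  have sL0 : 0 < size L by case: (L) L0.
  by move: E E2 E3 E4 sL0; clear; lia.
have few : 48 * kap * (nel e c1).+1 <= #|T|.
  have h1 : (nel e c1).+1 * g ^ 8 <= 2 * #|T|.
    have : g ^ 8 <= #|T| by apply: leq_trans n_ge; rewrite leq_pexp2l.
    move: r1; move: (g ^ 8) (nel e c1) #|T|; clear => q k n h1 h2.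
    by rewrite (mulSn k) mulSn mul1n addnC leq_add.
  have h2 : 2 * (48 * kap) <= g ^ 8.
    by apply: leq_trans (leq_pexp2l g0 (isT : 1 <= 8)); rewrite expn1; move: kap_ge g_ge; clear; lia.
  have := leq_mul (leqnn (nel e c1).+1) h2 => /leq_trans/(_ h1).
  by move: (nel e c1) => k; clear; lia.
have [R [sR Re two mR RF]] := two_factor G kap_ge g_ge n3 degL deg2 AL AK c1E uc1 mc1 few sp0 val0 bal0.
have RE H : H \in H0 :: gs -> {in gverts H &, forall x y, R x y = ladder (gA H) (gB H) x y}.
  move=> HG x y xH yH; rewrite -(F0E H HG) //; apply: RF; rewrite ?LamE ?(gsL H) ?V23 ?(gsV H) //.
have [R1 [sR1 R1e two1 c1R uvR]] := merge_all se ie sR Re two sw ug RE.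
have cR1 := sym_connect_sym sR1.
(* The connection from [gv H] to [gu H'] contains no cut and lies in the third zone, away from all
   pivots, so it survives the linking. *)
have linkR H H' : (H, H') \in prs (H0 :: gs) -> connect R (gv H) (gu H').
  move=> /[dup] /prs_mem[HG HG'] /link[c cV sub].
  have pathR x P : (forall p, p \in prs (x :: P) -> R p.1 p.2) -> path R x P.
    elim: P x => //= y P IH x h; rewrite (h (x, y)) ?prs_cons2 ?mem_head //=.
    by apply: IH => p pp; apply: h; rewrite prs_cons2 inE pp orbT.
  apply/connectP; exists (rcons c (gu H')); rewrite ?last_rcons //; apply: pathR => -[x y] xy /=.
  have xyL : (x, y) \in prs L.
    apply: sub; have -> : gB H ++ c ++ gA H' = ([:: gz' H] ++ (gv H :: rcons c (gu H'))) ++ rcons (gM H') (gz H').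
      by rewrite /gB /gA /= cat_rcons.
    by apply: (prs_catS _ _).1; apply: (prs_catS _ _).2.
  have [xL yL] := prs_mem xyL; have [xc yc] := prs_mem xy.
  have V3c z : z \in gv H :: rcons c (gu H') -> z \in V3 /\ z \notin Zc.
    rewrite inE mem_rcons inE => /or3P[/eqP->|/eqP->|zc].
    - have [_ _ _ vH] := mem_gadget H; split; first exact: (gsV H).
      by apply: (notZ H) => //; case: (ne_z H HG).
    - have [uH _ _ _] := mem_gadget H'; split; first exact: (gsV H').
      by apply: (notZ H') => //; case: (ne_z H' HG').
    - have [z3 zv] := cV z zc; split=> //; apply: contra zv => /ZcP[K' Kg ->].
      by apply: (invs K'); [rewrite inE Kg orbT|case: (mem_gadget K')].
  have [x3 xZ] := V3c x xc; have [y3 _] := V3c y yc.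
  by rewrite RF ?LamE ?V23 // /F0 /kept xyL /a xZ.
have gadR H x : H \in H0 :: gs -> x \in gverts H -> connect R1 (gu H) x.
  move=> HG xH; have lad P y z : P = gA H \/ P = gB H -> z \in P -> y = head y P -> connect R y z.
    move=> PP zP hy; have PE : P = y :: behead P by case: P PP zP hy => // p P _ _ /= <-.
    have PH u : u \in P -> u \in gverts H by case: PP => -> uP; rewrite /gverts mem_cat uP ?orbT.
    apply: (@path_connect _ _ _ (behead P)); last by rewrite -PE.
    have := adj_path y (behead P); rewrite -PE => pp.
    apply: (sub_in_path (P := mem (gverts H)) _ _ pp); last by rewrite -PE; apply/allP.
    by move=> u w uH wH uw; rewrite (RE H HG) // /ladder; case: PP uw => -> ->; rewrite ?orbT.
  move: xH; rewrite mem_cat => /orP[xA|xB]; first by apply: c1R; apply: (lad (gA H)); auto.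
  have vB : gv H \in gB H by rewrite !inE eqxx orbT.
  have h1 : connect R1 (gz' H) x by apply: c1R; apply: (lad (gB H)); auto.
  have h2 : connect R1 (gz' H) (gv H) by apply: c1R; apply: (lad (gB H)); auto.
  by apply: connect_trans (uvR H HG) _; apply: connect_trans h1; rewrite cR1.
have chain H : H \in H0 :: gs -> connect R1 (gu H0) (gu H).
  have st H1 H2 : (H1, H2) \in prs (H0 :: gs) -> connect R1 (gu H1) (gu H2).
    move=> h; apply: connect_trans (c1R _ _ (linkR _ _ h)); apply: uvR.
    by case: (prs_mem h).
  move: st; elim: (gs) (H0) => [|H1 l IH] Hh st; first by rewrite inE => /eqP->.
  rewrite inE => /orP[/eqP->//|Hl]; apply: connect_trans (st Hh H1 _) (IH H1 _ Hl).
    by rewrite prs_cons2 mem_head.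
  by move=> A B h; apply: st; rewrite prs_cons2 inE h orbT.
have all1 v : connect R1 (gu H0) v.
  have [k + /c1R vk] := mR v; rewrite inE => /vsP[H HG kH].
  apply: connect_trans (chain H HG) _; apply: connect_trans (gadR H k HG kH) _.
  by rewrite cR1.
have iR1 : irreflexive R1 by move=> x; apply/negP => /R1e; rewrite ie.
have [p [up pT cp]] := hamilton_cycle sR1 iR1 two1
  (fun x y => connect_trans (etrans (cR1 _ _) (all1 x)) (all1 y)) (gu H0).
by exists p; split=> //; apply: sub_cycle cp.
Qed.

End Assemble.

(** * The local lemma *)

Section LocalLemma.
Variables (I X : finType) (bad : I -> {set X}) (nb : I -> {set I}) (D : nat).
Implicit Types (S : {set I}) (v : I).

Definition good S := [set x | [forall v in S, x \notin bad v]].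

(** Probabilities are counted outcomes: given that any events outside [nb v] are avoided, [bad v]
    has probability at most [1 / (4 * D)]. *)
Hypothesis indep : forall v S, [disjoint S & nb v] ->
  4 * D * #|bad v :&: good S| <= #|good S|.
Hypotheses (D_gt0 : 0 < D) (nb_le : forall v, #|nb v| <= D).

Lemma goodU v S : good (v |: S) = good S :\: bad v.
Proof.
apply/setP => x; rewrite !inE; apply/forallP/andP => [h|[xv /forallP h] w].
  split; first by have := h v; rewrite !inE eqxx.
  by apply/forallP => w; apply/implyP => wS; have := h w; rewrite !inE wS orbT.
by rewrite !inE; apply/implyP => /orP[/eqP->//|]; apply/implyP.
Qed.

Lemma goodS S S' : S \subset S' -> good S' \subset good S.
Proof.
move=> /subsetP SS; apply/subsetP => x; rewrite !inE => /forallP h; apply/forallP => v.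
by apply/implyP => /SS; apply/implyP.
Qed.

Lemma card_goodU v S : #|good (v |: S)| + #|bad v :&: good S| = #|good S|.
Proof. by rewrite goodU addnC setIC cardsID. Qed.

(* At most a 1/(2D) fraction of the outcomes that are good on [S] is bad at [v]:
   discarding the at most [D] events correlated with [v] at most doubles the good set. *)
Lemma bad_given_good v S : 2 * D * #|bad v :&: good S| <= #|good S|.
Proof using indep D_gt0 nb_le.
have [k] := ubnP #|S|; elim: k v S => // k IH v S; rewrite ltnS => cS.
have IH' w S0 : S0 \proper S -> 2 * D * #|bad w :&: good S0| <= #|good S0|.
  by move=> /proper_card h; apply: IH; apply: leq_trans h cS.
have dj : [disjoint S :\: nb v & nb v].
  by rewrite -setI_eq0; apply/eqP/setP => x; rewrite !inE; case: (x \in nb v); rewrite ?andbF.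
have h0 := indep dj.
suff h1 : #|good (S :\: nb v)| <= 2 * #|good S|.
  have : #|bad v :&: good S| <= #|bad v :&: good (S :\: nb v)|.
    by apply/subset_leq_card/setIS/goodS/subsetDl.
  by move: h0 h1; nia.
have step (Y : {set I}) : Y \subset S :&: nb v ->
    2 * D * #|good (S :\: nb v)| <= 2 * D * #|good (Y :|: (S :\: nb v))| + #|Y| * #|good (S :\: nb v)|.
  move: {2}#|Y| (erefl #|Y|) => m; elim: m Y => [|m IHm] Y cY YS.
    by rewrite (cards0_eq cY) set0U cards0 addn0.
  have /card_gt0P[w wY] : 0 < #|Y| by rewrite cY.
  have cY' : #|Y :\ w| = m by have := cardsD1 w Y; rewrite wY cY; lia.
  have Y'S : Y :\ w \subset S :&: nb v by apply: subset_trans YS; apply: subsetDl.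
  have := IHm _ cY' Y'S; rewrite cY'.
  have -> : Y :|: (S :\: nb v) = w |: (Y :\ w :|: (S :\: nb v)) by rewrite setUA setD1K.
  have := card_goodU w (Y :\ w :|: (S :\: nb v)).
  have : 2 * D * #|bad w :&: good (Y :\ w :|: (S :\: nb v))| <= #|good (Y :\ w :|: (S :\: nb v))|.
    apply: IH'; apply/properP; split.
      by rewrite subUset subsetDl andbT (subset_trans Y'S) ?subsetIl.
    have := subsetP YS w wY; rewrite inE => /andP[wS wn]; exists w => //.
    by rewrite !inE eqxx wn.
  have := subset_leq_card (goodS (subsetUr (Y :\ w) (S :\: nb v))).
  rewrite cY; move: #|good _| #|good _| #|good _| #|_ :&: _| => a b c f; nia.
have := step _ (subxx _).
have -> : (S :&: nb v) :|: (S :\: nb v) = S by apply: setID.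
have : #|S :&: nb v| <= D by apply: leq_trans (nb_le v); apply/subset_leq_card/subsetIr.
move: #|S :&: nb v| #|good _| #|good _| => a c b h1 h2.
have h3 : a * b <= D * b by rewrite leq_mul2r h1 orbT.
have : D * b <= D * (2 * c) by move: h2 h3; rewrite -!mulnA [D * (2 * c)]mulnCA; clear; lia.
by rewrite leq_pmul2l.
Qed.

Lemma local_lemma : 0 < #|X| -> exists x, forall v, x \notin bad v.
Proof using indep D_gt0 nb_le.
move=> X0; suff /card_gt0P[x] : 0 < #|good [set: I]|.
  by rewrite inE => /forallP h; exists x => v; have := h v; rewrite inE.
move: {2}#|[set: I]| (leqnn #|[set: I]|) => k.
have : 0 < #|good set0|.
  have -> : good set0 = setT by apply/setP => x; rewrite !inE; apply/forallP => v; rewrite inE.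
  by rewrite cardsT.
move=> g0; suff H S : 0 < #|good S| by rewrite H.
move: {2}#|S| (erefl #|S|) => m; elim: m S => [|m IH] S cS; first by rewrite (cards0_eq cS).
have /card_gt0P[w wS] : 0 < #|S| by rewrite cS.
have cS' : #|S :\ w| = m by have := cardsD1 w S; rewrite wS cS; lia.
have := IH _ cS'; have := bad_given_good w (S :\ w); have := card_goodU w (S :\ w).
by rewrite setD1K //; nia.
Qed.

End LocalLemma.

(** * A random partition into three zones *)

Section Zones.
Variables (T : finType) (e : rel T) (d : nat).
Hypotheses (se : symmetric e) (reg : forall x, #|[set y | e x y]| = d) (d_ge : 96 <= d).
Notation coloring := {ffun T -> 'I_3}.
Implicit Types (f h k : coloring) (v w : T) (i : 'I_3) (A B : {set coloring}) (N : {set T}).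

Definition rare v i := [set f : coloring | 16 * #|[set w | e v w & f w == i]| < d].

(** Exchanging the values of a pair of colorings outside [N] maps [(A :&: B)] times all colorings
    injectively into [A] times [B]. This is the product rule for events that depend on disjoint sets
    of vertices. *)
Lemma card_indep N A B :
  (forall f h, {in N, f =1 h} -> (f \in A) = (h \in A)) ->
  (forall f h, {in ~: N, f =1 h} -> (f \in B) = (h \in B)) ->
  #|A :&: B| * #|{: coloring}| <= #|A| * #|B|.
Proof.
move=> hA hB; pose mix f h : coloring := [ffun w => if w \in N then f w else h w].
pose phi (p : coloring * coloring) := (mix p.1 p.2, mix p.2 p.1).
have inj : injective phi.
  move=> [f h] [f' h'] [/ffunP E1 /ffunP E2].
  have E w : f w = f' w /\ h w = h' w.
    by have := E1 w; have := E2 w; rewrite !ffunE; case: (w \in N).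
  by congr (_, _); apply/ffunP => w; case: (E w).
rewrite -cardsT -!cardsX -(card_imset _ inj); apply: subset_leq_card; apply/subsetP => q.
case/imsetP => -[f h]; rewrite !inE andbT => /andP[fA fB] -> /=.
rewrite (hA _ f) ?fA ?(hB _ f) ?fB // => w wN; rewrite ffunE; first by rewrite inE in wN; rewrite (negbTE wN).
by rewrite wN.
Qed.

(** Exponential moments: each neighbour of [v] with a colour other than [i] weighs 2. The total
    weight factors into 5 per neighbour and 3 per other vertex, while a rare coloring weighs at
    least [2 ^ (d - d %/ 16)]. *)
Lemma rare_weight v i : #|rare v i| * 2 ^ (d - d %/ 16) <= 5 ^ d * 3 ^ (#|T| - d).
Proof.
pose wt w (c : 'I_3) := if e v w && (c != i) then 2 else 1.
have sumE : \sum_(f : coloring) \prod_w wt w (f w) = 5 ^ d * 3 ^ (#|T| - d).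
  rewrite -(bigA_distr_bigA wt) (bigID (fun w => e v w)) /=.
  rewrite (eq_bigr (fun=> 5)) => [|w vw]; last first.
    rewrite /wt vw (bigD1 i) //= eqxx /= (eq_bigr (fun=> 2)) => [|c ->] //.
    by rewrite sum_nat_const; have := cardC1 i; rewrite card_ord => ->.
  rewrite [X in _ * X](eq_bigr (fun=> 3)) => [|w vw]; last first.
    by rewrite /wt (negbTE vw) sum_nat_const card_ord.
  rewrite !prod_nat_const; congr (5 ^ _ * 3 ^ _); first by rewrite -(reg v); apply: eq_card => w; rewrite inE.
  have := cardC (e v); have := reg v; rewrite cardsE => -> <-; rewrite addKn.
  by apply: eq_card => w; rewrite !inE.
rewrite -sumE.
apply: leq_trans (_ : \sum_(f in rare v i) \prod_w wt w (f w) <= _); last first.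
  by rewrite [X in _ <= X](bigID (mem (rare v i))) leq_addr.
rewrite -sum_nat_const; apply: leq_sum => f; rewrite inE => few.
have -> : \prod_w wt w (f w) = 2 ^ #|[set w | e v w & f w != i]|.
  by rewrite /wt -big_mkcond prod_nat_const; congr (2 ^ _); apply: eq_card => w; rewrite inE.
rewrite leq_exp2l //.
have := cardsID [set w | f w == i] [set w | e v w]; rewrite reg.
have -> : [set w | e v w] :&: [set w | f w == i] = [set w | e v w & f w == i].
  by apply/setP => w; rewrite !inE.
have -> : [set w | e v w] :\: [set w | f w == i] = [set w | e v w & f w != i].
  by apply/setP => w; rewrite !inE andbC.
move: few; move: #|_| #|_| => a b; clear; lia.
Qed.

Lemma rare_prob v i : #|rare v i| * 9 ^ (d %/ 16) <= #|{: coloring}|.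
Proof.
have dT : d <= #|T| by rewrite -(reg v) max_card.
rewrite card_ffun card_ord.
have -> : 3 ^ #|T| = 3 ^ d * 3 ^ (#|T| - d) by rewrite -expnD subnKC.
have h := rare_weight v i; set t := d %/ 16 in h *.
pose r := d %% 16.
have dE : d = 16 * t + r by rewrite mulnC -divn_eq.
have bd b : b ^ d = (b ^ 16) ^ t * b ^ r by rewrite {1}dE expnD expnM.
have key : 9 ^ t * 5 ^ d <= 3 ^ d * 2 ^ (d - t).
  have -> : d - t = 15 * t + r by rewrite {1}dE; clear; lia.
  (* Each 16 neighbours contribute [(5/3)^16 / 2^15], which is just below [1/9]. *)
  have h16 : 9 * 5 ^ 16 <= 3 ^ 16 * 2 ^ 15 by clear; lia.
  rewrite !bd expnD expnM; move: (5 ^ 16) (3 ^ 16) (2 ^ 15) h16 => B A C h16.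
  rewrite mulnA -expnMn mulnACA -!expnMn leq_mul //; first by case: (t) => // t'; rewrite leq_exp2r.
  by case: (r) => // r'; rewrite leq_exp2r.
have p : 0 < 2 ^ (d - t) * 5 ^ d by rewrite muln_gt0 !expn_gt0.
rewrite -(leq_pmul2r p).
have arith (z u a b c w : nat) : z * u <= b * w -> a * b <= c * u -> z * a * (u * b) <= c * w * (u * b).
  move=> h1 h2; have := leq_mul h1 h2.
  have -> : z * u * (a * b) = z * a * (u * b) by lia.
  by have -> : b * w * (c * u) = c * w * (u * b) by lia.
exact: arith h key.
Qed.

Lemma square_le_pow t : 6 <= t -> 12 * (16 * t.+1) ^ 2 <= 9 ^ t.
Proof.
move=> ht; have h : 56 * t.+1 <= 3 ^ t.
  rewrite -(subnKC ht); elim: (t - 6) => [|k IH]; first by [].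
  by rewrite addnS expnS; move: IH; move: (3 ^ _); lia.
have -> : 9 ^ t = (3 ^ t) ^ 2 by rewrite -expnM mulnC expnM.
by rewrite !expnS !expn0 !muln1; apply: leq_trans (leq_mul h h); lia.
Qed.

(** The event at [v] depends on the colours of its neighbours only, so it is independent of all but
    at most [d ^ 2] events, those at vertices with a common neighbour. Its probability is at most
    [3 / 9 ^ (d %/ 16)], which for [d >= 96] is at most [1 / (4 * d ^ 2)]. *)
Lemma zones_exist : 0 < #|T| -> exists Z1 Z2 Z3 : {set T},
  [/\ forall x, d <= 16 * dg e x Z1, forall x, d <= 16 * dg e x Z2, forall x, d <= 16 * dg e x Z3 &
    [/\ [disjoint Z1 & Z2], [disjoint Z1 & Z3] & [disjoint Z2 & Z3]]].
Proof.
move=> T0; pose bad v := [set f : coloring | [exists i, f \in rare v i]].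
pose nb v := [set u | [exists w, e v w && e u w]].
have nb_le v : #|nb v| <= d * d.
  have -> : nb v = \bigcup_(w in [set w | e v w]) [set u | e w u].
    apply/setP => u; rewrite inE; apply/existsP/bigcupP => [[w /andP[vw uw]]|[w]].
      by exists w; rewrite inE // se.
    by rewrite !inE => vw wu; exists w; rewrite vw se.
  have : \sum_(w in [set w | e v w]) #|[set u | e w u]| = d * d.
    by rewrite (eq_bigr (fun=> d)) ?sum_nat_const ?reg.
  move<-; apply: (big_ind2 (fun (X : {set T}) n => #|X| <= n)) => // [|X a Y b Xa Yb].
    by rewrite cards0.
  by apply: leq_trans (leq_add Xa Yb); apply: leq_card_setU.
have X0 : 0 < #|{: coloring}| by rewrite card_ffun card_ord expn_gt0.
have bad_le v : 4 * (d * d) * #|bad v| <= #|{: coloring}|.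
  have h1 : #|bad v| <= \sum_i #|rare v i|.
    have -> : bad v = \bigcup_i rare v i.
      by apply/setP => f; rewrite inE; apply/existsP/bigcupP => [[i fi]|[i _ fi]]; exists i.
    apply: (big_ind2 (fun (X : {set coloring}) n => #|X| <= n)) => // [|X a Y b Xa Yb].
      by rewrite cards0.
    by apply: leq_trans (leq_add Xa Yb); apply: leq_card_setU.
  have h2 : (\sum_i #|rare v i|) * 9 ^ (d %/ 16) <= 3 * #|{: coloring}|.
    have -> : 3 * #|{: coloring}| = \sum_(i < 3) #|{: coloring}| by rewrite sum_nat_const card_ord.
    by rewrite big_distrl /=; apply: leq_sum => i _; apply: rare_prob.
  have h3 : 12 * (d * d) <= 9 ^ (d %/ 16).
    have t6 : 6 <= d %/ 16 by rewrite leq_divRL.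
    apply: leq_trans (square_le_pow t6); rewrite leq_mul2l expnS expn1 /=.
    by have dl : d <= 16 * (d %/ 16).+1; [rewrite mulnC ltnW // ltn_ceil|apply: leq_mul].
  have := leq_trans (leq_mul h1 h3) h2; move: #|bad v| (d * d) #|{: coloring}|; clear; lia.
have indep v (S : {set T}) : [disjoint S & nb v] -> 4 * (d * d) * #|bad v :&: good bad S| <= #|good bad S|.
  move=> dis; pose N := [set w | e v w].
  have rareE u i f h : {in [set w | e u w], f =1 h} -> (f \in rare u i) = (h \in rare u i).
    move=> fh; rewrite !inE; congr (16 * #|pred_of_set _| < d); apply/setP => w; rewrite !inE.
    by case: (boolP (e u w)) => //= uw; rewrite fh ?inE.
  have badE u f h : {in [set w | e u w], f =1 h} -> (f \in bad u) = (h \in bad u).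
    by move=> fh; rewrite ![_ \in bad u]inE; apply: eq_existsb => i; apply: rareE.
  have goodE f h : {in ~: N, f =1 h} -> (f \in good bad S) = (h \in good bad S).
    move=> fh; rewrite ![_ \in good bad S]inE; apply: eq_forallb => u.
    case: (boolP (u \in S)) => //= uS.
    congr (~~ _); apply: badE => w; rewrite inE => uw; apply: fh; rewrite !inE.
    have : u \notin nb v by rewrite (disjointFr dis uS).
    by rewrite inE; apply: contra => vw; apply/existsP; exists w; rewrite vw uw.
  have ind := @card_indep N (bad v) (good bad S) (badE v) goodE.
  have arith (q a b c n : nat) : 0 < n -> b * n <= a * c -> q * a <= n -> q * b <= c.
    move=> n0 h1 h2; rewrite -(leq_pmul2r n0) -mulnA.
    apply: leq_trans (leq_mul (leqnn q) h1) _.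
    by rewrite mulnA [c * n]mulnC leq_mul2r h2 orbT.
  exact: arith X0 ind (bad_le v).
have d2 : 0 < d * d by rewrite muln_gt0; move: d_ge; clear; lia.
have [f hf] := local_lemma indep d2 nb_le X0.
pose Z (k : nat) := [set w | f w == inord k :> 'I_3].
have degZ (k : nat) x : d <= 16 * dg e x (Z k).
  rewrite leqNgt; apply/negP => few; case/negP: (hf x).
  rewrite inE; apply/existsP; exists (inord k); rewrite inE; apply: leq_ltn_trans few.
  by rewrite leq_mul2l /=; apply: subset_leq_card; apply/subsetP => w; rewrite !inE andbC.
have disZ (k l : nat) : k < 3 -> l < 3 -> k != l -> [disjoint Z k & Z l].
  move=> k3 l3 kl; apply/pred0P => w; rewrite /= !inE; apply/negP => /andP[/eqP-> /eqP/(congr1 val)].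
  by rewrite /= !inordK // => /eqP; apply/negP.
by exists (Z 0), (Z 1), (Z 2); split=> //; split; apply: disZ.
Qed.
End Zones.

From mathcomp Require Import all_boot all_order all_algebra.
From mathcomp Require Import sesquilinear spectral complex.
Import Order.TTheory GRing.Theory Num.Theory.
Local Open Scope ring_scope.

(** * The expander mixing lemma *)

Section SpectralGap.
Local Open Scope sesquilinear_scope.
Variable C : numClosedFieldType.
Implicit Types (n : nat).

Definition sqnorm n (u : 'rV[C]_n) : C := \sum_i `|u 0 i| ^+ 2.

Lemma sqnormE n (u : 'rV[C]_n) : sqnorm u = (u *m u^t*) 0 0.
Proof. by rewrite !mxE; apply: eq_bigr => i _; rewrite !mxE normCK. Qed.

Lemma sqnorm_unitary n (u : 'rV[C]_n) (P : 'M[C]_n) : P \is unitarymx -> sqnorm (u *m P) = sqnorm u.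
Proof. by move=> uP; rewrite !sqnormE trmx_mul map_mxM mulmxA mulmxtVK. Qed.

Lemma char_poly_similar n (P A : 'M[C]_n) : P \in unitmx ->
  char_poly (invmx P *m A *m P) = char_poly A.
Proof.
move=> uP; rewrite /char_poly.
have -> : char_poly_mx (invmx P *m A *m P) =
    map_mx polyC (invmx P) *m char_poly_mx A *m map_mx polyC P.
  rewrite /char_poly_mx mulmxBr mulmxBl -!map_mxM; congr (_ - _).
  by rewrite scalar_mxC -mulmxA -map_mxM mulVmx // map_mx1 mulmx1.
rewrite !det_mulmx mulrAC -det_mulmx -map_mxM mulVmx //.
by rewrite map_mx1 det1 mul1r.
Qed.

(** The order of [s] says nothing about the spectral diagonal. But the constant vector has a
    non-zero coordinate at some [i0], whose eigenvalue is [d > lam]; since at most one entry of [s]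
    exceeds [lam] in absolute value, all other eigenvalues are bounded by [lam]. The constant vector
    is then supported on [i0], so a vector orthogonal to it has coordinate 0 there. *)
Lemma spectral_gap n (A : 'M[C]_n) (d lam : C) (s : seq C) (x : 'rV[C]_n) :
  A \is hermsymmx -> char_poly A = \prod_(a <- s) ('X - a%:P) ->
  {in behead s, forall a, `|a| <= lam} -> 0 <= lam -> lam < d ->
  const_mx 1 *m A = d *: const_mx 1 :> 'rV[C]_n -> \sum_i x 0 i = 0 ->
  sqnorm (x *m A) <= lam ^+ 2 * sqnorm x.
Proof.
move=> hA cp gap lam0 ld one x0.
have /orthomx_spectralP EA := hermitian_normalmx hA.
set P := spectralmx A in EA; set D := spectral_diag A in EA.
have uP : P \is unitarymx := spectral_unitarymx A.
have uP' : P \in unitmx := spectral_unit A.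
have iP := invmx_unitary uP.
have [->|xn0] := eqVneq x 0.
  by rewrite mul0mx /sqnorm !big1 ?mulr0 // => i _; rewrite mxE normr0 expr0n.
have ps : perm_eq [seq D 0 i | i <- enum 'I_n] s.
  apply: prod_XsubC_eq; rewrite -cp EA char_poly_similar //.
  rewrite char_poly_trig ?diag_mx_is_trig // big_map big_enum /=.
  by apply: eq_bigr => i _; rewrite mxE eqxx.
have mulD (z : 'rV[C]_n) i : (z *m diag_mx D) 0 i = z 0 i * D 0 i.
  rewrite mxE (bigD1 i) //= big1 ?addr0 => [|k ki]; first by rewrite mxE eqxx mulr1n.
  by rewrite mxE (negbTE ki) mulr0n mulr0.
have tE (z : 'rV[C]_n) i : (z^t*) i 0 = (z 0 i)^* by rewrite !mxE.
pose z1 : 'rV[C]_n := const_mx 1 *m P^t*.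
have z1P : z1 *m P = const_mx 1 by rewrite /z1 -iP mulmxKV.
have z1D i : z1 0 i * (D 0 i - d) = 0.
  have /rowP/(_ i) : z1 *m diag_mx D = d *: z1.
    rewrite /z1 scalemxAl -one [X in _ = _ *m X *m _]EA -iP !mulmxA mulmxK //.
  rewrite mulD mulrBr => ->.
  by rewrite [X in X - _]mxE mulrC subrr.
have [i0 zi0] : exists i0, z1 0 i0 != 0.
  apply/existsP; apply: contraTT xn0; rewrite negb_exists => /forallP z0.
  have E : z1 = 0 by apply/rowP => i; rewrite [RHS]mxE; apply/eqP; have := z0 i; rewrite negbK.
  rewrite negbK; apply/eqP/rowP => i; have /rowP/(_ i) := z1P.
  by rewrite E mul0mx !mxE => /eqP; rewrite eq_sym oner_eq0.
have Di0 : D 0 i0 = d.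
  by apply/eqP; rewrite -subr_eq0; have /eqP := z1D i0; rewrite mulf_eq0 (negbTE zi0).
have small i : i != i0 -> `|D 0 i| <= lam.
  move=> ii0; apply: contraT => big.
  pose B := fun a : C => ~~ (`|a| <= lam).
  have : (count B s <= 1)%N.
    case: (s) gap => //= a s' gap; rewrite -[1%N]addn0 leq_add ?leq_b1 //.
    by rewrite leqn0 -leqn0 leqNgt -has_count; apply/hasPn => b /gap bl; rewrite /B negbK.
  rewrite -(permP ps) count_map.
  have -> : count (preim (fun k => D ord0 k) B) (enum 'I_n) = #|[pred k | B (D ord0 k)]|.
    by rewrite -sum1_count big_enum_cond -sum1_card; apply: eq_bigl.
  have : (#|[set i; i0]| <= #|[pred k | B (D ord0 k)]|)%N.
    apply: subset_leq_card; apply/subsetP => k; rewrite !inE => /orP[]/eqP->; rewrite /B //.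
    rewrite Di0 ger0_norm ?(le_trans lam0 (ltW ld)) // lt_geF //.
  by rewrite cards2 ii0 => h1 h2; have := leq_trans h1 h2.
have z1_0 i : i != i0 -> z1 0 i = 0.
  move=> /small Di; apply/eqP; have /eqP := z1D i; rewrite mulf_eq0 => /orP[//|].
  rewrite subr_eq0 => /eqP E; move: Di; rewrite E ger0_norm ?(le_trans lam0 (ltW ld)) //.
  by rewrite lt_geF.
pose z := x *m P^t*.
have zP : x = z *m P by rewrite /z -iP mulmxKV.
have zi : z 0 i0 = 0.
  have : (z *m z1^t*) 0 0 = 0.
    rewrite /z /z1 trmx_mul map_mxM trmxCK mulmxA -[x *m _ *m _]mulmxA -iP mulVmx // mulmx1.
    rewrite mxE -[RHS]x0; apply: eq_bigr => i _; by rewrite !mxE rmorph1 mulr1.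
  rewrite mxE (bigD1 i0) //= big1 ?addr0 => [|i /z1_0 E]; last by rewrite tE E rmorph0 mulr0.
  by move/eqP; rewrite tE mulf_eq0 conjC_eq0 (negbTE zi0) orbF => /eqP.
have -> : x *m A = (z *m diag_mx D) *m P.
  by rewrite {1}zP EA !mulmxA mulmxK.
rewrite (sqnorm_unitary _ uP) [in leRHS]zP (sqnorm_unitary _ uP) /sqnorm mulr_sumr.
apply: ler_sum => i _; rewrite mulD normrM exprMn mulrC.
have [->|/small Di] := eqVneq i i0; first by rewrite zi normr0 expr0n !mulr0.
rewrite ler_wpM2r ?exprn_ge0 // lerXn2r ?nnegrE ?normr_ge0 //.
Qed.

End SpectralGap.

From mathcomp Require Import all_classical all_reals all_analysis.
From mathcomp Require Import ring lra.
Import Order.TTheory GRing.Theory Num.Theory.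

Section Mixing.
Variables (R : realType) (n d : nat) (lam : R) (e : rel 'I_n).
Hypotheses (n0 : (0 < n)%N) (lam0 : 0 < lam) (lam_d : lam < d%:R) (ndl : @ndl_graph R n d lam e).
Local Notation A := (adj_mx R e).
Local Notation toC := (real_complex R).

Let se : symmetric e. Proof. by case: ndl => -[]. Qed.
Let reg : regular e d. Proof. by case: ndl. Qed.

Lemma sum_adj (X : {set 'I_n}) j : \sum_(i in X) A i j = (dg e j X)%:R.
Proof.
rewrite /dg -sum1_card natr_sum big_mkcond [RHS]big_mkcond /=; apply: eq_bigr => i _.
by rewrite !inE mxE se; case: (i \in X); case: (e j i).
Qed.

Lemma col_sum j : \sum_i A i j = d%:R.
Proof.
rewrite -(reg j) -sum1_card natr_sum [RHS]big_mkcond; apply: eq_bigr => i _.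
by rewrite mxE inE se; case: (e j i).
Qed.

Lemma norm_real_complex (r : R) : `|(r%:C)%C| = (`|r|%:C)%C :> R[i].
Proof. by rewrite normc_def /= expr0n addr0 sqrtr_sqr. Qed.

Lemma real_spectral_gap (x : 'rV[R]_n) : \sum_i x 0 i = 0 ->
  \sum_j (x *m A) 0 j ^+ 2 <= lam ^+ 2 * \sum_i x 0 i ^+ 2.
Proof.
move=> x0; case: ndl => _ _ [s [cp so s1]].
pose B := map_mx toC A.
have sq (y : 'rV[R]_n) : sqnorm (map_mx toC y) = toC (\sum_i y 0 i ^+ 2).
  rewrite /sqnorm rmorph_sum; apply: eq_bigr => i _ /=.
  by rewrite mxE norm_real_complex -rmorphXn /= real_normK ?num_real.
have hB : B \is hermsymmx.
  apply: realsym_hermsym.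
    apply/is_hermitianmxP/matrixP => i j.
    by rewrite !mxE expr0 mul1r se.
  by apply/mxOverP => i j; rewrite !mxE; case: (e i j); rewrite ?rmorph1 ?rmorph0 ?real1 ?real0.
have cpB : char_poly B = \prod_(a <- map toC s) ('X - a%:P).
  rewrite -map_char_poly cp rmorph_prod big_map; apply: eq_bigr => a _ /=.
  by rewrite rmorphB /= map_polyX map_polyC.
(* [behead] removes the entry of largest absolute value; by the order of [s], all the others are
   bounded by its second entry. *)
have gap : {in behead (map toC s), forall a, `|a| <= toC lam}.
  move=> a; rewrite behead_map => /mapP[b bs ->]; rewrite norm_real_complex lecR.
  move: so s1 bs; case: (s) => [|a0 [|a1 r]] //= /andP[_ pr] s1.
  rewrite inE => /orP[/eqP->//|br].
  have tr : transitive (fun x y : R => `|y| <= `|x|) by move=> u v w h1 h2; apply: le_trans h2 h1.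
  by have /allP/(_ b br) h := order_path_min tr pr; apply: le_trans h s1.
have one : const_mx 1 *m B = toC d%:R *: const_mx 1 :> 'rV[R[i]]_n.
  apply/rowP => j; rewrite !mxE mulr1 -(col_sum j) rmorph_sum /=.
  by apply: eq_bigr => i _; rewrite !mxE mul1r.
have X0 : \sum_i (map_mx toC x) 0 i = 0.
  rewrite (eq_bigr (fun i => toC (x 0 i))) => [|i _]; last by rewrite mxE.
  by rewrite -rmorph_sum x0 rmorph0.
have l0 : 0 <= toC lam by rewrite -(rmorph0 toC) lecR ltW.
have ld : toC lam < toC d%:R by rewrite ltcR.
by have := spectral_gap hB cpB gap l0 ld one X0; rewrite -map_mxM !sq -rmorphXn -rmorphM /= lecR.
Qed.

(** Cauchy-Schwarz, from the non-negative sum of squared deviations from the mean. *)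
Lemma sum_square (Y : {set 'I_n}) (u : 'I_n -> R) :
  (\sum_(j in Y) u j) ^+ 2 <= #|Y|%:R * \sum_(j in Y) u j ^+ 2.
Proof.
have [Y0|Y0] := posnP #|Y|; first by rewrite (cards0_eq Y0) !big_set0 cards0 expr0n mul0r.
have y0 : 0 < #|Y|%:R :> R by rewrite ltr0n.
set S := \sum_(j in Y) u j; pose m := S / #|Y|%:R.
have : 0 <= \sum_(j in Y) (u j - m) ^+ 2 by apply: sumr_ge0 => j _; apply: sqr_ge0.
have -> : \sum_(j in Y) (u j - m) ^+ 2 = \sum_(j in Y) u j ^+ 2 - S * m *+ 2 + #|Y|%:R * m ^+ 2.
  under eq_bigr => j _ do rewrite sqrrB.
  rewrite big_split sumrB /= sumr_const -[in RHS]mulr_natl; congr (_ - _ + _).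
    by rewrite sumrMnl -mulr_suml mulr_natl.
  by rewrite mulr_natl.
have mS : #|Y|%:R * m = S by rewrite /m mulrC divfK // gt_eqF.
have : #|Y|%:R * m ^+ 2 = S * m by rewrite expr2 mulrA mS.
move=> -> h; have := mulr_ge0 (ltW y0) h.
have -> : #|Y|%:R * (\sum_(j in Y) u j ^+ 2 - S * m *+ 2 + S * m) =
  #|Y|%:R * \sum_(j in Y) u j ^+ 2 - S ^+ 2.
  have : #|Y|%:R * (S * m) = S ^+ 2 by rewrite mulrCA mS expr2.
  by move: (S * m) => t h2; rewrite -h2; ring.
by rewrite subr_ge0.
Qed.

(** For [x] the indicator of [X] minus its mean, the deviation is the sum over [Y] of the entries of
    [x *m A]. Cauchy-Schwarz and the spectral gap bound it. *)
Lemma mixing (X Y : {set 'I_n}) :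
  ((edges e X Y)%:R - d%:R * #|X|%:R * #|Y|%:R / n%:R) ^+ 2 <= lam ^+ 2 * #|X|%:R * #|Y|%:R :> R.
Proof.
have nn : 0 < n%:R :> R by rewrite ltr0n.
pose a : R := #|X|%:R / n%:R.
pose x : 'rV[R]_n := \row_i ((i \in X)%:R - a).
have sX (Z : {set 'I_n}) : \sum_i (i \in Z)%:R = #|Z|%:R :> R.
  by rewrite -sum1_card natr_sum [RHS]big_mkcond; apply: eq_bigr => i _; case: (i \in Z).
have an : a * n%:R = #|X|%:R by rewrite /a divfK // gt_eqF.
have x0 : \sum_i x 0 i = 0.
  under eq_bigr => i _ do rewrite mxE.
  by rewrite sumrB sX sumr_const card_ord -(mulr_natr a) an subrr.
have x2 : \sum_i x 0 i ^+ 2 <= #|X|%:R.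
  have -> : \sum_i x 0 i ^+ 2 = #|X|%:R - a * #|X|%:R *+ 2 + a ^+ 2 * n%:R.
    under eq_bigr => i _ do rewrite mxE sqrrB.
    rewrite big_split sumrB /= sumr_const card_ord -(sX X); congr (_ - _ + _).
      by apply: eq_bigr => i _; case: (i \in X); rewrite ?expr1n ?expr0n.
    by rewrite sumrMnl -mulr_suml mulrC.
  by rewrite mulr_natr.
  have : a ^+ 2 * n%:R = a * #|X|%:R by rewrite expr2 -mulrA an.
  have : 0 <= a * #|X|%:R by rewrite !mulr_ge0 // invr_ge0 ltW.
  by move: (a * #|X|%:R) => t t0 ->; rewrite mulr2n; lra.
have xA j : (x *m A) 0 j = (dg e j X)%:R - a * d%:R.
  rewrite mxE; under eq_bigr => i _ do rewrite mxE mulrBl.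
  rewrite sumrB -mulr_sumr; congr (_ - a * _).
    rewrite -sum_adj [RHS]big_mkcond; apply: eq_bigr => i _.
    by case: (i \in X); rewrite ?mul1r ?mul0r.
  exact: col_sum.
have eE : \sum_(j in Y) (x *m A) 0 j = (edges e X Y)%:R - d%:R * #|X|%:R * #|Y|%:R / n%:R.
  under eq_bigr => j _ do rewrite xA.
  rewrite sumrB sumr_const -natr_sum; congr (_ - _); last by rewrite /a -mulr_natr; ring.
  congr (_%:R); rewrite /edges /dg.
  have cE (i : 'I_n) (Z : {set 'I_n}) : #|[set y in Z | e i y]| = (\sum_(y in Z) e i y)%N.
    rewrite -sum1_card big_mkcond [RHS]big_mkcond; apply: eq_bigr => y _; rewrite inE.
    by case: (y \in Z); case: (e i y).
  under eq_bigr => i _ do rewrite cE.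
  under [RHS]eq_bigr => i _ do rewrite cE.
  by rewrite exchange_big; apply: eq_bigr => i _; apply: eq_bigr => j _; rewrite se.
rewrite -eE; apply: le_trans (sum_square _ _) _.
rewrite mulrC ler_wpM2r //; apply: le_trans (_ : lam ^+ 2 * \sum_i x 0 i ^+ 2 <= _); last first.
  by rewrite ler_wpM2l // sqr_ge0.
apply: le_trans (real_spectral_gap x0).
rewrite [leRHS](bigID (mem Y)) /= lerDl sumr_ge0 // => j _; exact: sqr_ge0.
Qed.

End Mixing.

(** * From the eigenvalue condition to pseudorandomness *)

Section RegularGraph.
Variables (R : realType) (n d : nat) (lam : R) (e : rel 'I_n).
Hypotheses (n0 : (0 < n)%N) (lam0 : 0 < lam) (lam_d : lam < d%:R) (ndl : @ndl_graph R n d lam e).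

Let nn : 0 < n%:R :> R. Proof. by rewrite ltr0n. Qed.

(** Mixing for a single vertex, which spans no edge. It serves to turn a large [d / lam] into a
    large [n]. *)
Lemma degree_le : d%:R <= lam * n%:R.
Proof.
have [[se ie] _ _] := ndl; pose X := [set Ordinal n0].
have := @mixing R n d lam e n0 lam0 lam_d ndl X X.
have -> : edges e X X = 0%N.
  rewrite /edges big_set1 /dg; apply: eq_card0 => y; rewrite !inE.
  by apply/negP => /andP[/eqP->]; rewrite ie.
rewrite cards1 !mulr1 sub0r sqrrN => h.
have q0 : 0 <= d%:R / n%:R :> R by rewrite divr_ge0.
have : d%:R / n%:R <= lam by rewrite -ler_sqr ?nnegrE // ltW.
by rewrite ler_pdivrMr.
Qed.

(** If [Y] is small, the main term of the mixing lemma is at most [d * #|X| / 2048], half of what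
    the edges provide, so the deviation is at least [g * lam * #|X|]. If the edges are at most half
    of the main term, the deviation is at least the other half. Thus 2048 is twice [kap]. *)
Lemma pseudorandom_ndl g : 2048 * g%:R * lam <= d%:R -> pseudorandom e d (8 * 128) g.
Proof.
move=> hg; have [[se ie] reg _] := ndl.
have mix := @mixing R n d lam e n0 lam0 lam_d ndl.
have gl : 0 <= g%:R * lam by rewrite mulr_ge0 // ltW.
have l2 : 0 < lam ^+ 2 by rewrite exprn_gt0.
split=> // [X Y|X Y]; rewrite card_ord.
  move=> h; case: (leqP n (2 * (8 * 128) * #|Y|)) => hn; [by left|right].
  have [->|X0] := posnP #|X|; first by rewrite muln0.
  have x0 : 0 < #|X|%:R :> R by rewrite ltr0n.
  have h' : d%:R * #|X|%:R <= 8 * 128 * (edges e X Y)%:R :> R by rewrite -!natrM ler_nat.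
  have hn' : 2048 * #|Y|%:R <= n%:R :> R.
    apply: ltW; apply: le_lt_trans (_ : (2 * (8 * 128) * #|Y|)%:R < _); last by rewrite ltr_nat.
    by rewrite !natrM; lra.
  have := mix X Y; set w := _ - _ => M.
  have hq : d%:R * #|X|%:R * #|Y|%:R / n%:R <= d%:R * #|X|%:R / 2048 :> R.
    rewrite -(mulrA (d%:R * #|X|%:R)) ler_wpM2l ?mulr_ge0 // ler_pdivrMr //.
    by move: hn'; lra.
  have hw : g%:R * lam * #|X|%:R <= w.
    have h1 : 2048 * (g%:R * lam) * #|X|%:R <= d%:R * #|X|%:R.
      by rewrite ler_wpM2r // mulrA.
    by rewrite /w; move: h' hq h1; move: (d%:R * #|X|%:R * #|Y|%:R / n%:R) => q; lra.
  have : (g%:R * lam * #|X|%:R) ^+ 2 <= lam ^+ 2 * #|X|%:R * #|Y|%:R.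
    have p0 : 0 <= g%:R * lam * #|X|%:R by rewrite mulr_ge0.
    by apply: le_trans M; rewrite lerXn2r ?nnegrE ?p0 ?(le_trans p0 hw).
  have -> : (g%:R * lam * #|X|%:R) ^+ 2 = lam ^+ 2 * #|X|%:R * (g%:R ^+ 2 * #|X|%:R) by ring.
  by rewrite ler_pM2l ?mulr_gt0 // -natrX -natrM ler_nat.
move=> h; have [E|XY0] := posnP (#|X| * #|Y|); first by rewrite -mulnA E muln0.
have xy0 : 0 < #|X|%:R * #|Y|%:R :> R by rewrite -natrM ltr0n.
have h' : 2 * n%:R * (edges e X Y)%:R <= d%:R * #|X|%:R * #|Y|%:R :> R by rewrite -!natrM ler_nat.
have := mix X Y; set q := _ / n%:R => M.
have hw : g%:R * lam * (#|X|%:R * #|Y|%:R / n%:R) <= q - (edges e X Y)%:R.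
  have h1 : (edges e X Y)%:R <= q / 2.
    have : 2 * (edges e X Y)%:R <= q by rewrite /q ler_pdivlMr // mulrAC.
    by lra.
  have h2 : 2048 * (g%:R * lam * (#|X|%:R * #|Y|%:R / n%:R)) <= q.
    have -> : q = d%:R * (#|X|%:R * #|Y|%:R / n%:R) by rewrite /q !mulrA.
    by rewrite mulrA ler_wpM2r ?divr_ge0 ?(ltW xy0) // ?(ltW nn) // mulrA.
  have h3 : 0 <= g%:R * lam * (#|X|%:R * #|Y|%:R / n%:R) by rewrite mulr_ge0 // divr_ge0 // ltW.
  by move: h1 h2 h3; lra.
have : (g%:R * lam * (#|X|%:R * #|Y|%:R / n%:R)) ^+ 2 <= lam ^+ 2 * #|X|%:R * #|Y|%:R.
  have p0 : 0 <= g%:R * lam * (#|X|%:R * #|Y|%:R / n%:R).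
    by rewrite mulr_ge0 // divr_ge0 // ltW.
  by apply: le_trans M; rewrite -[leRHS]sqrrN opprB lerXn2r ?nnegrE ?p0 ?(le_trans p0 hw).
have -> : (g%:R * lam * (#|X|%:R * #|Y|%:R / n%:R)) ^+ 2 =
  lam ^+ 2 * (#|X|%:R * #|Y|%:R) * (g%:R ^+ 2 * #|X|%:R * #|Y|%:R / n%:R ^+ 2).
  by field; rewrite gt_eqF.
have n2 : 0 < n%:R ^+ 2 :> R by rewrite exprn_gt0.
have p : 0 < lam ^+ 2 * (#|X|%:R * #|Y|%:R) by rewrite mulr_gt0.
rewrite -[leRHS]mulrA -[leRHS]mulr1 (ler_pM2l p) (ler_pdivrMr _ _ n2) mul1r.
by rewrite -!natrX -!natrM ler_nat.
Qed.

End RegularGraph.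

Lemma expR_half (R : realType) : expR (2^-1 : R) <= 2.
Proof.
have h := expR_ge1Dx (- 2^-1 : R); have p := expR_gt0 (2^-1 : R).
have : expR (2^-1 : R) * expR (- 2^-1) = 1 by rewrite -expRD subrr expR0.
by move: h p; move: (expR _) (expR _) => a b; nra.
Qed.

(* [g] is of order [l = (ln n)^(1/3)], not of order [d / lam], so that [g ^ 20 <= n]
   for all [n] above an absolute constant. *)
Lemma parameters (R : realType) (n : nat) (l c : R) : (0 < n)%N ->
  8 * 128 * 128 + 4 <= c -> expR (8 ^+ 8 * c ^+ 20) <= n%:R -> l ^+ 3 = ln n%:R -> 0 <= l ->
  exists g j : nat, [/\ g%:R <= c * l, (128 * (8 * 128) <= g)%N, (g ^ 20 <= n)%N &
    [/\ (n < g * 2 ^ j)%N, (g * 2 ^ j <= 2 * n)%N & (2 * j + 4 <= g ^ 3)%N]].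
Proof.
move=> n0 hc hn hl l0; have nn : 0 < n%:R :> R by rewrite ltr0n.
set L := ln n%:R in hl; have eL : expR L = n%:R by rewrite lnK // posrE.
have c1 : 1 <= c by move: hc; lra.
have c0 : 0 <= c by apply: le_trans c1.
have hL : 8 ^+ 8 * c ^+ 20 <= L by rewrite -ler_expR eL.
have c20 : 1 <= c ^+ 20 by apply: exprn_ege1.
have L1 : 1 <= L.
  by apply: le_trans hL; rewrite -[leLHS]mul1r ler_pM //; apply: exprn_ege1; lra.
have l1 : 1 <= l.
  rewrite leNgt; apply/negP => lt1; have : l ^+ 3 < 1 by apply: exprn_ilt1.
  by rewrite hl ltNge L1.
have cl0 : 0 <= c * l by rewrite mulr_ge0.
pose g := Num.truncn (c * l).
have /andP[g_le g_gt] := truncn_itv cl0; rewrite -/g -natr1 in g_le g_gt.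
have g3l : 3 * l <= g%:R by nra.
have gK : (128 * (8 * 128) <= g)%N.
  rewrite -ltnS -(ltr_nat R) -natr1 !natrM; apply: le_lt_trans g_gt.
  by move: hc; nra.
have gn : (g ^ 20 <= n)%N.
  rewrite -(ler_nat R) natrX -eL.
  (* As [20 <= 21], [l ^ 20] is at most [L ^ 7]; against [(L / 8) ^ 8 <= expR L] this leaves one
     factor [L] to absorb [8 ^ 8 * c ^ 20]. *)
  have h1 : g%:R ^+ 20 <= c ^+ 20 * L ^+ 7.
    apply: le_trans (_ : (c * l) ^+ 20 <= _); first by rewrite lerXn2r ?nnegrE.
    rewrite exprMn -hl -exprM ler_wpM2l ?exprn_ge0 //.
    by apply: ler_weXn2l.
  apply: le_trans h1 _.
  have h2 : (L / 8) ^+ 8 <= expR L.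
    have -> : L = 8%:R * (L / 8) by rewrite mulrC divfK.
    rewrite expRM_natl mulrC mulKf //; apply: lerXn2r; rewrite ?nnegrE ?expR_ge0 ?divr_ge0 //; first by lra.
    by apply: le_trans (expR_ge1Dx _); rewrite lerDr.
  apply: le_trans h2; rewrite expr_div_n ler_pdivlMr ?exprn_gt0 // mulrAC mulrC [L ^+ 8]exprSr.
  by rewrite ler_wpM2l ?exprn_ge0 ?(le_trans ler01) // mulrC.
have g0 : (0 < g)%N by apply: leq_trans gK.
have g_n : (g <= n)%N.
  by apply: leq_trans gn; rewrite -[X in (X <= _)%N]expn1 leq_pexp2l.
have exj : exists k, (n < g * 2 ^ k)%N.
  by exists n; apply: leq_trans (ltn_expl n (isT : (1 < 2)%N)) _; rewrite leq_pmull.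
case: (ex_minnP exj) => j j_lo j_min; exists g, j; split=> //.
case: j j_lo j_min => [|j] j_lo j_min; first by move: j_lo; rewrite muln1 ltnNge g_n.
have hj : (g * 2 ^ j <= n)%N by rewrite leqNgt; apply/negP => /j_min; rewrite ltnn.
split=> //; first by rewrite expnS mulnCA leq_mul2l hj orbT.
(* From [2 ^ j <= n] and [expR_half]. So [j] is of order [l ^ 3], and the cube of [g >= 3 * l] is
   large enough. *)
have jL : j%:R <= 2 * L.
  have : expR (j%:R * 2^-1) <= expR L.
    rewrite expRM_natl eL; apply: le_trans (_ : 2 ^+ j <= _).
      by rewrite lerXn2r ?nnegrE ?expR_ge0 // expR_half.
    by rewrite -natrX ler_nat (leq_trans _ hj) // leq_pmull.
  by rewrite ler_expR; lra.
have : (2 * j.+1 + 4)%:R <= g%:R ^+ 3 :> R.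
  apply: le_trans (_ : (3 * l) ^+ 3 <= _); last by rewrite lerXn2r ?nnegrE ?mulr_ge0.
  by rewrite exprMn hl natrD natrM -natr1; lra.
by rewrite -natrX ler_nat.
Qed.

Theorem theorem1p2 (R : realType) :
  exists C : R, 0 < C /\
    forall (n d : nat) (lam : R) (e : rel 'I_n),
      (3 <= n)%N -> 0 < lam -> @ndl_graph R n d lam e ->
      C * (ln (n%:R : R)) `^ (3%:R^-1) <= d%:R / lam ->
      hamiltonian e.
Proof.
pose c : R := 8 * 128 * 128 + 4; pose M : R := expR (8 ^+ 8 * c ^+ 20).
have M0 : 0 < M by apply: expR_gt0.
have c0 : 4 <= c by rewrite /c; lra.
(* The summand [2048 * c] gives [2048 * g * lam <= d] for [g <= c * l], and [M] forces [n >= M]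
   through [degree_le], so small graphs never meet the condition. The factor 2 compensates for [l]
   being bounded below only by [1/2]. *)
exists (2 * (2048 * c + M)); split; first by lra.
move=> n d lam e n3 lam0 ndl; set l := _ `^ _ => hC.
have n0 : (0 < n)%N by apply: leq_trans n3.
have nn : 0 < n%:R :> R by rewrite ltr0n.
have L2 : 2^-1 <= ln (n%:R : R).
  rewrite -ler_expR lnK ?posrE //; apply: le_trans (expR_half R) _.
  by rewrite ler_nat ltnW.
have L0 : 0 <= ln (n%:R : R) by apply: le_trans L2; rewrite invr_ge0.
have l0 : 0 <= l by apply: powR_ge0.
have l3 : l ^+ 3 = ln n%:R.
  by rewrite -powR_mulrn // /l -powRrM mulVf ?powRr1 // pnatr_eq0.
have l2 : 2^-1 <= l.
  rewrite leNgt; apply/negP => lt.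
  have : l ^+ 3 <= 2^-1 ^+ 3 by rewrite lerXn2r ?nnegrE // ?ltW // invr_ge0.
  by rewrite l3 => h; move: h L2; lra.
have hC' : 2 * (2048 * c + M) * l * lam <= d%:R by rewrite -ler_pdivlMr.
have K1 : 1 < 2048 * c + M by lra.
have hM : (2048 * c + M) * lam <= d%:R.
  apply: le_trans hC'; move: l2 K1; move: (2048 * c + M) => K l2 K1.
  have h : 0 <= K * (2 * l - 1) * lam by rewrite !mulr_ge0 ?(ltW lam0) //; lra.
  by rewrite -subr_ge0; apply: le_trans h _; rewrite le_eqVlt; apply/orP; left; apply/eqP; ring.
have lam_d : lam < d%:R.
  by apply: lt_le_trans hM; rewrite -[ltLHS]mul1r ltr_pM2r.
have dn := @degree_le R n d lam e n0 lam0 lam_d ndl.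
have Mn : M <= n%:R.
  rewrite -(ler_pM2l lam0); apply: le_trans dn; apply: le_trans hM.
  by rewrite mulrC ler_wpM2r ?(ltW lam0) // lerDr; lra.
have [g [j [gl gK gn [j_lo j_hi j_g]]]] := @parameters R n l c n0 (lexx _) Mn l3 l0.
have hg : 2048 * g%:R * lam <= d%:R.
  apply: le_trans hC'; rewrite ler_wpM2r ?(ltW lam0) //.
  have h1 : 0 <= c * l by rewrite mulr_ge0 //; lra.
  have h2 : 0 <= M * l by rewrite mulr_ge0 ?(ltW M0).
  have -> : 2 * (2048 * c + M) * l = 4096 * (c * l) + 2 * (M * l) by ring.
  by move: gl h1 h2; move: (c * l) (M * l) (g%:R) => u v w; lra.
have PR := @pseudorandom_ndl R n d lam e n0 lam0 lam_d ndl g hg.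
have n20 : (g ^ 20 <= #|'I_n|)%N by rewrite card_ord.
have [[se ie] reg _] := ndl.
have n3' : (g ^ 3 <= #|'I_n|)%N.
  by apply: leq_trans n20; rewrite leq_pexp2l // (leq_trans _ gK).
have dK := deg_ge PR isT gK n3'.
have [||Z1 [Z2 [Z3 [d1 d2 d3 [d12 d13 d23]]]]] := @zones_exist _ e d se reg.
- by apply: leq_trans dK.
- by rewrite card_ord.
have [||p [up pT cp]] := @hamilton_of_zones _ e d (8 * 128) g j PR isT gK n20 _ _ j_g Z1 Z2 Z3 d1 d2 d3 d12 d13 d23.
- by rewrite card_ord.
- by rewrite card_ord.
exists p; split=> //; apply: uniq_perm => //; first exact: enum_uniq.
by move=> v; rewrite mem_enum pT.
Qed.
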